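(* Let $\mathcal P$ be a graph property such that $\mathcal P_n\neq\emptyset$ for infinitely many $n$, and let $f$ be a graph parameter. Then the extremal $(f,\mathcal P)$-problem is stable if and only if $\mathrm{LIM}(f,\mathcal P)$ consists of a single graphit $[W]$, where moreover the representative $W\in\mathcal W_I$ can be chosen to take only the values $0$ and $1$.
   Context: Let $I=[0,1]$ with Lebesgue measure $\mu$. $\mathcal W$ denotes the set of symmetric bounded functions $W:I^2\to\mathbb R$ that are measurable from the Lebesgue $\sigma$-algebra on $I^2$ to the Borel $\sigma$-algebra on $\mathbb R$ (graphons); $\mathcal W_I$ is the set of $W\in\mathcal W$ with values in $[0,1]$. $\Phi_0$ is the set of bijections $\phi:I\to I$ such that both $\phi$ and $\phi^{-1}$ are Lebesgue-to-Lebesgue measurable and measure preserving. For $W\in\mathcal W$ and $\phi:I\to I$ let $W^\phi(x,y)=W(\phi(x),\phi(y))$. The cut-norm of an integrable $W$ is $\|W\|_\Box=\sup_{S,T}|\int_{S\times T}W\,d\mu|$ over Lebesgue measurable $S,T\subseteq I$, and $\delta_\Box(U,W)=\inf_{\phi\in\Phi_0}\|U-W^\phi\|_\Box$. For $W\in\mathcal W_I$ let $[W]=\{U\in\mathcal W:\delta_\Box(U,W)=0\}$ (a graphit); $\delta_\Box$ induces a metric on the set $\mathcal X$ of graphits, which is compact. For a graph $G$ on $\{x_1,\dots,x_n\}$ define $W_G\in\mathcal W_I$ by $W_G(x,y)=1$ if $(x,y)\in[\frac{k-1}n,\frac kn)\times[\frac{l-1}n,\frac ln)$ and $\{x_k,x_l\}\in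 E(G)$, and $W_G(x,y)=0$ otherwise; the graphit $[W_G]$ does not depend on the labeling. A graph parameter is a real function on graphs invariant under isomorphism; a graph property is a class of graphs closed under isomorphism. $\mathcal P_n$ is the set of graphs in $\mathcal P$ with $n$ vertices, and $\mathrm{ex}_f(n,\mathcal P)=\max\{f(G):G\in\mathcal P_n\}$. $\mathrm{LIM}(f,\mathcal P)$ is the set of $x\in\mathcal X$ for which there exist indices $n_1<n_2<\cdots$ and graphs $G_{n_i}\in\mathcal P_{n_i}$ with $\lim_{i\to\infty}(f(G_{n_i})-\mathrm{ex}_f(n_i,\mathcal P))=0$ and $\lim_{i\to\infty}\delta_\Box([W_{G_{n_i}}],x)=0$. For graphs $G$ on $\{x_1,\dots,x_m\}$ and $H$ on $\{y_1,\dots,y_n\}$, $\delta_1(G,H)$ is the minimum, over non-negative $m\times n$ matrices $(\alpha_{i,j})$ with row sums $1/m$ and column sums $1/n$, of $\sum_{(i,j,g,h)\in\Delta}\alpha_{i,g}\alpha_{j,h}$, where $\Delta$ is the set of $(i,j,g,h)\in[m]^2\times[n]^2$ such that exactly one of $\{x_i,x_j\}\in E(G)$, $\{y_g,y_h\}\in E(H)$ holds. The extremal $(f,\mathcal P)$-problem is stable if for every $\varepsilon>0$ there are $\varepsilon'>0$ and $n_0$ such that for all $n_1,n_2\ge n_0$ and all graphs $G_1\in\mathcal P_{n_1}$, $G_2\in\mathcal P_{n_2}$ with $f(G_i)\ge \mathrm{ex}_f(n_i,\mathcal P)-\varepsilon'$ for $i=1,2$, we have $\delta_1(G_1,G_2)<\varepsilon$.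 *)

(* Defs.v *)
From HB Require Import structures.
From mathcomp Require Import all_boot all_order all_algebra all_fingroup.
From mathcomp Require Import all_classical all_reals all_analysis.

Set Implicit Arguments.
Unset Strict Implicit.
Unset Printing Implicit Defensive.

Import Order.TTheory GRing.Theory Num.Theory.
Import numFieldNormedType.Exports.

Local Open Scope classical_set_scope.
Local Open Scope ring_scope.

(** * Finite simple graphs on ['I_n] *)

(* The vertex x_k of a graph on {x_1, ..., x_n} is the ordinal k - 1. *)
Record sgraph (n : nat) := SGraph {
  edges : {set {set 'I_n}};
  edges_card2 : [forall e in edges, #|e| == 2] }.

HB.instance Definition _ n := [isSub for @edges n].
HB.instance Definition _ n := [Finite of sgraph n by <:].

(* [[set i; i]] has one element, so this relation is irreflexive. *)
Definition adj n (G : sgraph n) (i j : 'I_n) : bool := [set i; j]%SET \in edges G.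

Definition isomorphic n (G H : sgraph n) : Prop :=
  exists s : {perm 'I_n}, forall i j, adj H (s i) (s j) = adj G i j.

(* A class of graphs; [P n] is the set of its members on n vertices. *)
Definition graph_class := forall n : nat, set (sgraph n).

Definition graph_property (P : graph_class) : Prop :=
  forall n (G H : sgraph n), isomorphic G H -> P n G -> P n H.

Definition graph_parameter (R : realType) (f : forall n, sgraph n -> R) : Prop :=
  forall n (G H : sgraph n), isomorphic G H -> f n G = f n H.

(** * Kernels, cut norm and cut distance *)

(* The library's [lebesgue_measure] and its products live on the Borel sets.
   [line_L] and [plane_L] are [R] and [R * R] with the Lebesgue sigma-algebra, i.e.
   the sets that are Caratheodory measurable for the outer Lebesgue measure, and
   [completed_lebesgue_measure] and [leb2] are the Lebesgue measures on them. *)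
Definition leb2 {R : realType} : set _ -> \bar R :=
  @completed_measure_extension _ _ R (@lebesgue_measure R \x @lebesgue_measure R)%E.
HB.instance Definition _ (R : realType) := Measure.on (@leb2 R).

Notation line_L R := (caratheodory_type (@wlength R idfun)^*%mu).
Notation plane_L R :=
  (caratheodory_type (@lebesgue_measure R \x @lebesgue_measure R)%E^*%mu).

Section Graphons.
Variable R : realType.

Definition unitI : set R := `[0, 1]%classic.

(* A function on [unitI `*` unitI] is represented by a total function; no
   definition below depends on its values outside that square. *)
Definition sqfun : Type := R * R -> R.

Definition is_graphon (W : sqfun) : Prop :=
  [/\ forall x y, unitI x -> unitI y -> W (x, y) = W (y, x),
      exists M : R, forall x y, unitI x -> unitI y -> `|W (x, y)| <= M
    & measurable_fun (unitI `*` unitI : set (plane_L R)) (W : plane_L R -> R)].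

Definition is_graphonI (W : sqfun) : Prop :=
  is_graphon W /\ forall x y, unitI x -> unitI y -> 0 <= W (x, y) <= 1.

Definition measure_preserving (phi : R -> R) : Prop :=
  measurable_fun (unitI : set (line_L R)) (phi : line_L R -> line_L R) /\
  forall A : set (line_L R), measurable A -> A `<=` unitI ->
    completed_lebesgue_measure (unitI `&` phi @^-1` A) = completed_lebesgue_measure A.

(* [psi] is the inverse of the bijection that [phi] induces on [unitI]. *)
Definition Phi0 : set (R -> R) :=
  [set phi | exists psi : R -> R,
    [/\ {homo phi : x / unitI x}, {homo psi : x / unitI x},
        (forall x, unitI x -> psi (phi x) = x),
        (forall x, unitI x -> phi (psi x) = x) &
        measure_preserving phi /\ measure_preserving psi]].

Definition pullback (W : sqfun) (phi : R -> R) : sqfun :=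
  fun p => W (phi p.1, phi p.2).

Definition cut_norm (W : sqfun) : R :=
  sup [set r | exists S T : set (line_L R),
    [/\ measurable S, measurable T, S `<=` unitI, T `<=` unitI &
        r = `| \int[leb2]_(p in (S `*` T : set (plane_L R))) W p |]].

Definition cut_dist (U W : sqfun) : R :=
  inf [set cut_norm (U \- pullback W phi) | phi in Phi0].

Definition graphit (W : sqfun) : set sqfun :=
  [set U | is_graphon U /\ cut_dist U W = 0].

Definition graphits : set (set sqfun) := [set graphit W | W in is_graphonI].

(* The metric induced by [cut_dist] on graphits: on two graphits [cut_dist] does
   not depend on the representatives, so the infimum is over a singleton. *)
Definition graphit_dist (x y : set sqfun) : R :=
  inf [set r | exists U W, [/\ x U, y W & r = cut_dist U W]].

Definition graphon_of_graph n (G : sgraph n) : sqfun := fun p =>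
  [exists k : 'I_n, exists l : 'I_n,
    [&& p.1 \in `[k%:R / n%:R, k.+1%:R / n%:R[,
        p.2 \in `[l%:R / n%:R, l.+1%:R / n%:R[ & adj G k l]]%:R.

(** * Extremal problems *)

Implicit Types (P : graph_class) (f : forall n, sgraph n -> R).

(* There are finitely many graphs on ['I_n], so for nonempty [P n] this supremum
   is a maximum (lemma [ex_maxP]). *)
Definition ex_max f P (n : nat) : R := sup [set f n G | G in P n].

Definition LIM f P : set (set sqfun) :=
  [set x | graphits x /\
    exists (n : nat -> nat) (G : forall i, sgraph (n i)),
      [/\ {homo n : i j / (i < j)%N},
          (forall i, P (n i) (G i)),
          (f (n i) (G i) - ex_max f P (n i)) @[i --> \oo] --> (0 : R) &
          graphit_dist (graphit (graphon_of_graph (G i))) x @[i --> \oo]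
            --> (0 : R)]].

Definition is_overlay m n (a : 'M[R]_(m, n)) : Prop :=
  [/\ forall i g, 0 <= a i g,
      forall i, \sum_(g < n) a i g = m%:R^-1
    & forall g, \sum_(i < m) a i g = n%:R^-1].

(* For m, n > 0 the infimum of a continuous function over a nonempty compact
   polytope, hence a minimum. *)
Definition delta1 m n (G : sgraph m) (H : sgraph n) : R :=
  inf [set \sum_(i < m) \sum_(j < m) \sum_(g < n)
             \sum_(h < n | adj G i j (+) adj H g h) a i g * a j h
      | a in @is_overlay m n].

Definition stable f P : Prop :=
  forall eps : R, 0 < eps ->
  exists2 eps' : R, 0 < eps' & exists n0 : nat,
  forall n1 n2 : nat, (n0 <= n1)%N -> (n0 <= n2)%N ->
  forall (G1 : sgraph n1) (G2 : sgraph n2), P n1 G1 -> P n2 G2 ->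
    ex_max f P n1 - eps' <= f n1 G1 -> ex_max f P n2 - eps' <= f n2 G2 ->
    delta1 G1 G2 < eps.

End Graphons.

Arguments unitI {R}.

Lemma ex_maxP (R : realType) (f : forall n, sgraph n -> R) (P : graph_class) n :
  P n !=set0 ->
  exists2 G, P n G & f n G = ex_max f P n /\ forall H, P n H -> f n H <= f n G.
Proof.
move=> [G0 PG0].
have p0 : `[< P n G0 >] by apply/asboolP.
case: (@arg_maxP _ _ _ _ (fun G => `[< P n G >]) (f n) p0) => G /asboolP PG maxG.
have le H : P n H -> f n H <= f n G by move=> PH; apply: maxG; apply/asboolP.
exists G => //; split => //; apply/eqP; rewrite eq_le; apply/andP; split.
  apply: ub_le_sup; last by exists G.
  by exists (f n G) => _ [H PH <-]; exact: le.
by apply: ge_sup; [exists (f n G), G | move=> _ [H PH <-]; exact: le].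
Qed.

(* Main.v *)
(* For graphs G and H, the fractional overlays are exactly the matrices
   mu (I_i & phi^-1 J_g) for phi in Phi_0 (an overlay is realised by an interval
   exchange), so delta_1 (G, H) is the infimum of the L1 norms of W_G - W_H^phi.

   If the problem is stable, a suitable sequence of extremal graphs is Cauchy for
   delta_1. After relabelling, their kernels are Cauchy in L1, their limit can be
   rounded to a 0/1-valued W, and all nearly extremal graphs converge to W.

   Conversely, let LIM = {[W]} with W 0/1-valued. By compactness, large nearly
   extremal graphs are close to W in cut distance. If U -> W in cut norm then
   the integral of U - W over every measurable set A of the plane tends to 0 (a
   Dynkin class argument, starting from rectangles); taking A = {W = 0} and
   A = {W = 1} gives U -> W in L1, hence two such graphs are close in delta_1.

   Compactness: by Frieze-Kannan weak regularity, graphs are coloured with finitely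
   many colours such that graphs of the same colour are close in cut distance, so
   every sequence of graphs has a Cauchy subsequence, relabelled to F_n with
   |F_n - F_(n+1)| <= 2^-n in cut norm. The sets {V : |V - F_n| <= 2 * 2^-n} are
   convex and nested, and elements of nearly minimal L2 norm converge in L2 by the
   parallelogram identity. *)

Require Import Defs.
From mathcomp Require Import all_boot all_order all_algebra.
From mathcomp Require Import all_classical all_reals all_analysis.
From mathcomp Require Import lra measurable_realfun.

Set Implicit Arguments.
Unset Strict Implicit.
Unset Printing Implicit Defensive.

Import Order.TTheory GRing.Theory Num.Theory.
Import numFieldNormedType.Exports.

Local Open Scope classical_set_scope.
Local Open Scope ring_scope.

(** * Weak regularity and finite colourings *)

(** Weak regularity serves only as a finite classification: the colour of a graph records the signs
    of its rectangles and the rounded frequencies of its vertex types, and equality of colours is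
    turned into an explicit overlay. Testing an overlay against measurable sets produces fractional
    weights on pairs of vertices, so the finite estimates are made for bilinear forms whose weights
    are bounded by the overlay. A Cauchy sequence for the cut norm need not converge in L1 or
    pointwise; its terms are therefore replaced by other kernels of nearly minimal L2 norm near
    them. This yields a limit with values in [0,1] only. Rounding is possible for stable problems
    because there the 0/1-valued kernels themselves converge in L1. The measure-theoretic obstacle
    is that the Lebesgue sets of the plane are not the product sigma-algebra of the Lebesgue sets of
    the line: rectangles, relabellings and the Dynkin argument all pass through Borel sets and null
    sets. *)

Section FriezeKannan.
Variable R : realType.

(** A linear form on the cube [0,1]^I is largest at the indicator of {c > 0} and smallest at that of
    {c < 0}. *)
Lemma weighted_sum_bound (I : finType) (c : I -> R) (B : R) :
  (forall S : {set I}, `|\sum_(i in S) c i| <= B) ->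
  forall u : I -> R, (forall i, 0 <= u i <= 1) -> `|\sum_i u i * c i| <= B.
Proof.
move=> cB u u01; rewrite ler_norml; apply/andP; split.
  have := cB [set i | c i < 0]%SET; rewrite ler_norml => /andP[+ _].
  move=> /le_trans; apply; rewrite big_mkcond; apply: ler_sum => i _.
  have /andP[u0 u1] := u01 i; rewrite inE; case: ltP => c0; nra.
have := cB [set i | 0 < c i]%SET; rewrite ler_norml => /andP[_].
apply: le_trans; rewrite [leRHS]big_mkcond; apply: ler_sum => i _.
have /andP[u0 u1] := u01 i; rewrite inE; case: ltP => c0; nra.
Qed.

(** The form is linear in [u] and in [v] separately, so sets can be replaced by fractional weights
    one variable at a time. Overlays split vertices, which is why fractional weights are needed. *)
Lemma bilinear_bound (I J : finType) (D : I -> J -> R) (B : R) :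
  (forall (S : {set I}) (T : {set J}),
     `|\sum_(i in S) \sum_(j in T) D i j| <= B) ->
  forall u v, (forall i, 0 <= u i <= 1) -> (forall j, 0 <= v j <= 1) ->
  `|\sum_i \sum_j D i j * (u i * v j)| <= B.
Proof.
move=> DB u v u01 v01.
have -> : \sum_i \sum_j D i j * (u i * v j) =
    \sum_i u i * \sum_j v j * D i j.
  apply: eq_bigr => i _; rewrite mulr_sumr; apply: eq_bigr => j _.
  by rewrite mulrCA (mulrC (D i j)).
apply: weighted_sum_bound => // S.
rewrite exchange_big /=; under eq_bigr do rewrite -mulr_sumr.
apply: weighted_sum_bound => // T.
by rewrite exchange_big /=; exact: DB.
Qed.

(* A vertex is described by its membership in the [2 * M] sets of the [M]
   rectangles [S_k * T_k] of the decomposition. *)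
Definition vtype (M : nat) : finType := {ffun 'I_M -> bool * bool}.

(** Every coefficient is [eps] or [- eps], so for fixed [eps] and [M] there are only finitely many
    such functions; this keeps the set of colours finite. *)
Definition rects (eps : R) M (c : {ffun 'I_M -> bool}) (a b : vtype M) : R :=
  \sum_k (eps * (-1) ^+ c k * ((a k).1 && (b k).2)%:R).

Lemma rects_bound eps M (c : {ffun 'I_M -> bool}) a b : 0 <= eps ->
  `|rects eps c a b| <= eps * M%:R.
Proof.
move=> e0; apply: le_trans (ler_norm_sum _ _ _) _.
apply: (@le_trans _ _ (\sum_(k < M) eps)); last first.
  by rewrite sumr_const card_ord mulr_natr.
apply: ler_sum => k _; rewrite !normrM normrX normrN1 expr1n mulr1 ger0_norm//.
by rewrite ger0_norm// ler_piMr// lern1 leq_b1.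
Qed.

(* Each rectangle of correlation more than [eps n^2] that is subtracted with
   coefficient [eps] decreases the squared norm by at least [eps^2 n^2]. *)
Lemma weak_regularity (eps : R) n M : 0 < eps ->
  forall A : 'I_n -> 'I_n -> R,
  \sum_i \sum_j A i j ^+ 2 <= M%:R * (eps * n%:R) ^+ 2 ->
  exists (c : {ffun 'I_M -> bool}) (t : 'I_n -> vtype M),
  forall S T : {set 'I_n},
    `|\sum_(i in S) \sum_(j in T) (A i j - rects eps c (t i) (t j))|
      <= eps * n%:R ^+ 2.
Proof.
move=> e0; have en0 : 0 <= eps * n%:R ^+ 2 by rewrite mulr_ge0 ?exprn_ge0// ltW.
elim: M => [|M IH] A.
  (* Without rectangles the norm bound forces [A = 0], so any types serve. *)
  rewrite mul0r => A0.
  exists [ffun=> true], (fun=> [ffun=> (true, true)]) => S T.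
  rewrite big1 ?normr0// => i _; rewrite big1// => j _.
  rewrite /rects big_ord0 subr0; apply/eqP; rewrite -sqrf_eq0.
  have s0 k : true -> 0 <= \sum_j A k j ^+ 2.
    by move=> _; apply: sumr_ge0 => ? _; exact: sqr_ge0.
  have /eqP : \sum_i \sum_j A i j ^+ 2 = 0.
    by apply/eqP; rewrite eq_le A0 sumr_ge0.
  rewrite psumr_eq0// => /allP/(_ i); rewrite mem_index_enum => /(_ isT)/=.
  rewrite psumr_eq0; last by move=> ? _; exact: sqr_ge0.
  by move=> /allP/(_ j); rewrite mem_index_enum => /(_ isT).
move=> AM.
have [reg|] := pselect (forall S T : {set 'I_n},
    `|\sum_(i in S) \sum_(j in T) A i j| <= eps * n%:R ^+ 2).
  (* All remaining rectangles are taken empty. *)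
  exists [ffun=> true], (fun=> [ffun=> (false, false)]) => S T.
  rewrite (eq_bigr (fun i => \sum_(j in T) A i j)) => [|i _]; first exact: reg.
  apply: eq_bigr => j _; rewrite /rects big1 ?subr0// => k _.
  by rewrite !ffunE mulr0.
move=> /existsNP[S /existsNP[T /negP]]; rewrite -ltNge => big.
pose s := \sum_(i in S) \sum_(j in T) A i j.
(* With this sign the correlation of [A] with the signed rectangle is [|s|], which exceeds
   [eps * n ^ 2]. *)
pose b := s < 0.
have sb : (-1) ^+ b * s = `|s|.
  rewrite /b; case: ltP => s0; first by rewrite expr1 mulN1r ltr0_norm.
  by rewrite expr0 mul1r ger0_norm.
pose D i j : R := ((i \in S) && (j \in T))%:R.
pose A' i j := A i j - eps * (-1) ^+ b * D i j.
have sD : \sum_i \sum_j D i j * A i j = s.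
  rewrite /s [RHS]big_mkcond /=; apply: eq_bigr => i _.
  rewrite /D; case: (i \in S) => /=.
    rewrite [RHS]big_mkcond /=; apply: eq_bigr => j _.
    by case: (j \in T); rewrite ?mul1r ?mul0r.
  by rewrite big1// => j _; rewrite mul0r.
have sDD : \sum_i \sum_j D i j <= n%:R ^+ 2.
  apply: (@le_trans _ _ (\sum_(i < n) \sum_(j < n) 1)).
    by apply: ler_sum => i _; apply: ler_sum => j _; rewrite lern1 leq_b1.
  by rewrite !sumr_const !card_ord -natrX -mulnn mulrnA.
have [|c [t ct]] := IH A'.
  (* The cross term removes at least [2 eps^2 n^2], and the square of the rectangle restores at most
     [eps^2 n^2]. *)
  have -> : \sum_i \sum_j A' i j ^+ 2 = \sum_i \sum_j A i j ^+ 2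
      - 2 * eps * ((-1) ^+ b * s) + eps ^+ 2 * \sum_i \sum_j D i j.
    rewrite -sD !mulr_sumr -sumrB -big_split/=; apply: eq_bigr => i _.
    rewrite !mulr_sumr -sumrB -big_split/=; apply: eq_bigr => j _.
    have DD : D i j ^+ 2 = D i j by rewrite /D; case: andb; rewrite ?expr1n ?expr0n.
    have bb : ((-1) ^+ b) ^+ 2 = 1 :> R by rewrite sqrr_sign.
    rewrite /A' sqrrB !exprMn bb DD; move: ((-1) ^+ b) => sg; lra.
  rewrite sb; move: AM big; rewrite -/s -natr1 mulrDl mul1r exprMn.
  move: (\sum_i \sum_j A i j ^+ 2) (\sum_i \sum_j D i j) sDD `|s| => X Y hY a.
  have : eps ^+ 2 * Y <= eps ^+ 2 * n%:R ^+ 2 by rewrite ler_wpM2l ?sqr_ge0.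
  move=> h1 h2 h3.
  have : eps * (eps * n%:R ^+ 2) <= eps * a by rewrite ler_wpM2l// ltW.
  by rewrite mulrA -expr2; lra.
(* Index 0 carries the new rectangle [S x T], the other indices those found for [A']. *)
exists [ffun k => oapp c b (unlift ord0 k)],
  (fun i => [ffun k => oapp (t i) (i \in S, i \in T) (unlift ord0 k)]) => S' T'.
rewrite (eq_bigr (fun i => \sum_(j in T') (A' i j - rects eps c (t i) (t j)))).
  exact: ct.
move=> i _; apply: eq_bigr => j _.
rewrite {1}/rects big_ord_recl !ffunE unlift_none /= opprD addrA; congr (_ - _).
by apply: eq_bigr => k _; rewrite !ffunE liftK.
Qed.

End FriezeKannan.

(** * Couplings that match vertex types *)

Section TypeCoupling.
Variables (R : realType) (K : finType).

Definition freq n (t : 'I_n -> K) (a : K) : R := #|[set i | t i == a]%SET|%:R / n%:R.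

Lemma freq_ge0 n (t : 'I_n -> K) a : 0 <= freq t a.
Proof. by rewrite divr_ge0. Qed.

Lemma freq_gt0 n (t : 'I_n -> K) i : 0 < freq t (t i).
Proof.
rewrite divr_gt0// ltr0n; last by apply: leq_ltn_trans (ltn_ord i).
by apply/card_gt0P; exists i; rewrite inE.
Qed.

Lemma sum_by_type n (t : 'I_n -> K) (F : K -> R) :
  (0 < n)%N -> \sum_i F (t i) = \sum_a F a * (freq t a * n%:R).
Proof.
move=> n0; rewrite (partition_big t xpredT)//=; apply: eq_bigr => a _.
rewrite /freq divfK ?pnatr_eq0 -?lt0n// (eq_bigr (fun=> F a)) => [|i /eqP->//].
by rewrite sumr_const mulr_natr; congr (_ *+ _); apply: eq_card => i; rewrite !inE.
Qed.

Lemma sum_freq n (t : 'I_n -> K) : (0 < n)%N -> \sum_a freq t a = 1.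
Proof.
move=> n0; have := sum_by_type t (fun=> 1) n0.
rewrite sumr_const card_ord (eq_bigr (fun a => freq t a * n%:R)); last first.
  by move=> a _; rewrite mul1r.
rewrite -mulr_suml => /(congr1 (fun x => x / n%:R)).
by rewrite mulfK ?divff// pnatr_eq0 -lt0n.
Qed.

Variables (m n : nat) (s : 'I_m -> K) (t : 'I_n -> K).

Definition freqmin a := Num.min (freq s a) (freq t a).

(** The total variation distance of the two type distributions: the mass that no coupling can match
    within types. *)
Definition excess := 1 - \sum_a freqmin a.

Lemma excessl : (0 < m)%N -> excess = \sum_a (freq s a - freqmin a).
Proof. by move=> m0; rewrite sumrB sum_freq. Qed.

Lemma excess_le (d : R) : (0 < m)%N ->
  (forall a, `|freq s a - freq t a| <= d) -> excess <= #|K|%:R * d.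
Proof.
move=> m0 pq; rewrite excessl// -sum1_card natr_sum mulr_suml.
apply: ler_sum => a _; rewrite mul1r; apply: le_trans (pq a).
rewrite /freqmin; case: (leP (freq s a)) => h; first by rewrite subrr.
exact: ler_norm.
Qed.

End TypeCoupling.

Lemma freqminC (R : realType) (K : finType) m n (s : 'I_m -> K) (t : 'I_n -> K) a :
  freqmin R s t a = freqmin R t s a.
Proof. by rewrite /freqmin minC. Qed.

Lemma excessC (R : realType) (K : finType) m n (s : 'I_m -> K) (t : 'I_n -> K) :
  excess R s t = excess R t s.
Proof. by rewrite /excess; under eq_bigr do rewrite freqminC. Qed.

Section Coupling.
Variables (R : realType) (K : finType).

(** The unmatched mass of the type of [i], divided equally among the vertices of that type. *)
Definition rest m n (s : 'I_m -> K) (t : 'I_n -> K) (i : 'I_m) : R :=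
  (freq R s (s i) - freqmin R s t (s i)) / (freq R s (s i) * m%:R).

(* Within each type vertices are matched uniformly as far as the frequencies
   allow; what remains is matched by a product coupling. *)
Definition coupling m n (s : 'I_m -> K) (t : 'I_n -> K) : 'M[R]_(m, n) :=
  \matrix_(i, g) ((s i == t g)%:R * freqmin R s t (s i) /
      (freq R s (s i) * m%:R * (freq R t (s i) * n%:R))
    + rest s t i * rest t s g / excess R s t).

Lemma rest_ge0 m n (s : 'I_m -> K) (t : 'I_n -> K) i : 0 <= rest s t i.
Proof.
rewrite divr_ge0// ?mulr_ge0// ?freq_ge0// subr_ge0.
by rewrite /freqmin ge_min lexx.
Qed.

Lemma sum_rest m n (s : 'I_m -> K) (t : 'I_n -> K) : (0 < m)%N ->
  \sum_i rest s t i = excess R s t.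
Proof.
move=> m0; rewrite excessl//.
rewrite (sum_by_type s (fun a => (freq R s a - freqmin R s t a) / (freq R s a * m%:R)))//.
apply: eq_bigr => a _.
have [p0|p0] := eqVneq (freq R s a) 0; last first.
  by rewrite divfK// mulf_neq0// pnatr_eq0 -lt0n.
rewrite p0 mul0r mulr0 /freqmin p0; have := freq_ge0 R t a.
by case: leP => // _ _; rewrite subrr.
Qed.

Lemma excess_ge0 m n (s : 'I_m -> K) (t : 'I_n -> K) : (0 < m)%N ->
  0 <= excess R s t.
Proof. by move=> m0; rewrite -sum_rest// sumr_ge0// => i _; exact: rest_ge0. Qed.

Lemma coupling_ge0 m n (s : 'I_m -> K) (t : 'I_n -> K) i g :
  (0 < m)%N -> 0 <= coupling s t i g.
Proof.
move=> m0; rewrite mxE addr_ge0//.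
  by rewrite divr_ge0// ?mulr_ge0// ?freq_ge0// /freqmin le_min !freq_ge0.
by rewrite divr_ge0 ?excess_ge0// mulr_ge0 ?rest_ge0.
Qed.

Lemma coupling_row m n (s : 'I_m -> K) (t : 'I_n -> K) i : (0 < m)%N -> (0 < n)%N ->
  \sum_g coupling s t i g = m%:R^-1.
Proof.
move=> m0 n0; under eq_bigr do rewrite mxE.
rewrite big_split/= -!mulr_suml -mulr_sumr sum_rest// [excess R t s]excessC.
have -> : \sum_g (s i == t g)%:R = freq R t (s i) * n%:R.
  rewrite (sum_by_type t (fun a => (s i == a)%:R))// (bigD1 (s i))//= eqxx mul1r.
  by rewrite big1 ?addr0// => a; rewrite eq_sym => /negbTE ->; rewrite mul0r.
have p0 := freq_gt0 R s i.
have mR : 0 < m%:R :> R by rewrite ltr0n.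
have nR : 0 < n%:R :> R by rewrite ltr0n.
have -> : rest s t i * excess R s t / excess R s t = rest s t i.
  (* If the excess is 0, the quotient is 0 by convention; the nonnegative [rest] then sums to 0 and
     vanishes as well. *)
  have [e0|e0] := eqVneq (excess R s t) 0; last by rewrite mulfK.
  rewrite e0 invr0 mulr0; apply/esym/eqP.
  move: (sum_rest s t m0); rewrite e0 => /eqP.
  rewrite psumr_eq0 => [/allP/(_ i)|j _]; last exact: rest_ge0.
  by rewrite mem_index_enum => /(_ isT).
have -> : freq R t (s i) * n%:R * freqmin R s t (s i) /
    (freq R s (s i) * m%:R * (freq R t (s i) * n%:R)) =
    freqmin R s t (s i) / (freq R s (s i) * m%:R).
  have [q0|q0] := eqVneq (freq R t (s i)) 0.
    rewrite q0 !mul0r; apply/esym; rewrite /freqmin q0.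
    by case: leP; rewrite ?mul0r// leNgt p0.
  have qn : freq R t (s i) * n%:R != 0 by rewrite mulf_neq0// gt_eqF.
  by rewrite [_ * freqmin R s t _]mulrC invfM mulrACA divff// mulr1.
rewrite /rest -mulrDl addrC subrK invfM mulrA divff ?mul1r//.
by rewrite gt_eqF.
Qed.

Lemma couplingC m n (s : 'I_m -> K) (t : 'I_n -> K) i g :
  coupling s t i g = coupling t s g i.
Proof.
rewrite !mxE eq_sym excessC [rest s t i * _]mulrC; congr (_ + _).
case: eqP => [->|_]; last by rewrite !mul0r.
by rewrite freqminC [X in _ / X]mulrC.
Qed.

Lemma coupling_overlay m n (s : 'I_m -> K) (t : 'I_n -> K) :
  (0 < m)%N -> (0 < n)%N -> is_overlay (coupling s t).
Proof.
move=> m0 n0; split=> *; first exact: coupling_ge0.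
- exact: coupling_row.
- by under eq_bigr do rewrite couplingC; exact: coupling_row.
Qed.

(** Pairs of different types receive mass only from the product term, whose total mass is the
    excess. *)
Lemma coupling_off_diagonal m n (s : 'I_m -> K) (t : 'I_n -> K) :
  (0 < m)%N -> (0 < n)%N ->
  \sum_(x : 'I_m * 'I_n | s x.1 != t x.2) coupling s t x.1 x.2 <= excess R s t.
Proof.
move=> m0 n0.
apply: (@le_trans _ _ (\sum_i \sum_g rest s t i * rest t s g / excess R s t)).
  rewrite pair_big/= big_mkcond/=; apply: ler_sum => -[i g] _ /=.
  case: eqP => [_|/eqP/negbTE st] /=; last by rewrite mxE st !mul0r add0r.
  apply: divr_ge0; [by apply: mulr_ge0; exact: rest_ge0|exact: excess_ge0].
rewrite (eq_bigr (fun i => rest s t i * excess R s t / excess R s t)); last first.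
  by move=> i _; rewrite -mulr_suml -mulr_sumr sum_rest// excessC.
rewrite -!mulr_suml sum_rest//.
have [->|e0] := eqVneq (excess R s t) 0; first by rewrite !mul0r.
by rewrite mulfK.
Qed.

End Coupling.

(** * Colours of graphs *)

Section Colouring.
Variable R : realType.

Definition adjR n (G : sgraph n) i j : R := (adj G i j)%:R.

Definition regular (eps : R) M n (G : sgraph n)
    (ct : {ffun 'I_M -> bool} * ('I_n -> vtype M)) : Prop :=
  forall S T : {set 'I_n},
    `|\sum_(i in S) \sum_(j in T) (adjR G i j - rects eps ct.1 (ct.2 i) (ct.2 j))|
      <= eps * n%:R ^+ 2.

Lemma regular_exists (eps : R) M n (G : sgraph n) :
  0 < eps -> 1 <= M%:R * eps ^+ 2 -> exists ct, @regular eps M n G ct.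
Proof.
move=> e0 eM; have [|c [t ct]] := @weak_regularity R eps n M e0 (adjR G).
  apply: (@le_trans _ _ (\sum_(i < n) \sum_(j < n) 1)).
    apply: ler_sum => i _; apply: ler_sum => j _.
    by rewrite /adjR; case: adj; rewrite ?expr1n ?expr0n.
  rewrite !sumr_const !card_ord -mulrnA mulnn natrX exprMn mulrA.
  by rewrite ler_peMl// sqr_ge0.
by exists (c, t).
Qed.

Lemma marginals (I J : finType) (D : I -> I -> R) (u v : I * J -> R) :
  \sum_x \sum_y D x.1 y.1 * (u x * v y) =
  \sum_i \sum_j D i j * ((\sum_g u (i, g)) * \sum_h v (j, h)).
Proof.
transitivity (\sum_i \sum_g \sum_j \sum_h D i j * (u (i, g) * v (j, h))).
  rewrite [RHS]pair_bigA/=; apply: eq_bigr => -[i g] _ /=.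
  by rewrite [RHS]pair_bigA/=; apply: eq_bigr => -[j h] _.
apply: eq_bigr => i _.
rewrite exchange_big/=; apply: eq_bigr => j _.
rewrite mulr_suml mulr_sumr; apply: eq_bigr => g _.
by rewrite -mulr_sumr -mulr_sumr.
Qed.

(** Summing out the second coordinate leaves weights of at most [1/n] on the vertices; multiplied by
    [n] they lie in [0,1], and the factor [n^2] of the regularity bound cancels. *)
Lemma regular_bound (eps : R) M n (G : sgraph n) ct (J : finType)
    (u v : 'I_n * J -> R) : @regular eps M n G ct -> (0 < n)%N ->
  (forall x, 0 <= u x) -> (forall x, 0 <= v x) ->
  (forall i, \sum_g u (i, g) <= n%:R^-1) -> (forall i, \sum_g v (i, g) <= n%:R^-1) ->
  `|\sum_x \sum_y (adjR G x.1 y.1 - rects eps ct.1 (ct.2 x.1) (ct.2 y.1))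
       * (u x * v y)| <= eps.
Proof.
move=> rG n0 u0 v0 u1 v1.
have nR : 0 < n%:R :> R by rewrite ltr0n.
rewrite (marginals (fun i j => adjR G i j - rects eps ct.1 (ct.2 i) (ct.2 j))).
have w01 (w : 'I_n * J -> R) : (forall x, 0 <= w x) ->
    (forall i, \sum_g w (i, g) <= n%:R^-1) ->
    forall i, 0 <= n%:R * \sum_g w (i, g) <= 1.
  move=> w0 w1 i; rewrite mulr_ge0 ?sumr_ge0//=.
  by rewrite mulrC -ler_pdivlMr// mul1r.
have := bilinear_bound rG (w01 _ u0 u1) (w01 _ v0 v1).
set U := fun i => \sum_g u (i, g); set V := fun i => \sum_g v (i, g).
have -> : \sum_i \sum_j (adjR G i j - rects eps ct.1 (ct.2 i) (ct.2 j)) *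
      (n%:R * U i * (n%:R * V j)) = n%:R * n%:R *
    \sum_i \sum_j (adjR G i j - rects eps ct.1 (ct.2 i) (ct.2 j)) * (U i * V j).
  rewrite mulr_sumr; apply: eq_bigr => i _; rewrite mulr_sumr.
  by apply: eq_bigr => j _; rewrite mulrACA [LHS]mulrCA.
rewrite normrM ger0_norm; last by rewrite mulr_ge0 ?ltW.
by rewrite [leRHS]mulrC expr2 ler_pM2l// mulr_gt0.
Qed.

(** The colour consists of the signs of the rectangles and, for each type, [N] times its frequency
    rounded down. Graphs of one colour share the function [rects] and have close type distributions,
    so the type coupling makes their regularised kernels nearly agree. *)
Lemma coloring (eps : R) : 0 < eps ->
  exists (T : finType) (col : forall n, sgraph n -> T),
  forall m n (G : sgraph m) (H : sgraph n), (0 < m)%N -> (0 < n)%N ->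
    col m G = col n H ->
  exists2 a : 'M[R]_(m, n), is_overlay a &
  forall u v : 'I_m * 'I_n -> R,
    (forall x, 0 <= u x <= a x.1 x.2) -> (forall x, 0 <= v x <= a x.1 x.2) ->
    `|\sum_x \sum_y (adjR G x.1 y.1 - adjR H x.2 y.2) * (u x * v y)| <= eps.
Proof.
move=> eps0; pose e := eps / 3.
have e0 : 0 < e by rewrite divr_gt0.
pose M := (Num.truncn (e ^- 2)).+1.
have eM : 1 <= M%:R * e ^+ 2.
  rewrite -ler_pdivrMr ?exprn_gt0// mul1r ltW//.
  by rewrite /M truncnS_gt.
(* The excess will be at most [#|vtype M| / N]; this [N] brings the mismatch term, at most
   [4 * e * M] times the excess, below [e]. *)
pose N := (4 * M * #|vtype M|).+1.
pose ch n (G : sgraph n) := projT1 (cid (regular_exists G e0 eM)).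
have chP n (G : sgraph n) : regular e G (ch n G).
  by rewrite /ch; case: cid.
pose num n (G : sgraph n) (a : vtype M) :=
  (N * #|[set i | (ch n G).2 i == a]%SET| %/ n)%N.
pose T : finType := ({ffun 'I_M -> bool} * {ffun vtype M -> 'I_N.+1})%type.
exists T, (fun n G => ((ch n G).1, [ffun a => inord (num n G a)])).
move=> m n G H m0 n0 [cE /ffunP nE].
have numlt k (F : sgraph k) a : (0 < k)%N -> (num k F a < N.+1)%N.
  move=> k0; rewrite ltnS /num -{2}(mulnK N k0) leq_div2r// leq_mul2l.
  by apply/orP; right; apply: leq_trans (max_card _) _; rewrite card_ord.
have freqE k (F : sgraph k) a : (0 < k)%N ->
    (num k F a)%:R <= N%:R * freq R (ch k F).2 a < (num k F a)%:R + 1.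
  move=> k0; have kR : 0 < k%:R :> R by rewrite ltr0n.
  rewrite /freq mulrA ler_pdivlMr// ltr_pdivrMr// natr1 -!natrM ler_nat ltr_nat.
  by rewrite leq_trunc_div/= ltn_ceil.
have NR : 0 < N%:R :> R by rewrite ltr0n.
(* Equal integer parts of [N * freq] leave the frequencies at distance at most [1/N]. *)
have close a : `|freq R (ch m G).2 a - freq R (ch n H).2 a| <= N%:R^-1.
  have /(congr1 (@nat_of_ord _)) := nE a; rewrite !ffunE !inordK ?numlt// => E.
  have := freqE _ G a m0; have := freqE _ H a n0; rewrite E.
  move: (freq R _ a) (freq R _ a) => x y hx hy.
  rewrite -[N%:R^-1]mul1r ler_pdivlMr// -(gtr0_norm NR) -normrM mulrBl.
  by rewrite ![_ * N%:R]mulrC ler_norml; lra.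
pose s := (ch m G).2; pose t := (ch n H).2.
pose a := coupling R s t.
have ova : is_overlay a by exact: coupling_overlay.
exists a => // u v ua va.
have [a0 ar ac] := ova.
pose L x y := rects e (ch m G).1 x y.
have LE x y : L x y = rects e (ch n H).1 x y by rewrite /L cE.
(* The difference passes through the two regularised kernels: [F1] and [F3] are the regularity
   errors of [G] and [H], and [F2] compares the common function [L] at the types of paired vertices.
   Each gets a third of [eps]. *)
pose F1 x y := (adjR G x.1 y.1 - L (s x.1) (s y.1)) * (u x * v y).
pose F2 x y := (L (s x.1) (s y.1) - L (t x.2) (t y.2)) * (u x * v y).
pose F3 x y := (adjR H x.2 y.2 - L (t x.2) (t y.2)) * (u x * v y).
have -> : \sum_x \sum_y (adjR G x.1 y.1 - adjR H x.2 y.2) * (u x * v y) =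
    \sum_x \sum_y F1 x y + \sum_x \sum_y F2 x y - \sum_x \sum_y F3 x y.
  rewrite -big_split -sumrB/=; apply: eq_bigr => x _.
  rewrite -big_split -sumrB/=; apply: eq_bigr => y _.
  by rewrite /F1 /F2 /F3 -mulrDl -mulrBl addrA subrK opprB addrA subrK.
have u0 x : 0 <= u x by have /andP[] := ua x.
have v0 x : 0 <= v x by have /andP[] := va x.
have B1 : `|\sum_x \sum_y F1 x y| <= e.
  apply: regular_bound => // i; rewrite -(ar i); apply: ler_sum => g _.
    by have /andP[] := ua (i, g).
  by have /andP[] := va (i, g).
have B3 : `|\sum_x \sum_y F3 x y| <= e.
  (* [regular_bound] sums out the second coordinate, so the pairs are swapped to put the vertices of
     [H] first. *)
  pose sw (x : 'I_n * 'I_m) := (x.2, x.1).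
  have swK : {on predT, bijective sw} by apply: onW_bij; exists (fun x => (x.2, x.1)) => -[].
  rewrite (reindex sw)//=; under eq_bigr do rewrite (reindex sw)//=.
  rewrite /F3 /=; under eq_bigr do under eq_bigr do rewrite LE.
  apply: (@regular_bound e M n H (ch n H) _ (u \o sw) (v \o sw)) => //.
  - by move=> x; exact: u0.
  - by move=> x; exact: v0.
  - move=> g; rewrite -(ac g); apply: ler_sum => i _.
    by have /andP[] := ua (i, g).
  - move=> g; rewrite -(ac g); apply: ler_sum => i _.
    by have /andP[] := va (i, g).
have a1 : \sum_x a x.1 x.2 = 1.
  rewrite -(pair_bigA _ (fun i g => a i g))/=.
  rewrite (eq_bigr (fun=> m%:R^-1)) => [|i _]; last exact: ar.
  by rewrite sumr_const card_ord -[LHS]mulr_natr mulVf// pnatr_eq0 -lt0n.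
pose bad (x : 'I_m * 'I_n) := (s x.1 != t x.2).
pose ab x := if bad x then a x.1 x.2 else 0.
have ab0 x : 0 <= ab x by rewrite /ab; case: ifP.
have abs : \sum_x ab x <= #|vtype M|%:R * N%:R^-1.
  rewrite /ab -big_mkcond; apply: le_trans (excess_le m0 close).
  exact: coupling_off_diagonal.
(* A term of [F2] vanishes unless the types differ in [x] or in [y]; in that case two values of
   [rects] differ by at most [2 * e * M]. *)
have B2 : `|\sum_x \sum_y F2 x y| <= e.
  have c0 : 0 <= e * M%:R by rewrite mulr_ge0// ltW.
  apply: le_trans (ler_norm_sum _ _ _) _.
  apply: (@le_trans _ _ (\sum_x \sum_y
     (2 * (e * M%:R) * (ab x * a y.1 y.2) + 2 * (e * M%:R) * (a x.1 x.2 * ab y)))).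
    apply: ler_sum => x _; apply: le_trans (ler_norm_sum _ _ _) _.
    apply: ler_sum => y _.
    have /andP[ux0 uxa] := ua x; have /andP[vy0 vya] := va y.
    rewrite /F2 normrM [`|u x * v y|]ger0_norm ?mulr_ge0//.
    have uv : u x * v y <= a x.1 x.2 * a y.1 y.2 by rewrite ler_pM.
    have L2 : `|L (s x.1) (s y.1) - L (t x.2) (t y.2)| <= 2 * (e * M%:R).
      apply: le_trans (ler_normB _ _) _.
      rewrite mulr_natl mulr2n lerD//; apply: rects_bound; exact: ltW.
    have p0 : 0 <= a x.1 x.2 * a y.1 y.2 by rewrite mulr_ge0.
    have q0 : 0 <= 2 * (e * M%:R) * (a x.1 x.2 * a y.1 y.2).
      by rewrite mulr_ge0// mulr_ge0.
    rewrite /ab; case: ifP => bx.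
      apply: (@le_trans _ _ (2 * (e * M%:R) * (a x.1 x.2 * a y.1 y.2))).
        by rewrite ler_pM// mulr_ge0.
      by rewrite lerDl; case: ifP => _//; rewrite !mulr0.
    rewrite mul0r mulr0 add0r; case: ifP => by_.
      by rewrite ler_pM// mulr_ge0.
    move/negbFE/eqP : bx => ->; move/negbFE/eqP : by_ => ->.
    by rewrite subrr normr0 mul0r !mulr0.
  under eq_bigr do rewrite big_split/= -!mulr_sumr a1 mulr1.
  rewrite big_split/= -!mulr_sumr -mulr_suml a1 mul1r -mulrDl.
  apply: (@le_trans _ _ ((2 * (e * M%:R) + 2 * (e * M%:R)) *
      (#|vtype M|%:R * N%:R^-1))).
    by rewrite ler_wpM2l// addr_ge0// mulr_ge0.
  rewrite [X in X <= _]mulrA ler_pdivrMr// /N -[X in _ <= e * X]natr1 !natrM.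
  by lra.
apply: le_trans (ler_normB _ _) _.
apply: (@le_trans _ _ (e + e + e)); last by rewrite /e; lra.
by rewrite lerD//; apply: le_trans (ler_normD _ _) _; rewrite lerD.
Qed.

End Colouring.

(** * Lebesgue measure on the plane *)

Section LebesguePlane.
Variable R : realType.
Local Notation leb := (@lebesgue_measure R).
Local Notation mu := (@completed_lebesgue_measure R).
Local Notation borel2 := (measurableTypeR R * measurableTypeR R)%type.

Lemma borel_line (A : set (measurableTypeR R)) :
  measurable A -> measurable (A : set (line_L R)).
Proof. by move=> mA; exact: sub_caratheodory. Qed.

Lemma borel_plane (A : set borel2) :
  measurable A -> measurable (A : set (plane_L R)).
Proof. by move=> mA; exact: caratheodory_measurable_mu_ext. Qed.

Lemma leb2_borel (A : set borel2) :
  measurable A -> leb2 (A : set (plane_L R)) = (leb \x leb)%E A.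
Proof. by move=> mA; rewrite /leb2 /completed_measure_extension measurable_mu_extE. Qed.

(* Both are the outer measure of [wlength idfun], on different sigma-algebras. *)
Lemma line_measureE (A : set R) : mu A = leb A.
Proof. by []. Qed.

Lemma line_borelU (A : set (line_L R)) : measurable A ->
  exists B N : set (measurableTypeR R),
    [/\ measurable B, measurable N, leb N = 0%E, B `<=` A & A `\` B `<=` N].
Proof.
move=> mA.
have : (completed_algebra_gen leb).-sigma.-measurable A.
  by rewrite completed_caratheodory_measurable.
rewrite g_sigma_completed_algebra_genE => -[B mB [N0 [N [mN N0N sN]]] BN].
exists B, N; split => //; first by rewrite -BN; exact: subsetUl.
by rewrite -BN => x [[//|/sN]].
Qed.

Lemma leb2_nullS (A N : set (plane_L R)) :
  measurable N -> leb2 N = 0%E -> A `<=` N -> measurable A /\ leb2 A = 0%E.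
Proof.
move=> mN N0 AN; split.
  apply: (@measure_is_complete_caratheodory R _ (leb \x leb)%E^*%mu).
  by exists N; split.
apply/eqP; rewrite eq_le outer_measure_ge0 andbT -N0; exact: le_outer_measure.
Qed.

Lemma leb2_null (A : set (plane_L R)) (N : set borel2) :
  measurable N -> (leb \x leb)%E N = 0%E -> A `<=` N ->
  measurable A /\ leb2 A = 0%E.
Proof.
by move=> mN N0; apply: leb2_nullS; [exact: borel_plane|rewrite leb2_borel].
Qed.

(** Shrinking both sides to Borel sets changes the rectangle only inside the null strips [N x R] and
    [R x N'], so the product formula for Borel rectangles carries over. *)
Lemma plane_rect (S T : set (line_L R)) : measurable S -> measurable T ->
  measurable (S `*` T : set (plane_L R)) /\ leb2 (S `*` T : set (plane_L R)) = (mu S * mu T)%E.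
Proof.
move=> mS mT.
have [B [N [mB mN N0 BS SN]]] := line_borelU mS.
have [B' [N' [mB' mN' N'0 BT TN]]] := line_borelU mT.
have mE (C D M : set (line_L R)) : measurable C -> measurable D -> measurable M ->
    mu M = 0%E -> D `<=` C -> C `\` D `<=` M -> mu C = mu D.
  move=> mC mD mM M0 DC CM.
  have CD0 : mu (C `\` D) = 0%E.
    by apply: (@subset_measure0 _ _ _ mu _ M) => //; exact: measurableD.
  rewrite -{1}(setDUK DC) measureU//; [|exact: measurableD|].
    by rewrite [X in (_ + X)%E]CD0 adde0.
  by rewrite setDE setICA setICr setI0.
have mZ : measurable (N `*` setT `|` setT `*` N' : set borel2).
  by apply: measurableU; exact: measurableX.
have Z0 : (leb \x leb)%E (N `*` setT `|` setT `*` N') = 0%E.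
  apply: null_set_setU; [exact: measurableX|exact: measurableX|..].
    by rewrite [LHS]product_measure1E// [X in (X * _)%E]N0 mul0e.
  by rewrite [LHS]product_measure1E// [X in (_ * X)%E]N'0 mule0.
have [mD D0] : measurable ((S `*` T) `\` (B `*` B') : set (plane_L R)) /\
    leb2 ((S `*` T) `\` (B `*` B') : set (plane_L R)) = 0%E.
  apply: (leb2_null mZ Z0) => -[x y] [[/= Sx Ty] /= nB].
  have [Bx|nBx] := pselect (B x).
    by right; split => //; apply: TN; split => // B'y; apply: nB.
  by left; split => //; apply: SN; split.
have mBB : measurable (B `*` B' : set (plane_L R)).
  by apply: borel_plane; exact: measurableX.
have sub : B `*` B' `<=` S `*` T by move=> [x y] [/= /BS ? /BT].
rewrite -(setDUK sub); split; first exact: measurableU.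
rewrite measureU//; last by rewrite setDE setICA setICr setI0.
rewrite [X in (_ + X)%E]D0 adde0 [LHS]leb2_borel; last exact: measurableX.
rewrite product_measure1E// (mE S B N)// ?(mE T B' N')//; exact: borel_line.
Qed.

(** The outer measure is an infimum over countable Borel covers; intersecting covers of error
    [1/(n+1)] gives a Borel hull of the same measure. As the measure is finite, the difference from
    [A] is null, and it gets a hull of its own. *)
Lemma plane_borelU (A : set (plane_L R)) : measurable A -> (leb2 A < +oo)%E ->
  exists B N : set borel2,
    [/\ measurable B, measurable N, (leb \x leb)%E N = 0%E, A `<=` B & B `\` A `<=` N].
Proof.
have cover (X : set borel2) : (leb2 X < +oo)%E -> exists B : set borel2,
    [/\ measurable B, X `<=` B & leb2 B = leb2 X].
  move=> Xoo.
  have Xfin : leb2 X \is a fin_num by rewrite ge0_fin_numE// outer_measure_ge0.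
  have : forall n : nat, exists C : set borel2,
      [/\ measurable C, X `<=` C & (leb2 C <= leb2 X + n.+1%:R^-1%:E)%E].
    move=> n; have n0 : (0 < n.+1%:R^-1 :> R) by rewrite invr_gt0.
    have [_ [F [mF XF] <-] Fle] := lb_ereal_inf_adherent n0 Xfin.
    exists (\bigcup_k F k); split => //; first exact: bigcupT_measurable.
    apply: le_trans (ltW Fle).
    rewrite leb2_borel; last exact: bigcupT_measurable.
    by apply: measure_sigma_subadditive => //; exact: bigcupT_measurable.
  move=> /choice[C HC]; exists (\bigcap_n C n).
  have mC : measurable (\bigcap_n C n).
    by apply: bigcapT_measurable => n; have [] := HC n.
  have XC : X `<=` \bigcap_n C n by move=> x Xx n _; have [_ + _] := HC n; exact.
  split=> //; apply/eqP; rewrite eq_le; apply/andP; split; last exact: le_outer_measure.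
  apply/lee_addgt0Pr => e e0.
  have [n ne] : exists n : nat, n.+1%:R^-1 < e.
    exists (Num.truncn e^-1); rewrite invf_plt ?posrE//.
    exact: truncnS_gt.
  have [_ _ Cn] := HC n.
  apply: (@le_trans _ _ (leb2 (C n))); first by apply: le_outer_measure; exact: bigcap_inf.
  by apply: le_trans Cn _; rewrite leeD2l// lee_fin ltW.
move=> mA Aoo.
have [B [mB AB BA]] := cover _ Aoo.
have mB' := borel_plane mB.
have D0 : leb2 (B `\` A : set (plane_L R)) = 0%E.
  rewrite measureD//=; last by rewrite BA.
  by rewrite setIidr// BA subee// ge0_fin_numE// outer_measure_ge0.
have [|N [mN DN N0]] := cover (B `\` A); first by rewrite D0.
by exists B, N; split => //; rewrite -leb2_borel// N0.
Qed.

End LebesguePlane.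

(** * Invariance of the plane measure under relabelling *)

Section Invariance.
Variable R : realType.
Local Notation leb := (@lebesgue_measure R).
Local Notation mu := (@completed_lebesgue_measure R).
Local Notation borel2 := (measurableTypeR R * measurableTypeR R)%type.

Definition unitQ : set (plane_L R) := unitI `*` unitI.

Lemma measurable_unitI : measurable (unitI : set (line_L R)).
Proof. by apply: borel_line; exact: measurable_itv. Qed.

Lemma mu_unitI : mu (unitI : set R) = 1%E.
Proof.
rewrite line_measureE lebesgue_measure_itv/= lte_fin ltr01.
by rewrite oppr0 addr0.
Qed.

Lemma measurable_unitQ : measurable unitQ.
Proof. by have [] := plane_rect measurable_unitI measurable_unitI. Qed.

Lemma leb2_unitQ : leb2 unitQ = 1%E.
Proof.
by have [_ ->] := plane_rect measurable_unitI measurable_unitI; rewrite mu_unitI mule1.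
Qed.

Lemma leb2_le1 (A : set (plane_L R)) : A `<=` unitQ -> (leb2 A <= 1)%E.
Proof. by move=> AQ; rewrite -leb2_unitQ; exact: le_outer_measure. Qed.

Lemma leb2_lty (A : set (plane_L R)) : A `<=` unitQ -> (leb2 A < +oo)%E.
Proof. by move=> AQ; exact: le_lt_trans (leb2_le1 AQ) (ltry 1). Qed.

Variables (phi : R -> R).
Hypothesis phiI : {homo phi : x / unitI x}.
Hypothesis phimp : measure_preserving phi.

(* Extending [phi] by the identity gives a measure-preserving map of the whole line,
   so that integrals can be transported by pushforward. *)
Definition extend x := if x \in unitI then phi x else x.
Definition extend2 (p : R * R) := (extend p.1, extend p.2).

Lemma preimage_extend (A : set R) : extend @^-1` A =
  (unitI `&` phi @^-1` (A `&` unitI)) `|` (A `\` unitI).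
Proof.
apply/seteqP; split => x /=; rewrite /extend.
  case: ifPn => [/[!inE] Ix Ax|/negP]; last by rewrite inE; right.
  by left; do !split => //; exact: phiI.
case=> [[Ix [Ax Iphi]]|[Ax nIx]]; first by rewrite ifT// inE.
by rewrite ifF//; apply/negP; rewrite inE.
Qed.

Lemma extend_preserving (A : set (line_L R)) : measurable A ->
  measurable (extend @^-1` A : set (line_L R)) /\ mu (extend @^-1` A) = mu A.
Proof.
move=> mA; have mI := measurable_unitI.
have mAI : measurable (A `&` unitI : set (line_L R)) by exact: measurableI.
have mP : measurable (unitI `&` phi @^-1` (A `&` unitI) : set (line_L R)).
  exact: phimp.1.
have mD : measurable (A `\` unitI : set (line_L R)) by exact: measurableD.
rewrite preimage_extend; split; first exact: measurableU.
rewrite measureU//; last first.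
  by apply/seteqP; split => // x [[Ix _] [_ nIx]].
rewrite [X in (X + _)%E](phimp.2 (A `&` unitI))//.
rewrite -[in RHS](setUIDK A unitI) measureU//.
by apply/seteqP; split => // x [[_ Ix] [_ nIx]].
Qed.

(** The pushforward of the plane measure agrees with the product measure on Borel rectangles, hence
    on all Borel sets by uniqueness. *)
Lemma extend2_borel (A : set borel2) : measurable A ->
  measurable (extend2 @^-1` A : set (plane_L R)) /\
  leb2 (extend2 @^-1` A : set (plane_L R)) = (leb \x leb)%E A.
Proof.
have m1 : measurable_fun setT (fun p : plane_L R => extend p.1 : measurableTypeR R).
  move=> _ B mB; rewrite setTI.
  have [mP _] := extend_preserving (borel_line mB).
  have [+ _] := plane_rect mP (@measurableT _ (line_L R)).
  by congr (measurable _); apply/seteqP; split => -[x y] //= -[].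
have m2 : measurable_fun setT (fun p : plane_L R => extend p.2 : measurableTypeR R).
  move=> _ B mB; rewrite setTI.
  have [mP _] := extend_preserving (borel_line mB).
  have [+ _] := plane_rect (@measurableT _ (line_L R)) mP.
  by congr (measurable _); apply/seteqP; split => -[x y] //= -[].
have mE : measurable_fun setT (extend2 : plane_L R -> borel2).
  exact: measurable_fun_pair m1 m2.
move=> mA; split; first by rewrite -[_ @^-1` _]setTI; exact: mE.
have := @product_measure_unique _ _ _ _ R leb leb
  (pushforward leb2 (extend2 : plane_L R -> borel2)).
move=> /(_ mE) U; apply/esym; apply: (U _ A mA) => B C mB mC.
rewrite -[LHS]/(leb2 ((extend @^-1` B) `*` (extend @^-1` C) : set (plane_L R))).
have [mPB eB] := extend_preserving (borel_line mB).
have [mPC eC] := extend_preserving (borel_line mC).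
by have [_ ->] := plane_rect mPB mPC; rewrite eB eC.
Qed.

(** A set of finite measure is its Borel hull minus a null set, and [extend2_borel] controls the
    preimages of both. Other sets are exhausted by their traces on bounded squares. *)
Lemma extend2_preserving (A : set (plane_L R)) : measurable A ->
  measurable (extend2 @^-1` A : set (plane_L R)) /\
  ((leb2 A < +oo)%E -> leb2 (extend2 @^-1` A : set (plane_L R)) = leb2 A).
Proof.
have fin (B : set (plane_L R)) : measurable B -> (leb2 B < +oo)%E ->
    measurable (extend2 @^-1` B : set (plane_L R)) /\
    leb2 (extend2 @^-1` B : set (plane_L R)) = leb2 B.
  move=> mB Boo; have [C [N [mC mN N0 BC CN]]] := plane_borelU mB Boo.
  have [mPC eC] := extend2_borel mC; have [mPN eN] := extend2_borel mN.
  have [mZ Z0] : measurable (extend2 @^-1` (C `\` B) : set (plane_L R)) /\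
      leb2 (extend2 @^-1` (C `\` B) : set (plane_L R)) = 0%E.
    by apply: (leb2_nullS mPN) => [|p]; [rewrite eN|exact: CN].
  have BE : B = C `\` (C `\` B) by rewrite setDD setIidr.
  have -> : extend2 @^-1` B = extend2 @^-1` C `\` extend2 @^-1` (C `\` B).
    by rewrite {1}BE.
  split; first exact: measurableD.
  have Coo : leb2 (C : set (plane_L R)) = leb2 B.
    rewrite -(setDUK BC) measureU//; last by rewrite setDE setICA setICr setI0.
      have [_ D0] := leb2_null mN N0 CN.
      by rewrite [X in (_ + X)%E]D0 adde0.
    by apply: measurableD => //; exact: borel_plane.
  rewrite measureD//; last by rewrite [X in (X < _)%E]eC -leb2_borel// Coo.
  rewrite [X in (_ - X)%E](_ : _ = 0%E) ?sube0; last first.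
    by have [] := leb2_nullS mZ Z0 (@subIsetr _ (extend2 @^-1` C) _).
  by rewrite [LHS]eC -leb2_borel// Coo.
move=> mA; split; last by move=> /(fin _ mA)[].
pose K n : set borel2 := `[- n%:R, n%:R] `*` `[- n%:R, n%:R].
have mK n : measurable (K n) by apply: measurableX; exact: measurable_itv.
have -> : extend2 @^-1` A = \bigcup_n extend2 @^-1` (A `&` K n).
  rewrite -preimage_bigcup -setI_bigcupr; congr (_ @^-1` _).
  apply/esym/setIidl => -[x y] _; exists (Num.truncn (`|x| + `|y|)).+1 => //.
  have h := truncnS_gt (`|x| + `|y|).
  have hx : `|x| <= (Num.truncn (`|x| + `|y|)).+1%:R.
    by apply: le_trans (ltW h); rewrite lerDl.
  have hy : `|y| <= (Num.truncn (`|x| + `|y|)).+1%:R.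
    by apply: le_trans (ltW h); rewrite lerDr.
  by split; rewrite /= in_itv/= -ler_norml.
apply: bigcupT_measurable => n.
have mAK : measurable (A `&` K n : set (plane_L R)).
  by apply: measurableI => //; exact: borel_plane.
apply: (fin _ mAK _).1; apply: (@le_lt_trans _ _ (leb2 (K n : set (plane_L R)))).
  by apply: le_outer_measure; exact: subIsetr.
rewrite leb2_borel// product_measure1E; [|exact: measurable_itv..].
suff : (leb `[(- n%:R)%R, n%:R%R]%classic * leb `[(- n%:R)%R, n%:R%R]%classic < +oo)%E by [].
rewrite lebesgue_measure_itv; case: ifP => _; last by rewrite mule0 ltry.
by rewrite -EFinB -EFinM ltry.
Qed.

End Invariance.
Arguments unitQ {R}.

(** * The cut distance *)

Section Kernels.
Variable R : realType.
Local Notation mu := (@completed_lebesgue_measure R).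
Implicit Types (U V W : sqfun R) (phi psi : R -> R) (A : set (plane_L R)).

Definition bkernel W : Prop :=
  (exists M : R, forall p, unitQ p -> `|W p| <= M) /\
  measurable_fun (unitQ) (W : plane_L R -> R).

Definition integral2 A W : R := \int[leb2]_(p in A) W p.

Definition norm1 W : R := integral2 (unitQ) (fun p => `|W p|).

Lemma graphon_bkernel W : is_graphon W -> bkernel W.
Proof. by case=> _ [M WM] mW; split=> //; exists M => -[x y] [/= ? ?]; exact: WM. Qed.

Lemma bkernelD U V : bkernel U -> bkernel V -> bkernel (U \+ V).
Proof.
move=> [[M UM] mU] [[N VN] mV]; split; last exact: measurable_funD.
by exists (M + N) => p Qp; apply: le_trans (ler_normD _ _) _; rewrite lerD ?UM ?VN.
Qed.

Lemma bkernelZ (c : R) U : bkernel U -> bkernel (fun p => c * U p).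
Proof.
move=> [[M UM] mU]; split; last by apply: measurable_funM => //; exact: measurable_cst.
by exists (`|c| * M) => p Qp; rewrite normrM ler_wpM2l ?UM.
Qed.

Lemma bkernel_eq U V : (forall p, unitQ p -> U p = V p) -> bkernel U -> bkernel V.
Proof.
move=> UV [[M UM] mU]; split; first by exists M => p Qp; rewrite -UV ?UM.
by apply: eq_measurable_fun mU => p /[!inE] /UV.
Qed.

Lemma bkernelN U : bkernel U -> bkernel (\- U).
Proof.
by move=> /(bkernelZ (-1)); apply: bkernel_eq => p _ /=; rewrite mulN1r.
Qed.

Lemma bkernelB U V : bkernel U -> bkernel V -> bkernel (U \- V).
Proof. by move=> kU /bkernelN; exact: bkernelD. Qed.

Lemma bkernelM U V : bkernel U -> bkernel V -> bkernel (U \* V).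
Proof.
move=> [[M UM] mU] [[N VN] mV]; split; last exact: measurable_funM.
by exists (M * N) => p Qp; rewrite normrM ler_pM ?UM ?VN.
Qed.

Lemma bkernel_norm U : bkernel U -> bkernel (fun p => `|U p|).
Proof.
move=> [[M UM] mU]; split; last exact: measurableT_comp.
by exists M => p Qp; rewrite normr_id UM.
Qed.

Lemma bkernel_cst (c : R) : bkernel (fun=> c).
Proof. by split; last exact: measurable_cst; exists `|c|. Qed.

Lemma bkernel_integrable W A : bkernel W -> measurable A -> A `<=` unitQ ->
  leb2.-integrable A (EFin \o W).
Proof.
move=> [[M WM] mW] mA AQ; apply: (@integrableS _ _ _ _ (unitQ)) => //.
  exact: measurable_unitQ.
apply: measurable_bounded_integrable => //; first exact: measurable_unitQ.
  exact: leb2_lty.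
by exists M; split=> [|x Mx p Qp]; [exact: num_real|exact: le_trans (WM _ Qp) (ltW Mx)].
Qed.

Lemma integral2D A U V : measurable A -> A `<=` unitQ -> bkernel U -> bkernel V ->
  integral2 A (U \+ V) = integral2 A U + integral2 A V.
Proof. by move=> mA AQ kU kV; apply: RintegralD => //; exact: bkernel_integrable. Qed.

Lemma integral2B A U V : measurable A -> A `<=` unitQ -> bkernel U -> bkernel V ->
  integral2 A (U \- V) = integral2 A U - integral2 A V.
Proof. by move=> mA AQ kU kV; apply: RintegralB => //; exact: bkernel_integrable. Qed.

Lemma integral2Z A (c : R) U : measurable A -> A `<=` unitQ -> bkernel U ->
  integral2 A (fun p => c * U p) = c * integral2 A U.
Proof. by move=> mA AQ kU; apply: RintegralZl => //; exact: bkernel_integrable. Qed.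

Lemma integral2_eq A U V : (forall p, A p -> U p = V p) ->
  integral2 A U = integral2 A V.
Proof. by move=> UV; apply: eq_Rintegral => p /[!inE] /UV. Qed.

Lemma integral2_le A U V : measurable A -> A `<=` unitQ -> bkernel U -> bkernel V ->
  (forall p, A p -> U p <= V p) -> integral2 A U <= integral2 A V.
Proof. by move=> mA AQ kU kV; apply: le_Rintegral => //; exact: bkernel_integrable. Qed.

Lemma integral2_ge0 A U : (forall p, A p -> 0 <= U p) -> 0 <= integral2 A U.
Proof. exact: Rintegral_ge0. Qed.

Lemma integral2_norm A U : measurable A -> A `<=` unitQ -> bkernel U ->
  `|integral2 A U| <= integral2 A (fun p => `|U p|).
Proof. by move=> mA AQ kU; apply: le_normr_Rintegral => //; exact: bkernel_integrable. Qed.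

Lemma integral2_cst A (c : R) : measurable A -> A `<=` unitQ ->
  integral2 A (fun=> c) = c * fine (leb2 A).
Proof. by move=> mA AQ; exact: Rintegral_cst. Qed.

Lemma integral2_cstQ (c : R) : integral2 (unitQ) (fun=> c) = c.
Proof. by rewrite integral2_cst ?leb2_unitQ ?mulr1//; exact: measurable_unitQ. Qed.

Lemma integral2U A B U : measurable A -> measurable B -> A `<=` unitQ ->
  B `<=` unitQ -> A `&` B = set0 -> bkernel U ->
  integral2 (A `|` B) U = integral2 A U + integral2 B U.
Proof.
move=> mA mB AQ BQ AB kU; apply: Rintegral_setU => //; last by apply/disj_setPS; rewrite AB.
apply: bkernel_integrable => //; first exact: measurableU.
by move=> p [/AQ|/BQ].
Qed.

Lemma integral2_subset A B U : measurable A -> measurable B -> A `<=` B ->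
  B `<=` unitQ -> bkernel U -> (forall p, B p -> 0 <= U p) ->
  integral2 A U <= integral2 B U.
Proof.
move=> mA mB AB BQ kU U0; rewrite -(setDUK AB) integral2U//.
- by rewrite lerDl; apply: integral2_ge0 => p [/U0].
- exact: measurableD.
- exact: subset_trans BQ.
- by apply: subset_trans BQ => p [].
- by rewrite setDE setICA setICr setI0.
Qed.

Lemma norm1_triangle U V W : bkernel U -> bkernel V -> bkernel W ->
  norm1 (U \- W) <= norm1 (U \- V) + norm1 (V \- W).
Proof.
move=> kU kV kW; have mQ := @measurable_unitQ R.
have k1 : bkernel (fun p => `|(U \- V) p|) by apply: bkernel_norm; exact: bkernelB.
have k2 : bkernel (fun p => `|(V \- W) p|) by apply: bkernel_norm; exact: bkernelB.
have k3 : bkernel (fun p => `|(U \- W) p|) by apply: bkernel_norm; exact: bkernelB.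
have sQ : @unitQ R `<=` unitQ by [].
rewrite /norm1 -(integral2D mQ sQ k1 k2).
apply: (integral2_le mQ sQ k3 (bkernelD k1 k2)) => p _ /=.
by rewrite -{1}(subrK (V p) (U p)) -addrA ler_normD.
Qed.

Lemma norm1C U V : norm1 (U \- V) = norm1 (V \- U).
Proof. by apply: integral2_eq => p _ /=; rewrite distrC. Qed.

Lemma norm1_eq U V : (forall p, unitQ p -> U p = V p) -> norm1 U = norm1 V.
Proof. by move=> UV; apply: integral2_eq => p Qp /=; rewrite UV. Qed.

Lemma bkernel_pullback W phi : {homo phi : x / unitI x} -> measure_preserving phi ->
  bkernel W -> bkernel (pullback W phi).
Proof.
move=> phiI mp [[M WM] mW]; split.
  by exists M => -[x y] [/= Ix Iy]; apply: WM; split; exact: phiI.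
have Qpre (B : set R) : unitQ `&` pullback W phi @^-1` B =
    (extend2 phi @^-1` (unitQ `&` W @^-1` B)) :> set (R * R).
  apply/seteqP; split => -[x y] /=; rewrite /unitQ /extend2 /pullback /extend /=.
    by move=> [[/= Ix Iy] B1]; rewrite !ifT ?inE//; split => //; split; exact: phiI.
  case: ifPn => [/[!inE] Ix|/negP nIx]; last by move=> [[/= + _] _]; move: nIx; rewrite inE.
  case: ifPn => [/[!inE] Iy|/negP nIy]; last by move=> [[/= _ +] _]; move: nIy; rewrite inE.
  by move=> [_].
move=> _ B mB.
have := (extend2_preserving phiI mp (mW (@measurable_unitQ R) B mB)).1.
by rewrite -Qpre.
Qed.

(** Change of variables along the pushforward by [extend2 phi]; [W] is first extended by 0 so as to
    be measurable on the whole plane. *)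
Lemma integral2_pullback A W phi :
  {homo phi : x / unitI x} -> measure_preserving phi -> bkernel W ->
  measurable A -> A `<=` unitQ ->
  integral2 (unitQ `&` (fun p => (phi p.1, phi p.2)) @^-1` A) (pullback W phi) =
  integral2 A W.
Proof.
move=> phiI mp kW mA AQ; have [[M WM] mW] := kW.
pose W0 : plane_L R -> R := W \_ (unitQ).
have mW0 : measurable_fun setT W0.
  by apply/(measurable_restrictT _ _).1 => //; exact: measurable_unitQ.
have W0M p : `|W0 p| <= `|M|.
  rewrite /W0 patchE; case: ifPn => [/[!inE] /WM /le_trans ->//|_]; last by rewrite normr0.
  exact: ler_norm.
pose E : plane_L R -> plane_L R := extend2 phi.
have mE : measurable_fun setT E.
  by move=> _ B mB; rewrite setTI; exact: (extend2_preserving phiI mp mB).1.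
have EA : unitQ `&` (fun p : R * R => (phi p.1, phi p.2)) @^-1` A = E @^-1` A.
  apply/seteqP; split => -[x y]; rewrite /E /extend2 /extend /=.
    by move=> [[/= Ix Iy]]; rewrite !ifT ?inE.
  case: ifPn => [/[!inE] Ix|/negP nIx]; last by move=> /AQ[/=]; move: nIx; rewrite inE.
  by case: ifPn => [/[!inE] Iy|/negP nIy]; last by move=> /AQ[/=]; move: nIy; rewrite inE.
have mEA : measurable (E @^-1` A) by exact: (extend2_preserving phiI mp mA).1.
rewrite EA; transitivity (\int[leb2]_(p in E @^-1` A) (W0 (E p))).
  apply: eq_Rintegral => -[x y]; rewrite inE -EA /pullback /E /extend2 /extend /W0.
  move=> [[/= Ix Iy] Axy]; rewrite !ifT ?inE// patchE ifT// inE; exact: AQ.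
transitivity (\int[leb2]_(p in A) W0 p); last first.
  by apply: integral2_eq => p /AQ Qp; rewrite /W0 patchE ifT ?inE.
have eA := (extend2_preserving phiI mp mA).2 (leb2_lty AQ).
have mW0E : measurable_fun (E @^-1` A) (W0 \o E).
  by apply: measurable_funTS; exact: measurableT_comp.
have bW0E : [bounded (W0 \o E) x | x in E @^-1` A].
  exists `|M|; split=> [|x Mx p _]; first exact: num_real.
  exact: (le_trans (W0M _) (ltW Mx)).
have intW0E : leb2.-integrable (E @^-1` A) (EFin \o (W0 \o E)).
  apply: (measurable_bounded_integrable mEA _ mW0E bW0E).
  by rewrite [X in (X < _)%E]eA; exact: leb2_lty.
have mEW0 : measurable_fun setT (EFin \o W0) by exact/measurable_EFinP.
rewrite /Rintegral; congr fine.
apply: etrans (esym (integral_pushforward mE mEW0 intW0E mA)) _.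
(* Only subsets of [A] matter; they have finite measure, so [extend2_preserving] applies. *)
apply: eq_measure_integral => B mB BA.
exact: ((extend2_preserving phiI mp mB).2 (leb2_lty (subset_trans BA AQ))).
Qed.

End Kernels.

(** * The cut norm and the pseudometric it induces *)

Section CutMetric.
Variable R : realType.
Local Notation mu := (@completed_lebesgue_measure R).
Implicit Types (U V W : sqfun R) (phi psi : R -> R).

Lemma Phi0_homo phi : Phi0 phi -> {homo phi : x / unitI x}.
Proof. by case=> psi []. Qed.

Lemma Phi0_mp phi : Phi0 phi -> measure_preserving phi.
Proof. by case=> psi [? ? ? ? []]. Qed.

Lemma Phi0_inv phi : Phi0 phi -> exists psi : R -> R, [/\ Phi0 psi,
  forall x, unitI x -> psi (phi x) = x & forall x, unitI x -> phi (psi x) = x].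
Proof. by case=> psi [? ? ? ? [? ?]]; exists psi; split => //; exists phi. Qed.

Lemma measure_preserving_id : measure_preserving (@id R).
Proof.
split=> [_ B mB|A mA AI]; first by apply: measurableI => //; exact: measurable_unitI.
by congr (mu _); apply: setIidr.
Qed.

Lemma measure_preserving_comp phi psi : {homo psi : x / unitI x} ->
  measure_preserving phi -> measure_preserving psi ->
  measure_preserving (phi \o psi).
Proof.
move=> psiI [mphi ephi] [mpsi epsi].
have E (A : set R) : unitI `&` (phi \o psi) @^-1` A =
    unitI `&` psi @^-1` (unitI `&` phi @^-1` A).
  by apply/seteqP; split => x /= [Ix]; [split => //; split => //; exact: psiI|case].
split=> [_ B mB|A mA AI].
  have mB' : measurable (unitI `&` phi @^-1` B : set (line_L R)).
    by apply: mphi => //; exact: measurable_unitI.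
  by rewrite E; apply: mpsi => //; exact: measurable_unitI.
have mA' : measurable (unitI `&` phi @^-1` A : set (line_L R)).
  by apply: mphi => //; exact: measurable_unitI.
rewrite E (epsi (unitI `&` phi @^-1` A)) ?ephi//; exact: subIsetl.
Qed.

Lemma Phi0_id : Phi0 (@id R).
Proof. by exists id; split => //; split; exact: measure_preserving_id. Qed.

Lemma Phi0_comp phi psi : Phi0 phi -> Phi0 psi -> Phi0 (phi \o psi).
Proof.
move=> [phi' [h1 h2 h3 h4 [h5 h6]]] [psi' [k1 k2 k3 k4 [k5 k6]]].
exists (psi' \o phi'); split => //=.
- by move=> x Ix; apply/h1/k1.
- by move=> x Ix; apply/k2/h2.
- by move=> x Ix /=; rewrite h3 ?k3//; exact: k1.
- by move=> x Ix /=; rewrite k4 ?h4//; exact: h2.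
- by split; apply: measure_preserving_comp.
Qed.

Definition unit_sets (S T : set (line_L R)) : Prop :=
  [/\ measurable S, measurable T, S `<=` unitI & T `<=` unitI].

Lemma unit_setsX S T : unit_sets S T ->
  measurable (S `*` T : set (plane_L R)) /\ (S `*` T `<=` @unitQ R).
Proof.
move=> [mS mT SI TI]; split; first by have [] := plane_rect mS mT.
by move=> [x y] [/= /SI ? /TI].
Qed.

Lemma cut_norm_le W (c : R) :
  (forall S T, unit_sets S T -> `|integral2 (S `*` T) W| <= c) -> cut_norm W <= c.
Proof.
move=> Wc; apply: ge_sup; last by move=> _ [S [T [mS mT SI TI ->]]]; apply: Wc.
by exists `|integral2 (set0 `*` set0) W|, set0, set0; split.
Qed.

Lemma integral2_le_norm1 W (A : set (plane_L R)) : bkernel W -> measurable A ->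
  A `<=` unitQ -> `|integral2 A W| <= norm1 W.
Proof.
move=> kW mA AQ; apply: le_trans (integral2_norm mA AQ kW) _.
have mQ := @measurable_unitQ R; have sQ : @unitQ R `<=` unitQ by [].
exact: (integral2_subset mA mQ AQ sQ (bkernel_norm kW) (fun p _ => normr_ge0 _)).
Qed.

Lemma le_cut_norm W S T : bkernel W -> unit_sets S T ->
  `|integral2 (S `*` T) W| <= cut_norm W.
Proof.
move=> kW [mS mT SI TI]; apply: ub_le_sup; last by exists S, T.
exists (norm1 W) => _ [S' [T' [mS' mT' SI' TI' ->]]].
by have [|? ?] := @unit_setsX S' T'; [split|exact: integral2_le_norm1].
Qed.

Lemma cut_norm_le_norm1 W : bkernel W -> cut_norm W <= norm1 W.
Proof.
by move=> kW; apply: cut_norm_le => S T /unit_setsX[? ?]; exact: integral2_le_norm1.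
Qed.

Lemma cut_norm_ge0 W : bkernel W -> 0 <= cut_norm W.
Proof.
move=> kW; have ST : unit_sets set0 set0 by split.
exact: le_trans (normr_ge0 _) (le_cut_norm kW ST).
Qed.

Lemma cut_norm_eq U V : (forall p, unitQ p -> U p = V p) -> cut_norm U = cut_norm V.
Proof.
move=> UV; rewrite /cut_norm; congr sup; apply/seteqP; split => _ [S [T [mS mT SI TI ->]]];
  exists S, T; split => //; congr (`| _ |); apply: integral2_eq => -[x y] [/= /SI ? /TI ?].
  exact: UV.
by rewrite UV.
Qed.

Local Opaque integral2 cut_norm.

Lemma cut_normD U V : bkernel U -> bkernel V ->
  cut_norm (U \+ V) <= cut_norm U + cut_norm V.
Proof.
move=> kU kV; apply: cut_norm_le => S T ST; have [mST STQ] := unit_setsX ST.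
by rewrite integral2D//; apply: le_trans (ler_normD _ _) _; rewrite lerD ?le_cut_norm.
Qed.

Lemma cut_normZ (c : R) U : bkernel U -> cut_norm (fun p => c * U p) <= `|c| * cut_norm U.
Proof.
move=> kU; apply: cut_norm_le => S T ST; have [mST STQ] := unit_setsX ST.
by rewrite integral2Z// normrM ler_wpM2l// le_cut_norm.
Qed.

Lemma cut_normN U : bkernel U -> cut_norm (\- U) <= cut_norm U.
Proof.
move=> kU; have := cut_normZ (-1) kU; rewrite normrN1 mul1r; apply: le_trans.
by rewrite (@cut_norm_eq (\- U) (fun p => -1 * U p))// => p _; rewrite mulN1r.
Qed.

Lemma cut_norm_distC U V : bkernel U -> bkernel V -> cut_norm (U \- V) = cut_norm (V \- U).
Proof.
suff le (X Y : sqfun R) : bkernel X -> bkernel Y -> cut_norm (X \- Y) <= cut_norm (Y \- X).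
  by move=> kU kV; apply/le_anti/andP; split; [exact: (le _ _ kU kV)|exact: (le _ _ kV kU)].
move=> kX kY; apply: (le_trans _ (cut_normN (bkernelB kY kX))).
rewrite (@cut_norm_eq (X \- Y) (\- (Y \- X)))// => p _ /=; by rewrite opprB.
Qed.

Lemma cut_norm_triangle U V W : bkernel U -> bkernel V -> bkernel W ->
  cut_norm (U \- W) <= cut_norm (U \- V) + cut_norm (V \- W).
Proof.
move=> kU kV kW; apply: (le_trans _ (cut_normD (bkernelB kU kV) (bkernelB kV kW))).
rewrite (@cut_norm_eq (U \- W) ((U \- V) \+ (V \- W)))// => p _ /=.
by rewrite addrA subrK.
Qed.

Lemma bkernel_pullback0 W phi : Phi0 phi -> bkernel W -> bkernel (pullback W phi).
Proof. by move=> p0; apply: bkernel_pullback; [exact: Phi0_homo|exact: Phi0_mp]. Qed.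

Lemma pullbackK W phi psi : (forall x, unitI x -> phi (psi x) = x) ->
  forall p, unitQ p -> pullback (pullback W phi) psi p = W p.
Proof. by move=> K [x y] [/= Ix Iy]; rewrite /pullback/= !K. Qed.

(** Within the unit square [S x T] is the preimage under [phi] of the rectangle whose sides are the
    [psi]-preimages of [S] and [T]. Rectangle integrals of the pullback are thus rectangle integrals
    of [W]; the converse follows by pulling back along the inverse. *)
Lemma cut_norm_pullback W phi : Phi0 phi -> bkernel W ->
  cut_norm (pullback W phi) = cut_norm W.
Proof.
suff le (phi' : R -> R) (W' : sqfun R) : Phi0 phi' -> bkernel W' -> cut_norm (pullback W' phi') <= cut_norm W'.
  move=> p0 kW; have [psi [psi0 K1 K2]] := Phi0_inv p0.
  apply/le_anti/andP; split; first exact: (le _ _ p0 kW).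
  have e := cut_norm_eq (pullbackK W K2).
  apply: (@le_trans _ _ (cut_norm (pullback (pullback W phi) psi))).
    by rewrite [leRHS]e.
  exact: (le _ _ psi0 (bkernel_pullback0 p0 kW)).
move=> p0 kW; have [psi [psi0 K1 K2]] := Phi0_inv p0.
have pI := Phi0_homo p0.
apply: cut_norm_le => S T [mS mT SI TI].
pose S' := unitI `&` psi @^-1` S; pose T' := unitI `&` psi @^-1` T.
have [mpsi _] := Phi0_mp psi0.
have ST' : unit_sets S' T'.
  split; [exact: (mpsi (@measurable_unitI R) _ mS)|exact: (mpsi (@measurable_unitI R) _ mT)|exact: subIsetl|exact: subIsetl].
have [mST STQ] := unit_setsX ST'.
rewrite [X in integral2 X _](_ : _ =
    unitQ `&` (fun p : R * R => (phi' p.1, phi' p.2)) @^-1` (S' `*` T')).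
  rewrite integral2_pullback//; first exact: le_cut_norm.
  exact: Phi0_mp.
apply/seteqP; split => -[x y] /=.
  by move=> [/= Sx Ty]; have Ix := SI _ Sx; have Iy := TI _ Ty; rewrite /S' /T' /unitQ /= !K1//;
    do !split => //; exact: pI.
by move=> [[/= Ix Iy] [[/= _ +] [/= _ +]]]; rewrite !K1.
Qed.

Lemma norm1_pullback W phi : Phi0 phi -> bkernel W -> norm1 (pullback W phi) = norm1 W.
Proof.
move=> p0 kW; rewrite /norm1.
have mQ := @measurable_unitQ R; have sQ : @unitQ R `<=` unitQ by [].
rewrite -(integral2_pullback (Phi0_homo p0) (Phi0_mp p0) (bkernel_norm kW) mQ sQ).
congr integral2; apply/esym/setIidl => -[x y] [/= Ix Iy].
by split; exact: (Phi0_homo p0).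
Qed.

Lemma cut_dist_le U W phi : bkernel U -> bkernel W -> Phi0 phi ->
  cut_dist U W <= cut_norm (U \- pullback W phi).
Proof.
move=> kU kW p0; apply: ge_inf; last by exists phi.
exists 0 => _ [psi psi0 <-]; apply: cut_norm_ge0.
by apply: bkernelB => //; exact: bkernel_pullback0.
Qed.

Lemma cut_dist_ge0 U W : bkernel U -> bkernel W -> 0 <= cut_dist U W.
Proof.
move=> kU kW; apply: lb_le_inf.
  by exists (cut_norm (U \- pullback W id)), id => //; exact: Phi0_id.
move=> _ [psi psi0 <-]; apply: cut_norm_ge0.
by apply: bkernelB => //; exact: bkernel_pullback0.
Qed.

Lemma cut_dist_lt U W (c : R) : bkernel U -> bkernel W -> cut_dist U W < c ->
  exists2 phi, Phi0 phi & cut_norm (U \- pullback W phi) < c.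
Proof.
move=> _ _ /inf_lt -[|_ [phi p0 <-] lt]; last by exists phi.
by exists (cut_norm (U \- pullback W id)), id => //; exact: Phi0_id.
Qed.

Local Opaque cut_dist.

(** Pulling [Y - X^phi] back along the inverse [psi] of [phi] turns it into [Y^psi - X], with the
    same cut norm. *)
Lemma cut_distC U W : bkernel U -> bkernel W -> cut_dist U W = cut_dist W U.
Proof.
suff le (X Y : sqfun R) : bkernel X -> bkernel Y -> cut_dist X Y <= cut_dist Y X.
  by move=> kU kW; apply/le_anti/andP; split; [exact: (le _ _ kU kW)|exact: (le _ _ kW kU)].
move=> kX kY; apply/ler_addgt0Pr => e e0.
have [phi p0 lt] := cut_dist_lt kY kX (ltr_pwDr e0 (lexx (cut_dist Y X))).
have [psi [psi0 K1 K2]] := Phi0_inv p0.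
apply: le_trans (ltW lt); apply: le_trans (cut_dist_le kX kY psi0) _.
have kXp := bkernel_pullback0 p0 kX.
rewrite -(cut_norm_pullback psi0 (bkernelB kY kXp)).
have kYp := bkernel_pullback0 psi0 kY.
rewrite [leLHS](cut_norm_distC kX kYp).
rewrite (@cut_norm_eq (pullback (Y \- pullback X phi) psi) (pullback Y psi \- X))//.
by move=> p Qp /=; rewrite -[in RHS](pullbackK X K2 Qp).
Qed.

(** [W] is relabelled by [psi \o phi]: the distance of [V] and [W^psi] is unchanged when both are
    pulled back by [phi]. *)
Lemma cut_dist_triangle U V W : bkernel U -> bkernel V -> bkernel W ->
  cut_dist U W <= cut_dist U V + cut_dist V W.
Proof.
move=> kU kV kW; apply/ler_addgt0Pr => e e0.
have e20 : 0 < e / 2 by rewrite divr_gt0.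
have [phi p0 lt1] := cut_dist_lt kU kV (ltr_pwDr e20 (lexx (cut_dist U V))).
have [psi q0 lt2] := cut_dist_lt kV kW (ltr_pwDr e20 (lexx (cut_dist V W))).
apply: le_trans (cut_dist_le kU kW (Phi0_comp q0 p0)) _.
have kVp := bkernel_pullback0 p0 kV.
have kWq := bkernel_pullback0 q0 kW.
have kWqp := bkernel_pullback0 p0 kWq.
have e12 : cut_norm (pullback V phi \- pullback W (psi \o phi)) =
    cut_norm (V \- pullback W psi).
  rewrite -[RHS](cut_norm_pullback p0 (bkernelB kV kWq)).
  exact: cut_norm_eq.
apply: le_trans (cut_norm_triangle kU kVp kWqp) _; rewrite [X in _ + X]e12.
have := ltW (ltrD lt1 lt2); rewrite [X in _ <= X -> _]addrACA -splitr; exact.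
Qed.

Lemma cut_distxx U : bkernel U -> cut_dist U U = 0.
Proof.
move=> kU; apply/eqP; rewrite eq_le cut_dist_ge0// andbT.
apply: le_trans (cut_dist_le kU kU Phi0_id) _.
rewrite (@cut_norm_eq _ (fun p => 0 * U p)).
  by apply: le_trans (cut_normZ _ kU) _; rewrite normr0 mul0r.
by move=> [x y] _; rewrite /pullback /= subrr mul0r.
Qed.

Lemma graphit_self U : is_graphon U -> graphit U U.
Proof. by move=> gU; split => //; apply: cut_distxx; exact: graphon_bkernel. Qed.

Lemma graphit_distE U W : is_graphon U -> is_graphon W ->
  graphit_dist (graphit U) (graphit W) = cut_dist U W.
Proof.
move=> gU gW; rewrite /graphit_dist [X in inf X](_ : _ = [set cut_dist U W]) ?inf1//.
have kU := graphon_bkernel gU; have kW := graphon_bkernel gW.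
apply/seteqP; split => [r|_ ->] /=; last first.
  by exists U, W; split => //; exact: graphit_self.
move=> [U' [W' [[gU' UU'] [gW' WW'] ->]]].
have kU' := graphon_bkernel gU'; have kW' := graphon_bkernel gW'.
apply/eqP; rewrite eq_le; apply/andP; split.
  apply: le_trans (cut_dist_triangle kU' kU kW') _; rewrite UU' add0r.
  by apply: le_trans (cut_dist_triangle kU kW kW') _; rewrite [X in _ + X]cut_distC// WW' addr0.
apply: le_trans (cut_dist_triangle kU kU' kW) _; rewrite [X in X + _]cut_distC// UU' add0r.
by apply: le_trans (cut_dist_triangle kU' kW' kW) _; rewrite WW' addr0.
Qed.

Lemma graphit_eq U W : is_graphon U -> is_graphon W -> cut_dist U W = 0 ->
  graphit U = graphit W.
Proof.
suff le (X Y : sqfun R) : is_graphon X -> is_graphon Y -> cut_dist X Y = 0 -> graphit X `<=` graphit Y.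
  move=> gU gW UW; apply/seteqP; split; first exact: (le _ _ gU gW UW).
  apply: (le _ _ gW gU).
  by rewrite (cut_distC (graphon_bkernel gW) (graphon_bkernel gU)).
move=> gX gY XY Z [gZ ZX]; split; first exact: gZ.
have kX := graphon_bkernel gX; have kY := graphon_bkernel gY; have kZ := graphon_bkernel gZ.
apply/eqP; rewrite eq_le cut_dist_ge0// andbT.
by apply: le_trans (cut_dist_triangle kZ kX kY) _; rewrite ZX XY addr0.
Qed.

Lemma graphit_eq0 U W : is_graphon U -> graphit U = graphit W -> cut_dist U W = 0.
Proof. by move=> gU UW; have := graphit_self gU; rewrite UW => -[]. Qed.

End CutMetric.

(** * Overlays and interval exchanges *)

Section Exchange.
Variable R : realType.
Local Notation leb := (@lebesgue_measure R).
Local Notation mu := (@completed_lebesgue_measure R).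

Lemma shift_borel (c : R) (A : set (measurableTypeR R)) : measurable A ->
  measurable ((fun x => x + c) @^-1` A : set (measurableTypeR R)) /\
  leb ((fun x => x + c) @^-1` A) = leb A.
Proof.
pose s : measurableTypeR R -> measurableTypeR R := fun x => x + c.
have ms : measurable_fun setT s by exact: measurable_funD.
move=> mA; split; first by rewrite -[_ @^-1` _]setTI; exact: ms.
have := @lebesgue_measure_unique R (pushforward leb s).
move=> /(_ ms) U; apply/esym/U => // _ [[a b] _ <-].
rewrite -[RHS]/(leb (s @^-1` `]a, b]%classic)).
have -> : s @^-1` `]a, b]%classic = `]a - c, b - c]%classic.
  by apply/seteqP; split => x; rewrite /s /= !in_itv/= ltrBlDr lerBrDr.
rewrite !lebesgue_measure_itv/= !lte_fin ltrD2r; case: ifP => // _.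
by rewrite -!EFinB opprB addrA subrK.
Qed.

Lemma mu_null_sub (A N : set (line_L R)) : measurable N -> mu N = 0%E -> A `<=` N ->
  measurable A /\ mu A = 0%E.
Proof.
move=> mN N0 AN; split.
  by apply: (@completed_lebesgue_measure_is_complete R); exists N; split.
apply/eqP; rewrite eq_le outer_measure_ge0 andbT -N0; exact: le_outer_measure.
Qed.

Lemma shift_lebesgue (c : R) (A : set (line_L R)) : measurable A ->
  measurable ((fun x => x + c) @^-1` A : set (line_L R)) /\
  mu ((fun x => x + c) @^-1` A) = mu A.
Proof.
move=> mA; have [B [N [mB mN N0 BA AN]]] := line_borelU mA.
have [mB' eB] := shift_borel c mB; have [mN' eN] := shift_borel c mN.
have [mD D0] := mu_null_sub (borel_line mN) N0 AN.
have [mD' D0'] : measurable ((fun x => x + c) @^-1` (A `\` B) : set (line_L R)) /\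
    mu ((fun x => x + c) @^-1` (A `\` B)) = 0%E.
  apply: (mu_null_sub (borel_line mN')); first by rewrite line_measureE eN.
  by move=> x /AN.
have DI (X Y : set R) : X `&` (Y `\` X) = set0 by rewrite setDE setICA setICr setI0.
rewrite -(setDUK BA) preimage_setU; split.
  by apply: measurableU => //; exact: borel_line.
rewrite measureU//; [|exact: borel_line|by rewrite -preimage_setI DI preimage_set0].
rewrite measureU//; [|exact: borel_line].
by congr (_ + _)%E; [exact: eB|rewrite [LHS]D0' [RHS]D0].
Qed.

(** Stated for an arbitrary additive set function because it is applied to measures with extended
    real values, to integrals and to real masses. *)
Lemma additive_fibers d (T : measurableType d) (V : nmodType) (f : set T -> V)
    (J : finType) (idx : T -> J) (X : set T) :
  f set0 = 0 ->
  (forall A B, measurable A -> measurable B -> A `<=` X -> B `<=` X ->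
    A `&` B = set0 -> f (A `|` B) = f A + f B) ->
  (forall j, measurable (X `&` idx @^-1` [set j])) ->
  f X = \sum_j f (X `&` idx @^-1` [set j]).
Proof.
move=> f0 fU mX.
suff H (s : seq J) : uniq s -> measurable (X `&` [set x | idx x \in s]) /\
    f (X `&` [set x | idx x \in s]) = \sum_(j <- s) f (X `&` idx @^-1` [set j]).
  have [_] := H (enum J) (enum_uniq J); rewrite big_enum/= => <-.
  by congr f; apply/esym/setIidl => x _ /=; rewrite mem_enum.
elim: s => [|j s IH] /=.
  rewrite big_nil (_ : _ `&` _ = set0) ?f0; first by split.
  by apply/seteqP; split => // x [].
move=> /andP[js us]; have [mS eS] := IH us.
have E : X `&` [set x | idx x \in j :: s] =
    (X `&` idx @^-1` [set j]) `|` (X `&` [set x | idx x \in s]).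
  rewrite -setIUr; congr (_ `&` _); apply/seteqP; split => x /=; rewrite inE.
    by case/orP => [/eqP|]; [left|right].
  by case=> [->|->]; rewrite ?eqxx ?orbT.
rewrite E big_cons; split; first exact: measurableU.
rewrite fU ?eS//.
by apply/seteqP; split => // x [[_ /= e] [_ /=]]; rewrite e (negbTE js).
Qed.

Lemma measurable_fibers d (T : measurableType d) (J : finType) (idx : T -> J)
    (X : set T) :
  (forall j, measurable (X `&` idx @^-1` [set j])) -> measurable X.
Proof.
move=> mX; have -> : X = \bigcup_(j in [set: J]) (X `&` idx @^-1` [set j]).
  by apply/seteqP; split => [x Xx|x [j _ []]//]; exists (idx x).
exact: fin_bigcup_measurable.
Qed.

Lemma measure_fibers d (T : measurableType d) (nu : {measure set T -> \bar R})
    (J : finType) (idx : T -> J) (X : set T) :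
  (forall j, measurable (X `&` idx @^-1` [set j])) ->
  nu X = (\sum_j nu (X `&` idx @^-1` [set j]))%E.
Proof.
apply: (@additive_fibers _ _ _ (fun A => nu A)); first exact: measure0.
by move=> A B mA mB _ _ AB; exact: measureU.
Qed.

Definition cell (a l x : R) := a <= x < a + l.

(** [a] gives the left ends and [l] the lengths of half-open cells that partition [0,1). Empty cells
    are allowed, since an overlay may have zero entries. *)
Definition tiling (K : finType) (a l : K -> R) : Prop :=
  [/\ forall k x, cell (a k) (l k) x -> 0 <= x < 1,
      forall x, 0 <= x < 1 -> exists k, cell (a k) (l k) x
    & forall k k' x, cell (a k) (l k) x -> cell (a k') (l k') x -> k = k'].

Section IntervalExchange.
Variable K : finType.
Implicit Types a b l : K -> R.

Definition find_cell a l x : option K := [pick k | cell (a k) (l k) x].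

Lemma find_cellP a l x k : tiling a l -> cell (a k) (l k) x -> find_cell a l x = Some k.
Proof.
move=> [_ _ ainj] kx; rewrite /find_cell; case: pickP => [k' k'x|/(_ k)].
  by congr Some; exact: ainj k'x kx.
by rewrite kx.
Qed.

Lemma find_cell_some a l x k : find_cell a l x = Some k -> cell (a k) (l k) x.
Proof. by rewrite /find_cell; case: pickP => // k' k'x [<-]. Qed.

Lemma find_cell_none a l x : tiling a l -> find_cell a l x = None -> ~ (0 <= x < 1).
Proof.
by move=> ta E /(let: And3 _ c _ := ta in c x) [k /(find_cellP ta)]; rewrite E.
Qed.

(** Points outside [0,1) are fixed; in particular 1 stays in place, which makes the exchange a
    bijection of the closed interval. *)
Definition exchange a b l x : R :=
  if find_cell a l x is Some k then x - a k + b k else x.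

Lemma exchange_cell a b l x k : tiling a l -> cell (a k) (l k) x ->
  exchange a b l x = x - a k + b k /\ cell (b k) (l k) (exchange a b l x).
Proof.
move=> ta kx; rewrite /exchange (find_cellP ta kx); split => //.
by move: kx; rewrite /cell; lra.
Qed.

Lemma exchange_out a b l x : tiling a l -> ~ (0 <= x < 1) -> exchange a b l x = x.
Proof.
move=> [ta _ _] nx; rewrite /exchange; case E : find_cell => [k|//].
by case: nx; apply: ta; exact: find_cell_some E.
Qed.

Lemma exchange_homo a b l : tiling a l -> tiling b l ->
  {homo exchange a b l : x / unitI x}.
Proof.
move=> ta tb x; rewrite /unitI/= !in_itv/= => /andP[x0 x1].
have [xlt|xge] := ltP x 1.
  have [_ /(_ x)] := ta; rewrite x0 xlt => /(_ isT)[k kx] _.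
  have [_ bx] := exchange_cell b ta kx; have [/(_ _ _ bx)/andP[-> /ltW ->]] := tb.
  by [].
have -> : exchange a b l x = x.
  by apply: (exchange_out _ ta) => /andP[_]; rewrite ltNge xge.
by rewrite x0.
Qed.

Lemma exchangeK a b l x : tiling a l -> tiling b l -> 
  exchange b a l (exchange a b l x) = x.
Proof.
move=> ta tb; have [xin|/negP nx] := boolP (0 <= x < 1); last by rewrite !exchange_out.
have [_ /(_ x xin)[k kx] _] := ta.
have [E bx] := exchange_cell b ta kx; have [-> _] := exchange_cell a tb bx.
by rewrite E; lra.
Qed.

Lemma measurable_cell a l k (X : set (line_L R)) : measurable X ->
  tiling a l -> measurable (X `&` find_cell a l @^-1` [set Some k] : set (line_L R)).
Proof.
move=> mX ta; apply: measurableI => //.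
rewrite (_ : _ @^-1` _ = `[a k, a k + l k[%classic).
  by apply: borel_line; exact: measurable_itv.
apply/seteqP; split => x /=; rewrite in_itv/=; first exact: find_cell_some.
exact: find_cellP.
Qed.

Lemma measurable_none a l : tiling a l ->
  measurable (unitI `&` find_cell a l @^-1` [set None] : set (line_L R)) /\
  mu (unitI `&` find_cell a l @^-1` [set None]) = 0%E.
Proof.
move=> ta; apply: (@mu_null_sub _ [set 1]).
- by apply: borel_line; exact: measurable_set1.
- by rewrite line_measureE lebesgue_measure_set1.
move=> x [/= + /(find_cell_none ta)]; rewrite /unitI/= in_itv/= => /andP[x0 x1].
rewrite x0/= => /negP; rewrite -leNgt => x1'.
by apply/eqP; rewrite eq_le x1.
Qed.

(** On each cell the exchange is the translation by [b k - a k], and only the point 1 of the closed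
    interval lies outside all cells. *)
Lemma exchange_preserving a b l : tiling a l -> tiling b l ->
  measure_preserving (exchange a b l).
Proof.
move=> ta tb.
have cellE (A : set R) k : find_cell a l @^-1` [set Some k] `&` exchange a b l @^-1` A =
    (fun x => x + (b k - a k)) @^-1` (find_cell b l @^-1` [set Some k] `&` A).
  apply/seteqP; split => x /=.
    move=> [/find_cell_some kx Ax]; have [E bx] := exchange_cell b ta kx.
    have -> : x + (b k - a k) = exchange a b l x by rewrite E; lra.
    by split => //; exact: find_cellP.
  move=> [/find_cell_some kx Ax].
  have kx' : cell (a k) (l k) x by move: kx; rewrite /cell; lra.
  have [E bx] := exchange_cell b ta kx'.
  rewrite (find_cellP ta kx'); split => //.
  by have <- : x + (b k - a k) = exchange a b l x by rewrite E; lra.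
have inI c k : tiling c l -> find_cell c l @^-1` [set Some k] `<=` unitI.
  move=> tc x kx; have [/(_ _ _ (find_cell_some kx))/andP[x0 x1] _ _] := tc.
  by rewrite /unitI/= in_itv/= x0 ltW.
have fib (A : set R) k : unitI `&` exchange a b l @^-1` A `&` find_cell a l @^-1` [set Some k]
   = (fun x => x + (b k - a k)) @^-1` (A `&` find_cell b l @^-1` [set Some k]).
  rewrite setIAC (setIidr (inI a k ta)) cellE; congr (_ @^-1` _); exact: setIC.
have fibN (A : set R) c : tiling c l ->
    measurable (unitI `&` A `&` find_cell c l @^-1` [set None] : set (line_L R)) /\
    mu (unitI `&` A `&` find_cell c l @^-1` [set None]) = 0%E.
  move=> tc; have [mN N0] := measurable_none tc; apply: (mu_null_sub mN N0).
  by rewrite setIAC; exact: subIsetl.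
have mfib (A : set (line_L R)) k : measurable A -> measurable
    (unitI `&` exchange a b l @^-1` A `&` find_cell a l @^-1` [set k] : set (line_L R)).
  case: k => [k|] mA; last by have [] := fibN (exchange a b l @^-1` A) a ta.
  by rewrite fib; have [] := shift_lebesgue (b k - a k) (measurable_cell k mA tb).
split=> [_ A mA|A mA AI]; first by apply: (@measurable_fibers _ (line_L R) _ (find_cell a l)) => k; exact: mfib.
rewrite (@measure_fibers _ _ mu _ (find_cell a l)); last by move=> k; exact: mfib.
rewrite [RHS](@measure_fibers _ _ mu _ (find_cell b l)) => [|[k|]]; last first.
- by rewrite -(setIidr AI); have [] := fibN A b tb.
- exact: measurable_cell.
apply: eq_bigr => -[k|] _.
  rewrite fib.
  exact: (shift_lebesgue (b k - a k) (measurable_cell k mA tb)).2.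
have [_ e1] := fibN (exchange a b l @^-1` A) a ta; have [_ e2] := fibN A b tb.
by rewrite [LHS]e1 -{1}(setIidr AI) [RHS]e2.
Qed.

Lemma exchange_Phi0 a b l : tiling a l -> tiling b l -> Phi0 (exchange a b l).
Proof.
move=> ta tb; exists (exchange b a l); split.
- exact: exchange_homo.
- exact: exchange_homo.
- by move=> x _; exact: exchangeK.
- by move=> x _; exact: exchangeK.
- by split; exact: exchange_preserving.
Qed.

End IntervalExchange.
End Exchange.

(** * Construction of tilings from lengths *)

Section Tilings.
Variable R : realType.

Definition tiling_of (s : R) (K : finType) (a l : K -> R) : Prop :=
  [/\ forall k x, cell (a k) (l k) x -> 0 <= x < s,
      forall x, 0 <= x < s -> exists k, cell (a k) (l k) x
    & forall k k' x, cell (a k) (l k) x -> cell (a k') (l k') x -> k = k'].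

Definition psum n (l : 'I_n -> R) (i : nat) : R := \sum_(j < n | (j < i)%N) l j.

Lemma psumS n (l : 'I_n -> R) (k : 'I_n) : psum l k.+1 = psum l k + l k.
Proof.
rewrite /psum (bigD1 k)//= addrC; congr (_ + _); apply: eq_bigl => j.
by rewrite ltnS ltn_neqAle andbC.
Qed.

Lemma le_psum n (l : 'I_n -> R) i i' : (forall j, 0 <= l j) -> (i <= i')%N ->
  psum l i <= psum l i'.
Proof.
move=> l0 ii'; rewrite /psum [leLHS]big_mkcond [leRHS]big_mkcond/=.
apply: ler_sum => j _; case: ifP => ji; first by rewrite (leq_trans ji).
by case: ifP.
Qed.

Lemma psum_tiling n (l : 'I_n -> R) s : (forall j, 0 <= l j) -> \sum_j l j = s ->
  tiling_of s (fun k : 'I_n => psum l k) l.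
Proof.
move=> l0 ls.
have psum0 : psum l 0 = 0 by rewrite /psum big_pred0.
have psumn : psum l n = s by rewrite -ls; apply: eq_bigl => j; rewrite ltn_ord.
split=> [k x /andP[x1 x2]|x /andP[x0 xs]|k k' x].
- apply/andP; split; first by apply: le_trans x1; rewrite -psum0 le_psum.
  by apply: (lt_le_trans x2); rewrite -psumS -psumn le_psum.
(* The cell of [x] ends at the first partial sum above [x]. *)
- have exP : exists i, x < psum l i by exists n; rewrite psumn.
  case: (ex_minnP exP) => -[|i] xi imin; first by move: xi; rewrite psum0 ltNge x0.
  have i_n : (i < n)%N by apply: imin; rewrite psumn.
  exists (Ordinal i_n); rewrite /cell -psumS xi andbT leNgt.
  by apply/negP => /imin; rewrite ltnn.
- move=> /andP[x1 x2] /andP[x1' x2']; apply/eqP; case: ltngtP (val_eqE k k') => //= kk' _.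
    have : psum l k.+1 <= psum l k' by exact: le_psum.
    by rewrite psumS => h; have := lt_le_trans x2 (le_trans h x1'); rewrite ltxx.
  have : psum l k'.+1 <= psum l k by exact: le_psum.
  by rewrite psumS => h; have := lt_le_trans x2' (le_trans h x1); rewrite ltxx.
Qed.

Lemma tiling_pair (K L : finType) (a l : K -> R) (c d : K -> L -> R) :
  tiling a l -> (forall k, tiling_of (l k) (c k) (d k)) ->
  tiling (fun kg : K * L => a kg.1 + c kg.1 kg.2) (fun kg => d kg.1 kg.2).
Proof.
have shift x y z w : cell (x + y) z w = cell y z (w - x).
  by rewrite /cell; apply/idP/idP; lra.
move=> [t1 t2 t3] tk.
have up k g x : cell (a k + c k g) (d k g) x -> cell (a k) (l k) x.
  by rewrite shift; have [h _ _] := tk k; move=> /h; rewrite /cell; lra.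
split=> [[k g] x /= /up /t1//|x /t2[k kx]|[k g] [k' g'] x /= h h'].
  have [_ h _] := tk k; have [|g gx] := h (x - a k); first by move: kx; rewrite /cell; lra.
  by exists (k, g); rewrite shift.
have kk' := t3 _ _ _ (up _ _ _ h) (up _ _ _ h'); rewrite -kk' in h' *.
by congr (_, _); move: h h'; rewrite !shift; have [_ _] := tk k; exact.
Qed.

Lemma tiling_swap (K L : finType) (a l : K * L -> R) :
  tiling a l -> tiling (fun p : L * K => a (p.2, p.1)) (fun p => l (p.2, p.1)).
Proof.
move=> [t1 t2 t3]; split=> [[g k] x /t1//|x /t2[[k g] kx]|[g k] [g' k'] x h h'].
  by exists (g, k).
by have [-> ->] := t3 _ _ _ h h'.
Qed.

Lemma grid_tiling n : (0 < n)%N ->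
  tiling (fun k : 'I_n => k%:R / n%:R : R) (fun=> n%:R^-1).
Proof.
move=> n0.
have E' i : (i <= n)%N -> @psum n (fun=> n%:R^-1) i = i%:R / n%:R :> R.
  elim: i => [_|i IH i_n]; first by rewrite /psum big_pred0 ?mul0r.
  have /= -> := @psumS n (fun=> n%:R^-1) (Ordinal i_n).
  by rewrite IH ?(ltnW i_n)// -natr1 mulrDl mul1r.
have E (k : 'I_n) : @psum n (fun=> n%:R^-1) k = k%:R / n%:R :> R by exact: (E' k (ltnW (ltn_ord k))).
have [||t1 t2 t3] := @psum_tiling n (fun=> n%:R^-1) 1.
- by move=> _; rewrite invr_ge0.
- by rewrite sumr_const card_ord -[LHS]mulr_natl divff// pnatr_eq0 -lt0n.
split=> [k x|x /t2[k]|k k' x]; rewrite -?E; [exact: t1| |exact: t3].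
by rewrite E; exists k.
Qed.

End Tilings.

(** * Integrals and norms of step kernels *)

Section StepKernels.
Variable R : realType.
Local Notation mu := (@completed_lebesgue_measure R).

Section Step.
Variables (J : finType) (idx : R -> J) (F : J -> J -> R).
Hypothesis midx : forall j, measurable (unitI `&` idx @^-1` [set j] : set (line_L R)).

Definition weight (S : set R) (j : J) : R := fine (mu (S `&` idx @^-1` [set j])).

Lemma measurable_idx (S : set (line_L R)) j : measurable S -> S `<=` unitI ->
  measurable (S `&` idx @^-1` [set j] : set (line_L R)).
Proof. by move=> mS SI; rewrite -(setIidl SI) -setIA; exact: measurableI. Qed.

Lemma mu_lty (S : set (line_L R)) : S `<=` unitI -> (mu S < +oo)%E.
Proof.
move=> SI; apply: (@le_lt_trans _ _ (mu (unitI : set R))).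
  exact: le_outer_measure.
by rewrite mu_unitI ltry.
Qed.

Lemma mu_fin (S : set (line_L R)) : S `<=` unitI -> mu S \is a fin_num.
Proof. by move=> SI; rewrite ge0_fin_numE ?mu_lty// outer_measure_ge0. Qed.

Lemma weight_ge0 S j : 0 <= weight S j.
Proof. by rewrite fine_ge0// outer_measure_ge0. Qed.

Lemma weight_le (S : set R) j : S `<=` unitI -> weight S j <= weight unitI j.
Proof.
move=> SI; apply: fine_le; [apply: mu_fin|apply: mu_fin; exact: subIsetl|].
  by move=> x [/SI].
by apply: le_outer_measure; exact: setSI.
Qed.

Local Notation idx2 := (fun p : plane_L R => (idx p.1, idx p.2) : J * J).

Lemma rect_fiber (S T : set R) (j k : J) : (S `*` T) `&` idx2 @^-1` [set (j, k)] =
  (S `&` idx @^-1` [set j]) `*` (T `&` idx @^-1` [set k]) :> set (R * R).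
Proof.
apply/seteqP; split => -[x y] /=; first by move=> [[? ?] [-> ->]].
by move=> [[/= ? ->] [? ->]].
Qed.

Variable W : sqfun R.
Hypothesis WF : forall x y, unitI x -> unitI y -> W (x, y) = F (idx x) (idx y).

Lemma step_bkernel : bkernel W.
Proof.
split.
  exists (\sum_j \sum_k `|F j k|) => -[x y] [/= Ix Iy]; rewrite WF//.
  rewrite (bigD1 (idx x))//= (bigD1 (idx y))//= -addrA lerDl addr_ge0//.
    by apply: sumr_ge0.
  by apply: sumr_ge0 => j _; apply: sumr_ge0.
move=> _ B mB; apply: (@measurable_fibers _ (plane_L R) _ idx2) => -[j k].
have [FB|nFB] := pselect (B (F j k)).
  rewrite (_ : _ `&` _ = (unitI `&` idx @^-1` [set j]) `*` (unitI `&` idx @^-1` [set k])).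
    by have [] := plane_rect (midx j) (midx k).
  rewrite -rect_fiber; apply/seteqP; split => -[x y] /=; first by move=> [[]].
  by move=> [[/= Ix Iy] [jx ky]]; split; [split => //=; rewrite WF// jx ky|rewrite /= jx ky].
rewrite (_ : _ `&` _ = set0)//; apply/seteqP; split => -[x y] //=.
by move=> [[[/= Ix Iy] +] [jx ky]]; rewrite /= WF// jx ky.
Qed.

Lemma step_integral (S T : set (line_L R)) : unit_sets S T ->
  integral2 (S `*` T) W = \sum_j \sum_k F j k * (weight S j * weight T k).
Proof.
move=> ST; have [mS mT SI TI] := ST; have [mST STQ] := unit_setsX ST.
have rectQ (A B : set R) : A `<=` unitI -> B `<=` unitI -> A `*` B `<=` @unitQ R.
  by move=> AI BI [x y] [/= /AI ? /BI].
have mR j k : measurable ((S `*` T) `&` idx2 @^-1` [set (j, k)] : set (plane_L R)).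
  rewrite rect_fiber.
  by have [] := plane_rect (measurable_idx j mS SI) (measurable_idx k mT TI).
rewrite (@additive_fibers _ (plane_L R) _ (fun A => integral2 A W) _ idx2).
- rewrite pair_bigA/=; apply: eq_bigr => -[j k] _ /=; rewrite rect_fiber.
  have mSj := measurable_idx j mS SI; have mTk := measurable_idx k mT TI.
  have [mX eX] := plane_rect mSj mTk.
  have SjI : S `&` idx @^-1` [set j] `<=` unitI by move=> x [/SI].
  have TkI : T `&` idx @^-1` [set k] `<=` unitI by move=> x [/TI].
  rewrite (@integral2_eq _ _ _ (fun=> F j k)).
    rewrite integral2_cst//; last exact: rectQ.
    by rewrite eX fineM//; exact: mu_fin.
  by move=> [x y] [[/= /SI Ix jx] [/= /TI Iy ky]]; rewrite WF// jx ky.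
- exact: Rintegral_set0.
- move=> A B mA mB AS BS AB; apply: integral2U => //; [exact: subset_trans AS STQ|
    exact: subset_trans BS STQ|exact: step_bkernel].
- by move=> [j k]; exact: mR.
Qed.

(** [S] and [T] enter the integral of a step kernel only through the measures of their traces on the
    fibres, and these are fractional weights below the full ones. *)
Lemma step_cut_norm (c : R) :
  (forall u v : J -> R, (forall j, 0 <= u j <= weight unitI j) ->
     (forall j, 0 <= v j <= weight unitI j) ->
     `|\sum_j \sum_k F j k * (u j * v k)| <= c) ->
  cut_norm W <= c.
Proof.
move=> Fc; apply: cut_norm_le => S T ST; rewrite step_integral//.
by have [mS mT SI TI] := ST; apply: Fc => j; rewrite weight_ge0 weight_le.
Qed.

End Step.

Lemma step_norm1 (J : finType) (idx : R -> J) (F : J -> J -> R) (W : sqfun R) :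
  (forall j, measurable (unitI `&` idx @^-1` [set j] : set (line_L R))) ->
  (forall x y, unitI x -> unitI y -> W (x, y) = F (idx x) (idx y)) ->
  norm1 W = \sum_j \sum_k `|F j k| * (weight idx unitI j * weight idx unitI k).
Proof.
move=> midx WF; rewrite /norm1 /unitQ.
rewrite (step_integral (idx := idx) (F := fun j k => `|F j k|) midx)//.
  by move=> x y Ix Iy; rewrite WF.
by split=> //; exact: measurable_unitI.
Qed.

End StepKernels.

(** * Graph kernels and overlays as finite sums *)

Section GraphKernels.
Variable R : realType.
Local Notation mu := (@completed_lebesgue_measure R).

Lemma sum_option (V : nmodType) (T : finType) (f : option T -> V) :
  f None = 0 -> \sum_o f o = \sum_t f (Some t).
Proof.
move=> f0; rewrite (bigD1 None)//= f0 add0r (reindex_omap Some id) => [|[]]//=.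
by apply: eq_bigl => t; rewrite eqxx.
Qed.

Lemma sum_option2 (V : nmodType) (T U : finType) (f : option T * option U -> V) :
  (forall o, f (None, o) = 0) -> (forall o, f (o, None) = 0) ->
  \sum_j f j = \sum_(x : T * U) f (Some x.1, Some x.2).
Proof.
move=> f0 f1.
rewrite -(pair_bigA _ (fun t u => f (Some t, Some u)))/=.
transitivity (\sum_o \sum_o' f (o, o')).
  by rewrite pair_bigA; apply: eq_bigr => -[].
rewrite sum_option; last by rewrite big1.
by apply: eq_bigr => t _; rewrite sum_option.
Qed.

Definition mass (S : set R) : R := fine (mu S).

Lemma mass_fibers (J : finType) (idx : R -> J) (S : set (line_L R)) : S `<=` unitI ->
  (forall j, measurable (S `&` idx @^-1` [set j] : set (line_L R))) ->
  mass S = \sum_j weight idx S j.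
Proof.
move=> SI mS; apply: (@additive_fibers _ (line_L R)) => //.
  by rewrite /mass measure0.
move=> A B mA mB AS BS AB; rewrite /mass measureU//.
by rewrite fineD//; apply: mu_fin; [exact: subset_trans AS SI|exact: subset_trans BS SI].
Qed.

Definition grid n (x : R) : option 'I_n :=
  find_cell (fun k : 'I_n => k%:R / n%:R) (fun=> n%:R^-1) x.

(* [grid n x = None] only for [x] outside [0, 1). *)
Definition adjO n (G : sgraph n) (o o' : option 'I_n) : R :=
  if o is Some i then if o' is Some j then adjR R G i j else 0 else 0.

Lemma graphon_of_graphE n (G : sgraph n) x y :
  @graphon_of_graph R n G (x, y) = adjO G (grid n x) (grid n y).
Proof.
(* For [n = 0] there are no cells and both sides are 0; the grid is a tiling only for positive
   [n]. *)
case: n G => [|n] G.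
  rewrite /adjO; case: (grid 0 x) => [[]//|]; rewrite /graphon_of_graph.
  by case: existsP => // -[[]].
have tG := grid_tiling R (ltn0Sn n).
have cE (k : 'I_n.+1) z : (z \in `[k%:R / n.+1%:R, k.+1%:R / n.+1%:R[) =
    cell (k%:R / n.+1%:R) (n.+1%:R^-1) z.
  by rewrite in_itv/= /cell -[k.+1%:R]natr1 mulrDl mul1r.
rewrite /graphon_of_graph /adjO /grid.
case: existsP => [[k /existsP[l /and3P[]]]|].
  by rewrite !cE /= => kx ly Gkl; rewrite (find_cellP tG kx) (find_cellP tG ly) /adjR Gkl.
case Ex : find_cell => [k|//]; case Ey : find_cell => [l|//] /= nG.
rewrite /adjR; case Gkl : (adj G k l) => //; case: nG; exists k; apply/existsP; exists l.
by rewrite !cE /= (find_cell_some Ex) (find_cell_some Ey).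
Qed.

Lemma measurable_grid n j : (0 < n)%N ->
  measurable (unitI `&` grid n @^-1` [set j] : set (line_L R)).
Proof.
move=> n0; have tG := grid_tiling R n0; case: j => [k|].
  by apply: measurable_cell => //; exact: measurable_unitI.
by have [] := measurable_none tG.
Qed.

Lemma mass_grid_none n : (0 < n)%N -> mass (unitI `&` grid n @^-1` [set None]) = 0.
Proof. by move=> n0; have [_] := measurable_none (grid_tiling R n0); rewrite /mass => ->. Qed.

Lemma mass_cell (a l : R) : 0 <= l -> mass [set x | cell a l x] = l.
Proof.
move=> l0; rewrite /mass (_ : [set x | _] = `[a, a + l[%classic).
  rewrite line_measureE lebesgue_measure_itv/= lte_fin; case: ltP => [_|].
    by rewrite -EFinB/= addrC addKr.
  by rewrite gerDl => h; apply/esym/eqP; rewrite eq_le h.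
by apply/seteqP; split => x /=; rewrite in_itv.
Qed.

Lemma grid_someE n k : (0 < n)%N ->
  grid n @^-1` [set Some k] = [set x | cell (k%:R / n%:R) n%:R^-1 x].
Proof.
move=> n0; have tG := grid_tiling R n0; apply/seteqP; split => x /=.
  exact: find_cell_some.
exact: find_cellP.
Qed.

Lemma grid_unitI n k : (0 < n)%N -> grid n @^-1` [set Some k] `<=` unitI.
Proof.
move=> n0 x; rewrite grid_someE// => /= kx; have [t1 _ _] := grid_tiling R n0.
by have /andP[x0 x1] := t1 _ _ kx; rewrite /unitI/= in_itv/= x0 ltW.
Qed.

Lemma mass_grid n k : (0 < n)%N -> mass (unitI `&` grid n @^-1` [set Some k]) = n%:R^-1.
Proof. by move=> n0; rewrite (setIidr (@grid_unitI n k n0)) grid_someE// mass_cell. Qed.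

Section Relabelled.
Variables (m n : nat) (phi : R -> R).
Hypotheses (m0 : (0 < m)%N) (n0 : (0 < n)%N) (p0 : Phi0 phi).

(** The common refinement of the grid of [m] cells and the [phi]-preimage of the grid of [n] cells;
    the difference of the two graph kernels is a step kernel on it. *)
Definition grid2 (x : R) : option 'I_m * option 'I_n := (grid m x, grid n (phi x)).

Lemma phi_preimage (A : set (line_L R)) : measurable A -> A `<=` unitI ->
  measurable (unitI `&` phi @^-1` A : set (line_L R)) /\
  mass (unitI `&` phi @^-1` A) = mass A.
Proof.
move=> mA AI; have [mphi ephi] := Phi0_mp p0; split.
  by apply: mphi => //; exact: measurable_unitI.
by rewrite /mass ephi.
Qed.

Lemma phi_gridE o : unitI `&` (grid n \o phi) @^-1` [set o] =
  unitI `&` phi @^-1` (unitI `&` grid n @^-1` [set o]).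
Proof.
apply/seteqP; split => x /= [Ix].
  by move=> e; split => //; split => //; exact: (Phi0_homo p0).
by move=> [].
Qed.

Lemma measurable_phi_grid o :
  measurable (unitI `&` (grid n \o phi) @^-1` [set o] : set (line_L R)).
Proof.
by rewrite phi_gridE; have [] := phi_preimage (measurable_grid o n0) (@subIsetl _ _ _).
Qed.

Lemma mass_phi_grid o :
  mass (unitI `&` (grid n \o phi) @^-1` [set o]) = mass (unitI `&` grid n @^-1` [set o]).
Proof.
by rewrite phi_gridE; have [] := phi_preimage (measurable_grid o n0) (@subIsetl _ _ _).
Qed.

Lemma grid2E o o' : unitI `&` grid2 @^-1` [set (o, o')] =
  (unitI `&` grid m @^-1` [set o]) `&` (unitI `&` (grid n \o phi) @^-1` [set o']).
Proof.
apply/seteqP; split => x /=; first by move=> [Ix [-> ->]].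
by move=> [[Ix <-] [_ <-]].
Qed.

Lemma measurable_grid2 j : measurable (unitI `&` grid2 @^-1` [set j] : set (line_L R)).
Proof.
case: j => o o'; rewrite grid2E; apply: measurableI; first exact: measurable_grid.
exact: measurable_phi_grid.
Qed.

Lemma mass_le (A B : set R) : A `<=` B -> B `<=` unitI -> mass A <= mass B.
Proof.
move=> AB BI; apply: fine_le; [apply: mu_fin; exact: subset_trans AB BI|exact: mu_fin|].
exact: le_outer_measure.
Qed.

Lemma weight_grid2_none o : weight grid2 unitI (None, o) = 0.
Proof.
apply/eqP; rewrite eq_le weight_ge0 andbT -(mass_grid_none m0) /weight grid2E.
by apply: mass_le; exact: subIsetl.
Qed.

Lemma weight_none_grid2 o : weight grid2 unitI (o, None) = 0.
Proof.
apply/eqP; rewrite eq_le weight_ge0 andbT -(mass_grid_none n0) -mass_phi_grid /weight grid2E.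
by apply: mass_le; [exact: subIsetr|exact: subIsetl].
Qed.

Definition overlay_of : 'M[R]_(m, n) :=
  \matrix_(i, g) weight grid2 unitI (Some i, Some g).

Lemma sum_weight_grid2l o :
  \sum_o' weight grid2 unitI (o, o') = mass (unitI `&` grid m @^-1` [set o]).
Proof.
have E o' : (unitI `&` grid m @^-1` [set o]) `&` (grid n \o phi) @^-1` [set o'] =
    unitI `&` grid2 @^-1` [set (o, o')].
  by apply/seteqP; split => x /=; [move=> [[Ix e1] e2]; rewrite /grid2 -e1 -e2|move=> [Ix [e1 e2]]].
rewrite (@mass_fibers _ (grid n \o phi)); last 2 first.
- exact: subIsetl.
- by move=> o'; rewrite E; exact: measurable_grid2.
by apply: eq_bigr => o' _; rewrite /weight -E.
Qed.

Lemma sum_weight_grid2r o' :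
  \sum_o weight grid2 unitI (o, o') = mass (unitI `&` grid n @^-1` [set o']).
Proof.
rewrite -mass_phi_grid.
have E o : (unitI `&` (grid n \o phi) @^-1` [set o']) `&` grid m @^-1` [set o] =
    unitI `&` grid2 @^-1` [set (o, o')].
  by apply/seteqP; split => x /=; [move=> [[Ix e1] e2]; rewrite /grid2 -e1 -e2|move=> [Ix [e1 e2]]].
rewrite (@mass_fibers _ (grid m)); last 2 first.
- exact: subIsetl.
- by move=> o; rewrite E; exact: measurable_grid2.
by apply: eq_bigr => o _; rewrite /weight -E.
Qed.

Lemma overlay_of_overlay : is_overlay overlay_of.
Proof.
split=> [i g|i|g]; first by rewrite mxE weight_ge0.
- rewrite -(mass_grid i m0) -sum_weight_grid2l sum_option ?weight_none_grid2//.
  by apply: eq_bigr => g _; rewrite mxE.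
- rewrite -(mass_grid g n0) -sum_weight_grid2r sum_option ?weight_grid2_none//.
  by apply: eq_bigr => i _; rewrite mxE.
Qed.

Variables (G : sgraph m) (H : sgraph n).

Definition disagreement (j k : option 'I_m * option 'I_n) : R :=
  adjO G j.1 k.1 - adjO H j.2 k.2.

Local Notation WD := (@graphon_of_graph R m G \- pullback (@graphon_of_graph R n H) phi).

Lemma disagreementE x y : unitI x -> unitI y ->
  WD (x, y) = disagreement (grid2 x) (grid2 y).
Proof. by move=> _ _; rewrite /pullback /= !graphon_of_graphE. Qed.

(** Fibres with a [None] component are null, so their weights vanish and the sum reduces to pairs of
    vertices. [D] is the absolute value for the L1 norm and the identity for the cut norm. *)
Lemma disagreement_sum (D : R -> R) (w w' : option 'I_m * option 'I_n -> R) :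
  (forall j, 0 <= w j <= weight grid2 unitI j) ->
  (forall j, 0 <= w' j <= weight grid2 unitI j) ->
  \sum_j \sum_k D (disagreement j k) * (w j * w' k) =
  \sum_(x : 'I_m * 'I_n) \sum_(y : 'I_m * 'I_n)
    D (adjR R G x.1 y.1 - adjR R H x.2 y.2) *
    (w (Some x.1, Some x.2) * w' (Some y.1, Some y.2)).
Proof.
have none1 u : (forall j, 0 <= u j <= weight grid2 unitI j) -> forall o, u (None, o) = 0.
  move=> hu o; have := hu (None, o); rewrite weight_grid2_none => h.
  by apply/eqP; rewrite eq_le andbC.
have none2 u : (forall j, 0 <= u j <= weight grid2 unitI j) -> forall o, u (o, None) = 0.
  move=> hu o; have := hu (o, None); rewrite weight_none_grid2 => h.
  by apply/eqP; rewrite eq_le andbC.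
move=> hw hw'; rewrite sum_option2.
- apply: eq_bigr => x _; rewrite sum_option2//= => o.
    by rewrite (none1 _ hw') !mulr0.
  by rewrite (none2 _ hw') !mulr0.
- by move=> o; rewrite big1// => k _; rewrite (none1 _ hw) mul0r mulr0.
- by move=> o; rewrite big1// => k _; rewrite (none2 _ hw) mul0r mulr0.
Qed.

Lemma norm1_overlay : norm1 WD =
  \sum_(x : 'I_m * 'I_n) \sum_(y : 'I_m * 'I_n)
    `|adjR R G x.1 y.1 - adjR R H x.2 y.2| * (overlay_of x.1 x.2 * overlay_of y.1 y.2).
Proof.
rewrite (step_norm1 measurable_grid2 disagreementE).
have hw j : 0 <= weight grid2 unitI j <= weight grid2 unitI j by rewrite weight_ge0/=.
rewrite (disagreement_sum (fun r => `|r|) hw hw).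
by apply: eq_bigr => x _; apply: eq_bigr => y _; rewrite !mxE.
Qed.

(** The hypothesis has the form of the conclusion of [coloring]: a bound for all weights below a
    given overlay. *)
Lemma cut_norm_overlay (c : R) :
  (forall u v : 'I_m * 'I_n -> R, (forall x, 0 <= u x <= overlay_of x.1 x.2) ->
     (forall x, 0 <= v x <= overlay_of x.1 x.2) ->
     `|\sum_x \sum_y (adjR R G x.1 y.1 - adjR R H x.2 y.2) * (u x * v y)| <= c) ->
  cut_norm WD <= c.
Proof.
move=> hc; apply: (step_cut_norm measurable_grid2 disagreementE) => u v hu hv.
rewrite (disagreement_sum id hu hv).
by apply: (hc (fun x => u (Some x.1, Some x.2)) (fun x => v (Some x.1, Some x.2))) => x;
  rewrite mxE.
Qed.

End Relabelled.

(** The tiling [A] cuts the interval of each row into pieces of lengths [a i g], and [B] cuts the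
    interval of each column into pieces of the same lengths. The exchange moves the piece [(i, g)]
    from the [i]-th cell of one grid into the [g]-th cell of the other, so these two cells meet in
    mass [a i g]. *)
Lemma overlay_exchange m n (a : 'M[R]_(m, n)) : (0 < m)%N -> (0 < n)%N ->
  is_overlay a -> exists2 phi, Phi0 phi & overlay_of m n phi = a.
Proof.
move=> m0 n0 [a0 ar ac].
have tm := grid_tiling R m0; have tn := grid_tiling R n0.
pose A (kg : 'I_m * 'I_n) := kg.1%:R / m%:R + psum (a kg.1) kg.2.
pose B (kg : 'I_m * 'I_n) := kg.2%:R / n%:R + psum (a^~ kg.2) kg.1.
pose L (kg : 'I_m * 'I_n) := a kg.1 kg.2.
have t1 : tiling A L := tiling_pair tm (fun i => psum_tiling (a0 i) (ar i)).
have t2 : tiling B L :=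
  tiling_swap (tiling_pair tn (fun g => psum_tiling (fun i => a0 i g) (ac g))).
exists (exchange A B L); first exact: exchange_Phi0.
apply/matrixP => i g; rewrite mxE /weight.
rewrite -/(mass _) -[RHS](@mass_cell (A (i, g)))//; congr mass.
have up1 k h x : cell (A (k, h)) (L (k, h)) x -> grid m x = Some k.
  move=> kx; apply: (find_cellP tm).
  have [t _ _] := psum_tiling (a0 k) (ar k); have := t h (x - k%:R / m%:R).
  by move: kx; rewrite /cell /A /L /=; lra.
have up2 k h x : cell (B (k, h)) (L (k, h)) x -> grid n x = Some h.
  move=> kx; apply: (find_cellP tn).
  have [t _ _] := psum_tiling (fun i => a0 i h) (ac h); have := t k (x - h%:R / n%:R).
  by move: kx; rewrite /cell /B /L /=; lra.
apply/seteqP; split => x /=.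
  move=> [Ix [rx ry]]; have [h _ _] := tm; have x01 := h _ _ (find_cell_some rx).
  have [_ cov _] := t1; have [[k l] kx] := cov _ x01.
  have [_ ky] := exchange_cell B t1 kx.
  move: ry; rewrite (up2 _ _ _ ky) => -[<-]; move: rx; rewrite (up1 _ _ _ kx) => -[<-].
  exact: kx.
move=> kx; have [h _ _] := t1; have /andP[x0 x1] := h (i, g) x kx.
split; first by rewrite /unitI/= in_itv/= x0 ltW.
have [_ ky] := exchange_cell (k := (i, g)) B t1 kx.
by rewrite /grid2 (up1 i g _ kx) (up2 i g _ ky).
Qed.

End GraphKernels.

Section Delta1.
Variable R : realType.

Lemma adjC n (G : sgraph n) i j : adj G i j = adj G j i.
Proof. by rewrite /adj finset.setUC. Qed.

Lemma adjO01 n (G : sgraph n) o o' : adjO R G o o' = 0 \/ adjO R G o o' = 1.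
Proof.
case: o => [i|]; last by left.
by case: o' => [j|]; [rewrite /= /adjR; case: adj; [right|left]|left].
Qed.

Lemma graphon_of_graph_bkernel n (G : sgraph n) : (0 < n)%N ->
  bkernel (@graphon_of_graph R n G).
Proof.
move=> n0; apply: (@step_bkernel R _ (@grid R n) (adjO R G)).
  by move=> o; exact: measurable_grid.
by move=> x y _ _; rewrite graphon_of_graphE.
Qed.

Lemma graphon_of_graph01 n (G : sgraph n) x y :
  @graphon_of_graph R n G (x, y) = 0 \/ @graphon_of_graph R n G (x, y) = 1.
Proof. by rewrite graphon_of_graphE; exact: adjO01. Qed.

Lemma graphon_of_graphI n (G : sgraph n) : (0 < n)%N ->
  is_graphonI (@graphon_of_graph R n G).
Proof.
move=> n0; have [[M WM] mW] := graphon_of_graph_bkernel G n0.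
split; [split => //|].
- move=> x y _ _; rewrite !graphon_of_graphE /adjO.
  by case: (grid n x) => [i|]; case: (grid n y) => [j|] //; rewrite /adjR adjC.
- by exists M => x y Ix Iy; apply: WM.
- by move=> x y _ _; case: (graphon_of_graph01 G x y) => ->; rewrite ?lexx ?ler01.
Qed.

Variables (m n : nat) (G : sgraph m) (H : sgraph n).
Hypotheses (m0 : (0 < m)%N) (n0 : (0 < n)%N).

Lemma overlay_costE (a : 'M[R]_(m, n)) :
  \sum_(i < m) \sum_(j < m) \sum_(g < n)
     \sum_(h < n | adj G i j (+) adj H g h) a i g * a j h =
  \sum_(x : 'I_m * 'I_n) \sum_(y : 'I_m * 'I_n)
    `|adjR R G x.1 y.1 - adjR R H x.2 y.2| * (a x.1 x.2 * a y.1 y.2).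
Proof.
transitivity (\sum_(i < m) \sum_(g < n) \sum_(j < m) \sum_(h < n)
    `|adjR R G i j - adjR R H g h| * (a i g * a j h)).
  apply: eq_bigr => i _; rewrite exchange_big/=; apply: eq_bigr => g _.
  apply: eq_bigr => j _; rewrite big_mkcond/=; apply: eq_bigr => h _.
  rewrite /adjR; case: adj; case: adj => /=.
  - by rewrite subrr normr0 mul0r.
  - by rewrite subr0 normr1 mul1r.
  - by rewrite sub0r normrN1 mul1r.
  - by rewrite subrr normr0 mul0r.
rewrite [LHS]pair_bigA/=; apply: eq_bigr => -[i g] _ /=.
by rewrite [LHS]pair_bigA/=; apply: eq_bigr => -[j h] _.
Qed.

Lemma overlay_cost_ge0 (a : 'M[R]_(m, n)) : is_overlay a ->
  0 <= \sum_(i < m) \sum_(j < m) \sum_(g < n)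
     \sum_(h < n | adj G i j (+) adj H g h) a i g * a j h.
Proof. by move=> [a0 _ _]; do 4 apply: sumr_ge0 => ? _; rewrite mulr_ge0. Qed.

Lemma delta1_le phi : Phi0 phi ->
  delta1 R G H <= norm1 (@graphon_of_graph R m G \- pullback (@graphon_of_graph R n H) phi).
Proof.
move=> p0; rewrite norm1_overlay// -overlay_costE; apply: ge_inf.
  by exists 0 => _ [a /overlay_cost_ge0 a0 <-].
by exists (overlay_of m n phi) => //; exact: overlay_of_overlay.
Qed.

Lemma delta1_lt (c : R) : delta1 R G H < c -> exists2 phi, Phi0 phi &
  norm1 (@graphon_of_graph R m G \- pullback (@graphon_of_graph R n H) phi) < c.
Proof.
move=> /inf_lt -[|_ [a ova <-] lt].
  (* The infimum is over a nonempty set, since the identity relabelling gives an overlay. *)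
  eexists; exists (overlay_of m n id); last by [].
  by apply: overlay_of_overlay => //; exact: Phi0_id.
have [phi p0 phia] := overlay_exchange m0 n0 ova.
by exists phi => //; rewrite norm1_overlay// phia -overlay_costE.
Qed.

End Delta1.

(** * Limits of kernels *)

Section L1Limit.
Variable R : realType.

Lemma limn_esup_bounds (u : nat -> R) (n : nat) (a b : R) :
  (forall m, (n <= m)%N -> a <= u m <= b) ->
  exists2 r : R, limn_esup (EFin \o u) = r%:E & a <= r <= b.
Proof.
move=> ab.
have le : (limn_esup (EFin \o u) <= b%:E)%E.
  rewrite limn_esup_lim; apply: lime_le; first exact: is_cvg_esups.
  exists n => // m /= nm; apply: ge_ereal_sup => _ [k /= mk <-].
  by rewrite lee_fin; have /andP[] := ab k (leq_trans nm mk).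
have ge : (a%:E <= limn_esup (EFin \o u))%E.
  rewrite limn_esup_lim; apply: lime_ge; first exact: is_cvg_esups.
  exists n => // m /= nm; apply: le_ereal_sup_tmp; exists (u m)%:E; first by exists m => /=.
  by rewrite lee_fin; have /andP[] := ab m nm.
move: le ge; case: limn_esup => [r| |]//.
by rewrite !lee_fin => rb ar; exists r => //; rewrite ar.
Qed.

Lemma norm1E (W : sqfun R) : bkernel W ->
  (\int[leb2]_(p in (@unitQ R)) `|W p|%:E)%E = (norm1 W)%:E.
Proof.
move=> kW; rewrite /norm1 /integral2 fineK//.
apply: integrable_fin_num => //; first exact: measurable_unitQ.
exact: (bkernel_integrable (bkernel_norm kW) (@measurable_unitQ R)).
Qed.

Local Opaque integral2 cut_norm cut_dist.

Definition halves (n : nat) : R := 2^-1 ^+ n.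

Lemma halves_gt0 n : 0 < halves n.
Proof. by rewrite exprn_gt0// invr_gt0. Qed.

Lemma sum_halves n m : \sum_(0 <= k < m) halves (n + k) <= 2 * halves n.
Proof.
suff -> : \sum_(0 <= k < m) halves (n + k) = 2 * halves n - 2 * halves (n + m).
  by rewrite gerBl mulr_ge0// ltW// halves_gt0.
elim: m => [|m IH]; first by rewrite big_nil addn0 subrr.
rewrite big_nat_recr//= IH addnS /halves exprS; set x := _ ^+ (n + m); lra.
Qed.

Lemma halves_lt (e : R) : 0 < e -> exists n, forall m, (n <= m)%N -> halves m < e.
Proof.
move=> e0; exists (Num.truncn e^-1).+1 => m nm.
rewrite /halves exprVn invf_plt ?posrE ?exprn_gt0//.
apply: lt_trans (truncnS_gt _) _.
apply: (@le_lt_trans _ _ m%:R); first by rewrite ler_nat.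
by rewrite -natrX ltr_nat ltn_expl.
Qed.

(** The limit is the pointwise limit superior, which is measurable, symmetric and bounded without
    discarding a null set of divergence. The series of increments dominates [|V n - L|] pointwise,
    and integrating it term by term gives a geometric tail. *)
Lemma norm1_limit (V : nat -> sqfun R) : (forall n, is_graphonI (V n)) ->
  (forall n, norm1 (V n \- V n.+1) <= halves n) ->
  exists2 L : sqfun R, is_graphonI L & forall n, norm1 (V n \- L) <= 2 * halves n.
Proof.
move=> VI Vcauchy.
pose L : sqfun R := fun p => fine (limn_esup (fun n => (V n p)%:E)).
have kV n : bkernel (V n) by apply: graphon_bkernel; have [] := VI n.
have V01 n p : unitQ p -> 0 <= V n p <= 1.
  by case: p => x y [/= Ix Iy]; have [_] := VI n; exact.
have Lbd p n a b : (forall m, (n <= m)%N -> a <= V m p <= b) -> a <= L p <= b.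
  by move=> /(@limn_esup_bounds (V^~ p))[r]; rewrite /L => ->.
have L01 p : unitQ p -> 0 <= L p <= 1 by move=> Qp; apply: (Lbd p 0%N) => m _; exact: V01.
have mL : measurable_fun unitQ (L : plane_L R -> R).
  have mE : measurable_fun unitQ (fun p : plane_L R => limn_esup (fun n => (V n p)%:E)).
    apply: (@measurable_fun_limn_esup _ _ _ _ (fun n (p : plane_L R) => (V n p)%:E)) => n.
    by apply/measurable_EFinP; have [_] := kV n.
  have mT : measurable [set: \bar R] by exact: measurableT.
  exact: (measurableT_comp (fine_measurable mT) mE).
have LI : is_graphonI L.
  split; [split => //|].
  - move=> x y Ix Iy; rewrite /L; congr (fine (limn_esup _)); apply/funext => n.
    by have [[-> //]] := VI n.
  - exists 1 => x y Ix Iy; have /andP[L0 L1] := L01 (x, y) (conj Ix Iy).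
    by rewrite ger0_norm.
  - by move=> x y Ix Iy; exact: (L01 (x, y) (conj Ix Iy)).
exists L => // n.
have kL : bkernel L by apply: graphon_bkernel; have [] := LI.
pose f k (p : plane_L R) := (`|(V (n + k) \- V (n + k).+1) p|)%:E.
have f0 k p : (0 <= f k p)%E by rewrite lee_fin.
have mf k : measurable_fun unitQ (f k).
  by apply/measurable_EFinP; have [] := bkernel_norm (bkernelB (kV (n + k)%N) (kV (n + k).+1)).
have partial p m : (`|V n p - V (n + m)%N p|%:E <= \sum_(0 <= k < m) f k p)%E.
  elim: m => [|m IH]; first by rewrite big_nil addn0 subrr normr0.
  rewrite big_nat_recr//=; apply: le_trans (leeD2r _ IH).
  rewrite /f -EFinD lee_fin addnS.
  by rewrite -{1}(subrK (V (n + m)%N p) (V n p)) -addrA ler_normD.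
have ptwise p : unitQ p -> (`|(V n \- L) p|%:E <= \sum_(0 <= k <oo) f k p)%E.
  move=> Qp; have : (0 <= \sum_(0 <= k <oo) f k p)%E by apply: nneseries_ge0.
  (* Where the series diverges the bound is trivial; elsewhere all later [V m p] stay within [s] of
     [V n p], hence so does [L p]. *)
  case ES : (\sum_(0 <= k <oo) f k p)%E => [s||]; [|by move=> _; rewrite leey|by []].
  move=> s0; rewrite lee_fin /= ler_norml.
  suff /Lbd/andP[h1 h2] : forall m, (n <= m)%N -> V n p - s <= V m p <= V n p + s.
    by lra.
  move=> m nm; have := partial p (m - n)%N; rewrite subnKC// => h.
  have : (`|V n p - V m p|%:E <= s%:E)%E.
    rewrite -ES; apply: le_trans h _.
    exact: (@nneseries_lim_ge _ _ xpredT).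
  by rewrite lee_fin ler_norml; lra.
rewrite -lee_fin -norm1E; last exact: bkernelB.
apply: (@le_trans _ _ (\int[leb2]_(p in unitQ) \sum_(0 <= k <oo) f k p)%E).
  apply: ge0_le_integral.
  - exact: measurable_unitQ.
  - by move=> p _; rewrite lee_fin.
  - by apply/measurable_EFinP; have [_] := bkernel_norm (bkernelB (kV n) kL).
  - exact: ge0_emeasurable_sum.
  - exact: ptwise.
rewrite integral_nneseries; [|exact: measurable_unitQ|exact: mf|by move=> k p _].
apply: lime_le; first by apply: is_cvg_nneseries => k _ _; exact: integral_ge0.
apply: nearW => m; apply: (@le_trans _ _ (\sum_(0 <= k < m) (halves (n + k))%:E)%E).
  apply: lee_sum => k _; have kk := bkernelB (kV (n + k)%N) (kV (n + k).+1).
  by rewrite [leLHS](norm1E kk) lee_fin.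
by rewrite sumEFin lee_fin sum_halves.
Qed.

End L1Limit.

Lemma midpoint01 (R : realFieldType) (a b : R) :
  0 <= a <= 1 -> 0 <= b <= 1 -> 0 <= 2^-1 * (a + b) <= 1.
Proof. lra. Qed.

Lemma midpoint_le (R : realFieldType) (a b u v c : R) :
  a <= 2^-1 * u -> b <= 2^-1 * v -> u <= c -> v <= c -> a + b <= c.
Proof. lra. Qed.

Lemma midpointB (R : realFieldType) (a b c : R) :
  2^-1 * (a + b) - c = 2^-1 * (a - c) + 2^-1 * (b - c).
Proof. lra. Qed.

(** Here [w] is the energy of the midpoint of two nearly minimal elements; as [en <= w], the
    parallelogram identity bounds their distance by the growth of the minimal energy. *)
Lemma energy_step (R : realFieldType) (en em hn hm vn vm w : R) :
  en <= w -> hm <= hn -> vn < en + hn -> vm < em + hm ->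
  2 * vn + 2 * vm - 4 * w <= 2 * (em - en) + 4 * hn.
Proof. lra. Qed.

Lemma energy_close (R : realFieldType) (x e h s e1 en em : R) :
  0 < e / 8 -> x <= 2 * (em - en) + 4 * h -> e1 <= en -> h < e / 8 -> em <= s ->
  s - e / 8 < e1 -> x <= e.
Proof. lra. Qed.

Lemma tail_step (R : realFieldType) (a b c h : R) :
  a <= 2 * c -> b <= h -> 2 * c = h -> a + b <= 2 * h.
Proof. lra. Qed.

(** * Completeness of the cut norm on graphons *)

Section CutComplete.
Variable R : realType.
Implicit Types (U V W : sqfun R).
Local Opaque integral2 cut_norm cut_dist.

Definition norm2 W : R := integral2 unitQ (W \* W).

Lemma norm2_ge0 W : bkernel W -> 0 <= norm2 W.
Proof.
by move=> kW; apply: integral2_ge0 => p _; rewrite /= -expr2 sqr_ge0.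
Qed.

(* AM-GM: [2 |w| <= w^2 / t + t]. *)
Lemma norm1_norm2 W (t : R) : bkernel W -> 0 < t -> norm2 W <= t ^+ 2 -> norm1 W <= t.
Proof.
move=> kW t0 W2; have mQ := @measurable_unitQ R; have sQ : @unitQ R `<=` unitQ by [].
have kWW := bkernelZ (t^-1 / 2) (bkernelM kW kW).
have kt := @bkernel_cst R (t / 2).
apply: (@le_trans _ _ (integral2 unitQ ((fun p => t^-1 / 2 * (W \* W) p) \+ (fun=> t / 2)))).
  apply: (integral2_le mQ sQ (bkernel_norm kW) (bkernelD kWW kt)) => p _ /=.
  have : 0 <= (`|W p| - t) ^+ 2 by exact: sqr_ge0.
  have -> : W p * W p = `|W p| ^+ 2 by rewrite real_normK ?num_real// expr2.
  move: `|W p| => w h; rewrite -(ler_pM2l t0) mulrDr !mulrA divff ?gt_eqF// mul1r.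
  by lra.
rewrite (integral2D mQ sQ kWW kt) (integral2Z _ mQ sQ (bkernelM kW kW)) integral2_cstQ.
have : t^-1 / 2 * norm2 W <= t^-1 / 2 * t ^+ 2.
  by rewrite ler_pM2l// divr_gt0// invr_gt0.
have -> : t^-1 / 2 * t ^+ 2 = (t^-1 * t) * (t / 2) by lra.
rewrite mulVf ?gt_eqF// mul1r /norm2; lra.
Qed.

Lemma parallelogram U V : bkernel U -> bkernel V ->
  norm2 (U \- V) = 2 * norm2 U + 2 * norm2 V - 4 * norm2 (fun p => 2^-1 * (U \+ V) p).
Proof.
move=> kU kV; have mQ := @measurable_unitQ R; have sQ : @unitQ R `<=` unitQ by [].
have k1 := bkernelZ 2 (bkernelM kU kU); have k2 := bkernelZ 2 (bkernelM kV kV).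
have kh := bkernelZ 2^-1 (bkernelD kU kV).
have k3 := bkernelZ 4 (bkernelM kh kh).
rewrite /norm2 -(integral2Z _ mQ sQ (bkernelM kU kU)) -(integral2Z _ mQ sQ (bkernelM kV kV)).
rewrite -(integral2Z _ mQ sQ (bkernelM kh kh)) -(integral2D mQ sQ k1 k2).
rewrite -(integral2B mQ sQ (bkernelD k1 k2) k3).
by apply: integral2_eq => p _ /=; lra.
Qed.

Lemma monotone_majorant (N : nat -> nat) : exists n : nat -> nat,
  [/\ forall k, (N k <= n k)%N, forall k, (k <= n k)%N & forall k, (n k <= n k.+1)%N].
Proof.
exists (fun k => \sum_(j < k.+1) (N j + 1))%N; split=> k.
- by rewrite big_ord_recr/= addnA addnC addnA addnC leq_addr.
- rewrite big_split/= sum_nat_const card_ord muln1.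
  by apply: leq_trans (leq_addl _ _); rewrite leqnSn.
- by rewrite [leqRHS]big_ord_recr/= leq_addr.
Qed.

Variable F : nat -> sqfun R.
Hypothesis FI : forall n, is_graphonI (F n).
Hypothesis Fcauchy : forall n, cut_norm (F n \- F n.+1) <= halves R n.

Let kF n : bkernel (F n).
Proof. by apply: graphon_bkernel; have [] := FI n. Qed.

(* Convex, nested neighbourhoods of the tails of [F]. Elements of nearly minimal
   L2 norm of such sets converge in L2, by the parallelogram identity. *)
Definition near_tail n V := is_graphonI V /\ cut_norm (V \- F n) <= 2 * halves R n.

Lemma near_tail_bkernel n V : near_tail n V -> bkernel V.
Proof. by move=> [[/graphon_bkernel]]. Qed.

Lemma near_tail_self n : near_tail n (F n).
Proof.
split; first exact: FI.
rewrite (@cut_norm_eq _ _ (fun p => 0 * F n p)).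
  apply: le_trans (cut_normZ _ (kF n)) _.
  by rewrite normr0 mul0r mulr_ge0// ltW// halves_gt0.
by move=> p _; rewrite /= subrr mul0r.
Qed.

(** The radius [2 * halves n] is chosen for this: the next radius is half of it, and adding the step
    [halves n] from [F n.+1] to [F n] gives the radius back. *)
Lemma near_tailS n V : near_tail n.+1 V -> near_tail n V.
Proof.
move=> nV; have kV := near_tail_bkernel nV; have [VI V2] := nV; split => //.
apply: le_trans (cut_norm_triangle kV (kF n.+1) (kF n)) _.
have cF := Fcauchy n; rewrite (cut_norm_distC (kF n) (kF n.+1)) in cF.
have h2 : 2 * halves R n.+1 = halves R n by rewrite /halves exprS mulrA divff ?mul1r.
exact: tail_step V2 cF h2.
Qed.

Lemma near_tail_le n m V : (n <= m)%N -> near_tail m V -> near_tail n V.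
Proof.
move=> nm; rewrite -(subnK nm); elim: (m - n)%N => // k IH.
by rewrite addSn => /near_tailS.
Qed.

Lemma near_tail_mid n U V : near_tail n U -> near_tail n V ->
  near_tail n (fun p => 2^-1 * (U \+ V) p).
Proof.
move=> nU nV; have kU := near_tail_bkernel nU; have kV := near_tail_bkernel nV.
have [[[symU [M UM] mU] U01] cU] := nU; have [[[symV [N VN] mV] V01] cV] := nV.
have [_ mh] := bkernelZ 2^-1 (bkernelD kU kV).
have h01 x y : unitI x -> unitI y -> 0 <= 2^-1 * (U \+ V) (x, y) <= 1.
  by move=> Ix Iy; apply: midpoint01; [exact: U01|exact: V01].
split; [split; [split => //|exact: h01]|].
- by move=> x y Ix Iy /=; rewrite symU// symV.
- by exists 1 => x y Ix Iy; have /andP[h0 h1] := h01 x y Ix Iy; rewrite ger0_norm.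
have k1 := bkernelZ 2^-1 (bkernelB kU (kF n)).
have k2 := bkernelZ 2^-1 (bkernelB kV (kF n)).
rewrite (@cut_norm_eq _ _ ((fun p => 2^-1 * (U \- F n) p) \+ (fun p => 2^-1 * (V \- F n) p))).
  apply: le_trans (cut_normD k1 k2) _.
  have := cut_normZ 2^-1 (bkernelB kU (kF n)); have := cut_normZ 2^-1 (bkernelB kV (kF n)).
  rewrite ger0_norm ?invr_ge0// => c1 c2; exact: midpoint_le c2 c1 cU cV.
by move=> p _; exact: midpointB.
Qed.

Let energies n := [set norm2 V | V in near_tail n].
Let energy n := inf (energies n).

Let energies_lb n : has_lbound (energies n).
Proof. by exists 0 => _ [V /near_tail_bkernel kV <-]; exact: norm2_ge0. Qed.

Let energies_n0 n : energies n !=set0.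
Proof. by exists (norm2 (F n)), (F n) => //; exact: near_tail_self. Qed.

Let energy_le n m : (n <= m)%N -> energy n <= energy m.
Proof.
move=> nm; apply: lb_le_inf; first exact: energies_n0.
move=> _ [V nV <-]; apply: ge_inf; first exact: energies_lb.
by exists V => //; exact: near_tail_le nV.
Qed.

Let energy_le1 n : energy n <= 1.
Proof.
apply: (@le_trans _ _ (norm2 (F n))).
  by apply: ge_inf; [exact: energies_lb|exists (F n) => //; exact: near_tail_self].
rewrite -(integral2_cstQ (1 : R)).
have mQ := @measurable_unitQ R; have sQ : @unitQ R `<=` unitQ by [].
apply: (integral2_le mQ sQ (bkernelM (kF n) (kF n)) (bkernel_cst 1)) => -[x y] [/= Ix Iy].
have [_ /(_ x y Ix Iy)/andP[F0 F1]] := FI n; nra.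
Qed.

Lemma cut_complete : exists2 L : sqfun R, is_graphonI L &
  forall n, cut_norm (L \- F n) <= 4 * halves R n.
Proof.
have exV n : exists V, near_tail n V /\ norm2 V < energy n + halves R n.
  have [|_ [V nV <-] lt] := inf_adherent (halves_gt0 R n) (_ : has_inf (energies n)).
    by split; [exact: energies_n0|exact: energies_lb].
  by exists V.
have [V HV] := choice exV.
have kV n : bkernel (V n) by have [nV _] := HV n; exact: near_tail_bkernel nV.
have dist n m : (n <= m)%N ->
    norm2 (V n \- V m) <= 2 * (energy m - energy n) + 4 * halves R n.
  move=> nm; have [nVn ltn] := HV n; have [nVm ltm] := HV m.
  (* The midpoint of [V n] and [V m] lies in the [n]-th neighbourhood, so its energy is not below
     the infimum there. *)
  have : energy n <= norm2 (fun p => 2^-1 * (V n \+ V m) p).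
    apply: ge_inf; first exact: energies_lb.
    exists (fun p => 2^-1 * (V n \+ V m) p); last by [].
    exact: near_tail_mid nVn (near_tail_le nm nVm).
  have : halves R m <= halves R n.
    rewrite /halves -(subnK nm) exprD ler_piMl ?exprn_ge0 ?invr_ge0//.
    by rewrite exprn_ile1 ?invr_ge0// invf_le1 ?ler1n.
  by rewrite (parallelogram (kV n) (kV m)) => h1 h2; exact: energy_step h2 h1 ltn ltm.
pose S := sup (range energy).
have hS : has_sup (range energy).
  by split; [exists (energy 0), 0%N|exists 1 => _ [n _ <-]; exact: energy_le1].
have exN k : exists N, forall n m, (N <= n)%N -> (n <= m)%N ->
    norm2 (V n \- V m) <= halves R k ^+ 2.
  (* The energies increase to [S]: beyond [N1] the term [2 * (energy m - energy n)] is at most 2/8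
     of the target, and beyond [N2] the term [4 * halves n] is at most 4/8 of it. *)
  have e0 : 0 < halves R k ^+ 2 / 8 by rewrite divr_gt0// exprn_gt0// halves_gt0.
  have [_ [N1 _ <-] lt1] := sup_adherent e0 hS.
  have [N2 lt2] := halves_lt e0.
  exists (maxn N1 N2) => n m; rewrite geq_max => /andP[n1 n2] nm.
  have eS : energy m <= S by apply: ub_le_sup; [case: hS|exists m].
  exact: energy_close e0 (dist _ _ nm) (energy_le n1) (lt2 n n2) eS lt1.
have [N HN] := choice exN.
have [n [nN nk nS]] := monotone_majorant N.
have [k|k|L LI HL] := @norm1_limit R (fun k => V (n k)).
- by have [[]] := HV (n k).
- apply: norm1_norm2; [exact: bkernelB|exact: halves_gt0|exact: HN].
exists L => // j.
have kL : bkernel L by apply: graphon_bkernel; have [] := LI.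
(* The constant 4 is 2 from the L1 limit plus 2 from the [j]-th neighbourhood, which contains
   [V (n j)] because [j <= n j]. *)
apply: le_trans (cut_norm_triangle kL (kV (n j)) (kF j)) _.
have [_ c1] := near_tail_le (nk j) (HV (n j)).1.
have c2 := cut_norm_le_norm1 (bkernelB kL (kV (n j))).
have c3 := HL j; rewrite norm1C in c3.
apply: le_trans (lerD (le_trans c2 c3) c1) _.
by rewrite -mulrDl -natrD.
Qed.

End CutComplete.

(** * Sequential compactness of graph kernels *)

Section Align.
Variable R : realType.
Local Opaque integral2 cut_norm cut_dist.

Lemma graphonI_pullback (W : sqfun R) phi : Phi0 phi -> is_graphonI W ->
  is_graphonI (pullback W phi).
Proof.
move=> p0 [gW W01]; have pI := Phi0_homo p0.
have [[M WM] mW] := bkernel_pullback0 p0 (graphon_bkernel gW).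
split; [split => //|].
- move=> x y Ix Iy; have [sW _ _] := gW.
  exact: (sW (phi x) (phi y) (pI _ Ix) (pI _ Iy)).
- by exists M => x y Ix Iy; apply: WM.
- by move=> x y Ix Iy; exact: (W01 (phi x) (phi y) (pI _ Ix) (pI _ Iy)).
Qed.

(** Each [phi j] brings kernel [j.+1] close to kernel [j]; the composites carry all kernels to the
    labelling of kernel 0 and leave consecutive distances unchanged. *)
Fixpoint align (phi : nat -> R -> R) (j : nat) : R -> R :=
  if j is i.+1 then phi i \o align phi i else id.

Lemma align_Phi0 phi : (forall j, Phi0 (phi j)) -> forall j, Phi0 (align phi j).
Proof. by move=> p0; elim=> [|j IH]; [exact: Phi0_id|exact: Phi0_comp]. Qed.

Lemma alignE (W : nat -> sqfun R) phi j :
  pullback (W j) (align phi j) \- pullback (W j.+1) (align phi j.+1) =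
  pullback (W j \- pullback (W j.+1) (phi j)) (align phi j).
Proof. by []. Qed.

Lemma same_color_close (e : R) : 0 < e ->
  exists (T : finType) (col : forall n, sgraph n -> T),
  forall m n (G : sgraph m) (H : sgraph n), (0 < m)%N -> (0 < n)%N ->
    col m G = col n H ->
    cut_dist (@graphon_of_graph R m G) (@graphon_of_graph R n H) <= e.
Proof.
move=> e0; have [T [col colP]] := coloring e0.
exists T, col => m n G H m0 n0 cGH.
have [a ova Ha] := colP m n G H m0 n0 cGH.
have [phi p0 phia] := overlay_exchange m0 n0 ova.
apply: le_trans (cut_dist_le _ _ p0) _; [exact: graphon_of_graph_bkernel..|].
by apply: cut_norm_overlay => //; rewrite phia.
Qed.

Definition unbounded (I : set nat) := forall N, exists2 k, (N <= k)%N & I k.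

Lemma unbounded_color (T : finType) (c : nat -> T) (I : set nat) :
  unbounded I -> exists t, unbounded (I `&` c @^-1` [set t]).
Proof.
move=> uI; apply: contrapT => /forallNP nt.
have exN t : exists N, forall k, (N <= k)%N -> I k -> c k <> t.
  have /existsNP[N NN] := nt t; exists N => k Nk Ik ckt.
  by apply: NN; exists k.
have [N HN] := choice exN.
have [k Nk Ik] := uI (\max_t N t).
by apply: (HN (c k) k) => //; exact: leq_trans (leq_bigmax (c k)) Nk.
Qed.

(** Refining by one colouring at a time gives nested unbounded sets [I j] with [c j] constant on
    [I j.+1], and a diagonal sequence is picked from them. The growth condition makes [n \o s]
    increasing when [k < n k]. *)
Lemma diagonal_colors (T : nat -> finType) (c : forall j, nat -> T j) (n : nat -> nat) :
  exists s : nat -> nat, [/\ {homo s : i j / (i < j)%N},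
    forall j, (n (s j) < s j.+1)%N & forall j, c j (s j) = c j (s j.+1)].
Proof.
have step j (I : {I : set nat | unbounded I}) :
    exists J : {J : set nat | unbounded J}, sval J `<=` sval I /\
      exists t, sval J `<=` c j @^-1` [set t].
  have [t ut] := unbounded_color (c j) (svalP I).
  by exists (exist _ _ ut); split; [move=> k []|exists t => k []].
have [next nextP] : exists next : forall j, {I : set nat | unbounded I} -> {J : set nat | unbounded J},
    forall j I, sval (next j I) `<=` sval I /\
      exists t, sval (next j I) `<=` c j @^-1` [set t].
  have [nx Hnx] := choice (fun jI : nat * {I : set nat | unbounded I} => step jI.1 jI.2).
  by exists (fun j I => nx (j, I)) => j I; exact: (Hnx (j, I)).
have uT : unbounded setT by move=> N; exists N.
pose I := fix I j := if j is i.+1 then next i (I i) else exist unbounded setT uT.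
have IS j : sval (I j.+1) `<=` sval (I j) by have [] := nextP j (I j).
have pickP j N : exists k, (N <= k)%N /\ sval (I j) k.
  by have [k Nk Ik] := svalP (I j) N; exists k.
have [pk Hpk] := choice (fun jN : nat * nat => pickP jN.1 jN.2).
(* [s j] is picked in [I j.+1], whence the indices 1 and [i.+2]; the lower bound
   [(s i + n (s i)).+1] yields both growth conditions. *)
pose s := fix s j := if j is i.+1 then pk (i.+2, (s i + n (s i)).+1) else pk (1%N, 0%N).
have sI j : sval (I j.+1) (s j).
  by case: j => [|j]; [have [] := Hpk (1%N, 0%N)|have [] := Hpk (j.+2, (s j + n (s j)).+1)].
have sS j : (s j + n (s j) < s j.+1)%N by have [] := Hpk (j.+2, (s j + n (s j)).+1).
exists s; split.
- apply: (homo_ltn (@ltn_trans)) => j; exact: leq_ltn_trans (leq_addr _ _) (sS j).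
- by move=> j; exact: leq_ltn_trans (leq_addl _ _) (sS j).
- move=> j; have [_ [t Jt]] := nextP j (I j).
  by rewrite (Jt _ (sI j)) (Jt _ (IS _ _ (sI j.+1))).
Qed.

Lemma graphs_precompact (n : nat -> nat) (G : forall k, sgraph (n k)) :
  (forall k, (k < n k)%N) ->
  exists (s : nat -> nat) (W : sqfun R), [/\ {homo s : i j / (i < j)%N},
    {homo n \o s : i j / (i < j)%N}, is_graphonI W &
    forall j, cut_dist (@graphon_of_graph R (n (s j)) (G (s j))) W <= 4 * halves R j].
Proof.
move=> nk; have n0 k : (0 < n k)%N by exact: leq_ltn_trans (nk k).
(* Half of [halves j] leaves room for the strict inequality that selects a relabelling. *)
have e0 j : 0 < halves R j / 2 by rewrite divr_gt0// halves_gt0.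
pose T j := projT1 (cid (same_color_close (e0 j))).
pose colX j := cid (projT2 (cid (same_color_close (e0 j)))).
pose c j k : T j := projT1 (colX j) (n k) (G k).
have cP j k l : c j k = c j l ->
    cut_dist (@graphon_of_graph R (n k) (G k)) (@graphon_of_graph R (n l) (G l)) < halves R j.
  move=> /(projT2 (colX j) _ _ (G k) (G l) (n0 k) (n0 l)) /le_lt_trans; apply.
  by rewrite ltr_pdivrMr// ltr_pMr ?ltr1n// halves_gt0.
have [s [sinc ns sc]] := diagonal_colors c n.
pose V j := @graphon_of_graph R (n (s j)) (G (s j)).
have VI j : is_graphonI (V j) by exact: graphon_of_graphI.
have kV j : bkernel (V j) by exact: graphon_of_graph_bkernel.
have exphi j : exists phi, Phi0 phi /\ cut_norm (V j \- pullback (V j.+1) phi) < halves R j.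
  by have [phi p0 lt] := cut_dist_lt (kV j) (kV j.+1) (cP j _ _ (sc j)); exists phi.
have [phi Hphi] := choice exphi.
have ap : forall j, Phi0 (align phi j) by apply: align_Phi0 => j; have [] := Hphi j.
have [j|j|W WI HW] := @cut_complete R (fun j => pullback (V j) (align phi j)).
- exact: graphonI_pullback.
- rewrite alignE cut_norm_pullback//; first by have [_ /ltW] := Hphi j.
  by apply: bkernelB => //; apply: bkernel_pullback0 => //; have [] := Hphi j.
exists s, W; split => //.
  apply: (homo_ltn (@ltn_trans)) => j /=; exact: ltn_trans (ns j) (nk _).
move=> j; have kW : bkernel W by apply: graphon_bkernel; have [] := WI.
rewrite [leLHS](cut_distC (kV j) kW).
exact: (le_trans (cut_dist_le kW (kV j) (ap j)) (HW j)).
Qed.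

End Align.

(** * From cut norm to L1 for 0/1-valued limits *)

Section Tends0.
Variable R : realType.
Implicit Types u v : nat -> R.

Definition tends0 u := forall e : R, 0 < e -> exists N : nat,
  forall k, (N <= k)%N -> `|u k| < e.

Lemma tends0D u v : tends0 u -> tends0 v -> tends0 (fun k => u k + v k).
Proof.
move=> u0 v0 e e0; have e20 : 0 < e / 2 by rewrite divr_gt0.
have [M HM] := u0 _ e20; have [N HN] := v0 _ e20.
exists (maxn M N) => k; rewrite geq_max => /andP[Mk Nk].
apply: le_lt_trans (ler_normD _ _) _.
by rewrite [e]splitr ltrD ?HM ?HN.
Qed.

Lemma tends0N u : tends0 u -> tends0 (fun k => - u k).
Proof. by move=> u0 e /u0[N HN]; exists N => k /HN; rewrite normrN. Qed.

Lemma tends0_le u v : (forall k, `|u k| <= v k) -> tends0 v -> tends0 u.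
Proof.
move=> uv v0 e /v0[N HN]; exists N => k /HN; apply: le_lt_trans.
exact: le_trans (uv k) (ler_norm _).
Qed.

Lemma tends0_eq u v : u =1 v -> tends0 v -> tends0 u.
Proof. by move=> uv v0 e /v0[N HN]; exists N => k; rewrite uv; exact: HN. Qed.

Lemma tends0_cst0 : tends0 (fun=> 0).
Proof. by move=> e e0; exists 0%N => k _; rewrite normr0. Qed.

Lemma tends0_halves : tends0 (halves R).
Proof.
move=> e /halves_lt[N HN]; exists N => k /HN; rewrite ger0_norm//.
exact/ltW/halves_gt0.
Qed.

Lemma tends0_approx u : (forall e : R, 0 < e -> exists2 v, tends0 v &
  forall k, `|u k - v k| <= e) -> tends0 u.
Proof.
move=> H e e0; have e20 : 0 < e / 2 by rewrite divr_gt0.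
have [v v0 uv] := H _ e20; have [N HN] := v0 _ e20.
exists N => k /HN vk; rewrite -(subrK (v k) (u k)).
apply: le_lt_trans (ler_normD _ _) _.
by rewrite [e]splitr ler_ltD.
Qed.

End Tends0.

Section WeakConvergence.
Variable R : realType.
Local Notation borel2 := (measurableTypeR R * measurableTypeR R)%type.
Local Notation leb := (@lebesgue_measure R).

Lemma integral2_le_measure (D : sqfun R) (A : set (plane_L R)) : bkernel D ->
  (forall p, unitQ p -> `|D p| <= 1) -> measurable A -> A `<=` unitQ ->
  `|integral2 A D| <= fine (leb2 A).
Proof.
move=> kD D1 mA AQ; apply: le_trans (integral2_norm mA AQ kD) _.
rewrite -[leRHS]mul1r -(integral2_cst 1 mA AQ).
by apply: (integral2_le mA AQ (bkernel_norm kD) (bkernel_cst 1)) => p /AQ /D1.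
Qed.

Local Opaque integral2 cut_norm cut_dist.

Variable D : nat -> sqfun R.
Hypothesis kD : forall k, bkernel (D k).
Hypothesis D1 : forall k p, unitQ p -> `|D k p| <= 1.
Hypothesis cutD : tends0 (fun k => cut_norm (D k)).

Let null A := tends0 (fun k => integral2 (unitQ `&` A) (D k)).
Let mQ := @measurable_unitQ R.

Let subQ (A : set (plane_L R)) : unitQ `&` A `<=` unitQ.
Proof. exact: subIsetl. Qed.

Let mQA (A : set borel2) : measurable A -> measurable (unitQ `&` A : set (plane_L R)).
Proof. by move=> mA; apply: measurableI => //; exact: borel_plane. Qed.

Let null_rect (A B : set (measurableTypeR R)) : measurable A -> measurable B ->
  null (A `*` B).
Proof.
move=> mA mB; apply: tends0_le cutD => k.
rewrite (_ : unitQ `&` _ = (unitI `&` A) `*` (unitI `&` B)); last first.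
  by apply/seteqP; split => -[x y] /=; [move=> [[/= ? ?] [? ?]]|move=> [[/= ? ?] [? ?]]].
apply: le_cut_norm => //; split; [| |exact: subIsetl|exact: subIsetl];
  by apply: measurableI; [exact: measurable_unitI|exact: borel_line].
Qed.

Let nullC (A : set borel2) : measurable A -> null A -> null (~` A).
Proof.
move=> mA nA; have nT : null (setT `*` setT) by exact: null_rect.
apply: (@tends0_eq _ _ (fun k => integral2 (unitQ `&` (setT `*` setT)) (D k) +
    - integral2 (unitQ `&` A) (D k))); last by apply: tends0D => //; exact: tends0N.
move=> k; rewrite setXTT setIT -[X in integral2 X _ + _](setUIDK unitQ A).
have mC : measurable (unitQ `\` A : set (plane_L R)).
  by apply: measurableD => //; exact: borel_plane.
have dj : (unitQ `&` A) `&` (unitQ `\` A) = set0.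
  by apply/seteqP; split => // p [[_ Ap] [_ nAp]].
rewrite (integral2U (mQA mA) mC (@subQ _) (@subDsetl _ _ _) dj (kD k)).
by rewrite addrAC subrr add0r setDE.
Qed.

Let nullU2 (A B : set borel2) : measurable A -> measurable B -> A `&` B = set0 ->
  null A -> null B -> null (A `|` B).
Proof.
move=> mA mB AB nA nB.
apply: (tends0_eq _ (tends0D nA nB)) => k.
have dj : (unitQ `&` A) `&` (unitQ `&` B) = set0 by rewrite setIACA AB setI0.
by rewrite setIUr (integral2U (mQA mA) (mQA mB) (@subQ _) (@subQ _) dj (kD k)).
Qed.

(** Convergence on the finite unions [B M] need not be uniform in [M], but [|D k| <= 1] bounds the
    integral over the rest of the union by its measure, uniformly in [k]. *)
Let null_bigcup (F : (set borel2)^nat) : (forall n, measurable (F n)) ->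
  trivIset setT F -> (forall n, null (F n)) -> null (\bigcup_k F k).
Proof.
move=> mF tF nF.
pose B M : set borel2 := \bigcup_(i in `I_M) F i.
have mB M : measurable (B M) by exact: bigcup_measurable.
have BS M : B M.+1 = B M `|` F M.
  apply/seteqP; split => [p [i /= + Fp]|p [[i /= iM Fp]|Fp]].
  - by rewrite ltnS leq_eqVlt => /predU1P[<-|iM]; [right|left; exists i].
  - by exists i => //=; exact: ltnW.
  - by exists M => /=.
have nB M : null (B M).
  elim: M => [|M IH].
    apply: (tends0_eq _ (@tends0_cst0 R)) => k.
    rewrite (_ : _ `&` _ = set0); first exact: Rintegral_set0.
    by apply/seteqP; split => // p [_ [i]].
  rewrite BS; apply: nullU2 => //; apply/seteqP; split => // p [[i /= iM Fip] FMp].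
  have [] := @tF i M I I (ex_intro _ p (conj Fip FMp)) => e.
  by rewrite e ltnn in iM.
have mE : measurable (\bigcup_k F k) by exact: bigcupT_measurable.
pose E : set (plane_L R) := unitQ `&` \bigcup_k F k.
have EB : E = \bigcup_M (unitQ `&` B M).
  rewrite /E -setI_bigcupr; congr (_ `&` _); apply/seteqP; split => p.
    by move=> [i _ Fp]; exists i.+1 => //; exists i => /=.
  by move=> [M _ [i _ Fp]]; exists i.
have cvB : (leb2 \o (fun M => unitQ `&` B M : set (plane_L R))) x @[x --> \oo] --> leb2 E.
  rewrite EB; apply: nondecreasing_cvg_mu.
  - by move=> M; exact: mQA.
  - by rewrite -EB; exact: mQA.
  - move=> M M' MM'; apply/subsetPset => p [Qp [i /= iM Fp]]; split => //.
    by exists i => //=; exact: leq_trans MM'.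
have Efin : leb2 E \is a fin_num.
  by rewrite ge0_fin_numE ?leb2_lty ?outer_measure_ge0//; exact: subIsetl.
apply: tends0_approx => e e0.
have [M BM] : exists M, `|fine (leb2 E) - fine (leb2 (unitQ `&` B M : set (plane_L R)))| < e.
  have /fine_cvg/cvgrPdist_lt/(_ _ e0)[M _ HM] :
      (leb2 \o (fun M => unitQ `&` B M : set (plane_L R))) x @[x --> \oo] --> (fine (leb2 E))%:E.
    by rewrite fineK.
  by exists M; apply: HM => /=.
exists (fun k => integral2 (unitQ `&` B M) (D k)); [exact: nB|move=> k].
have BE : unitQ `&` B M `<=` E.
  by move=> p [Qp [i _ Fp]]; split => //; exists i.
have mEB : measurable (E `\` (unitQ `&` B M)).
  by apply: measurableD; exact: mQA.
have EBQ : E `\` (unitQ `&` B M) `<=` unitQ by move=> p [[]].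
have dj : (unitQ `&` B M) `&` (E `\` (unitQ `&` B M)) = set0 by rewrite setDE setICA setICr setI0.
have -> : integral2 E (D k) = integral2 (unitQ `&` B M) (D k) +
    integral2 (E `\` (unitQ `&` B M)) (D k).
  rewrite -[X in integral2 X _ = _](setDUK BE).
  exact: (integral2U (mQA (mB M)) mEB (@subQ _) EBQ dj (kD k)).
rewrite [X in `|X|]addrC addKr; apply: le_trans (integral2_le_measure (kD k) (@D1 k) mEB EBQ) _.
rewrite measureD; [|exact: mQA|exact: mQA|by apply: leb2_lty; exact: subIsetl].
rewrite (setIidr BE) fineB//; last first.
  by rewrite ge0_fin_numE ?leb2_lty ?outer_measure_ge0//; exact: subIsetl.
exact: le_trans (ler_norm _) (ltW BM).
Qed.

Let null_borel (A : set borel2) : measurable A -> null A.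
Proof.
pose G := [set A `*` B | A in @measurable _ (measurableTypeR R) & B in @measurable _ (measurableTypeR R)].
have GE : @measurable _ borel2 = <<s G >> by exact: measurable_prod_measurableType.
rewrite GE; apply: (dynkin_induction GE).
- move=> _ _ [A1 mA1 [B1 mB1 <-]] [A2 mA2 [B2 mB2 <-]].
  exists (A1 `&` A2); first exact: measurableI.
  by exists (B1 `&` B2); [exact: measurableI|rewrite setXI].
- by rewrite -setXTT; exact: null_rect.
- by move=> _ [A1 mA1 [B1 mB1 <-]]; exact: null_rect.
- exact: nullC.
- exact: null_bigcup.
Qed.

(** Inside the unit square a Lebesgue set differs from a Borel set by a null set, over which the
    integrals vanish. *)
Lemma weak_cvg0 (A : set (plane_L R)) : measurable A -> A `<=` unitQ ->
  tends0 (fun k => integral2 A (D k)).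
Proof.
move=> mA AQ; have [B [N [mB mN N0 AB BN]]] := plane_borelU mA (leb2_lty AQ).
have [mZ Z0] : measurable ((unitQ `&` B) `\` A) /\ leb2 ((unitQ `&` B) `\` A) = 0%E.
  by apply: (leb2_null mN N0) => p [[_ Bp] nAp]; apply: BN.
have AQB : A `<=` unitQ `&` B by move=> p Ap; split; [exact: AQ|exact: AB].
apply: (tends0_eq _ (null_borel mB)) => k.
have ZQ : (unitQ `&` B) `\` A `<=` unitQ by move=> p [[]].
have dj : A `&` ((unitQ `&` B) `\` A) = set0 by rewrite setDE setICA setICr setI0.
rewrite -(setDUK AQB) (integral2U mA mZ AQ ZQ dj (kD k)).
have := integral2_le_measure (kD k) (@D1 k) mZ ZQ.
by rewrite Z0 normr_le0 => /eqP ->; rewrite addr0.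
Qed.

End WeakConvergence.

Section ZeroOne.
Variable R : realType.
Local Opaque integral2 cut_norm cut_dist.

(** The proof is by contradiction along a sequence, so [d] depends on [W] and is not explicit.
    [U - W] is nonnegative where [W = 0] and nonpositive where [W = 1]; the L1 norm is therefore a
    difference of integrals over two sets independent of [U], to which [weak_cvg0] applies. *)
Lemma norm1_of_cut_norm (W : sqfun R) : is_graphonI W ->
  (forall p, unitQ p -> W p = 0 \/ W p = 1) ->
  forall e : R, 0 < e -> exists2 d : R, 0 < d & forall U : sqfun R, is_graphonI U ->
    cut_norm (U \- W) < d -> norm1 (U \- W) < e.
Proof.
move=> WI W01 e e0; apply: contrapT => nd.
have exU k : exists U, is_graphonI U /\ cut_norm (U \- W) < halves R k /\ e <= norm1 (U \- W).
  apply: contrapT => nU; apply: nd; exists (halves R k); first exact: halves_gt0.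
  by move=> U UI Uk; rewrite ltNge; apply/negP => eU; apply: nU; exists U.
have [U HU] := choice exU.
have kW : bkernel W by apply: graphon_bkernel; have [] := WI.
have kU k : bkernel (U k) by apply: graphon_bkernel; have [[]] := HU k.
pose D k : sqfun R := U k \- W.
have kD k : bkernel (D k) by exact: bkernelB.
have U01 k p : unitQ p -> 0 <= U k p <= 1.
  by case: p => x y [/= Ix Iy]; have [[_ h] _] := HU k; exact: h.
have D1 k p : unitQ p -> `|D k p| <= 1.
  move=> Qp; have := U01 k p Qp; rewrite /D /= ler_norml.
  by case: (W01 p Qp) => ->; move: (U k p) => u; lra.
have cutD : tends0 (fun k => cut_norm (D k)).
  apply: tends0_le (@tends0_halves R) => k; rewrite ger0_norm; last exact: cut_norm_ge0.
  by have [_ [/ltW]] := HU k.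
have mQ := @measurable_unitQ R.
pose Z : set (plane_L R) := unitQ `&` W @^-1` [set 0].
have mZ : measurable Z by have [_ mW] := kW; apply: mW => //; exact: measurable_set1.
have mZ' : measurable (unitQ `\` Z) by exact: measurableD.
have ZQ : Z `<=` unitQ by exact: subIsetl.
have Z'Q : unitQ `\` Z `<=` unitQ by exact: subDsetl.
have := tends0D (weak_cvg0 kD D1 cutD mZ ZQ) (tends0N (weak_cvg0 kD D1 cutD mZ' Z'Q)).
move=> /(_ e e0)[N /(_ N (leqnn N))]; apply/negP; rewrite -leNgt.
have [_ [_]] := HU N; move=> /le_trans; apply; apply: le_trans (ler_norm _).
have dj : Z `&` (unitQ `\` Z) = set0 by rewrite setDE setICA setICr setI0.
have -> : norm1 (U N \- W) = integral2 Z (fun p => `|D N p|) +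
    integral2 (unitQ `\` Z) (fun p => `|D N p|).
  rewrite /norm1 -[X in integral2 X _ = _](setDUK ZQ).
  exact: (integral2U mZ mZ' ZQ Z'Q dj (bkernel_norm (kD N))).
rewrite lerD//.
  rewrite (@integral2_eq _ Z _ (D N))// => p [Qp /= Wp].
  by rewrite /D /= Wp subr0 ger0_norm//; have /andP[] := U01 N p Qp.
rewrite -mulN1r -(integral2Z (-1) mZ' Z'Q (kD N)).
rewrite (@integral2_eq _ (unitQ `\` Z) _ (fun p => -1 * D N p))// => p [Qp nZ].
have Wp : W p = 1 by case: (W01 p Qp) => // W0; case: nZ.
rewrite /D /= Wp mulN1r ler0_norm// subr_le0.
by have /andP[] := U01 N p Qp.
Qed.

End ZeroOne.

(** * Stability *)

(** If rounding at 1/2 sends [l] to the wrong value, then [l] is at distance at least 1/2 from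
    [x]. *)
Lemma round_dist (R : realFieldType) (x l : R) : x = 0 \/ x = 1 -> 0 <= l <= 1 ->
  `|x - (2^-1 < l)%R%:R| <= 2 * `|x - l|.
Proof.
case=> -> /andP[l0 l1]; case: ltP => h /=.
- by rewrite sub0r normrN normr1 sub0r normrN ger0_norm//; lra.
- by rewrite subrr normr0 mulr_ge0.
- by rewrite subrr normr0 mulr_ge0.
- by rewrite subr0 normr1 ger0_norm; lra.
Qed.

Lemma splitr3 (R : realFieldType) (e : R) : e / 3 + (e / 3 + e / 3) = e.
Proof. lra. Qed.

Lemma quarter_lt (R : realFieldType) (x e : R) : x < e / 4 -> 4 * x < e.
Proof. by rewrite ltr_pdivlMr// mulrC. Qed.

Section Stability.
Variable R : realType.
Local Opaque integral2 cut_norm cut_dist graphit_dist delta1 ex_max.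

Local Notation WG G := (@graphon_of_graph R _ G).

Lemma tends0P (u : nat -> R) : tends0 u <-> (u i @[i --> \oo] --> (0 : R)).
Proof.
split=> [u0|/cvgrPdist_lt u0 e e0].
  apply/cvgrPdist_lt => e e0; have [N HN] := u0 e e0.
  by exists N => // k /= Nk; rewrite sub0r normrN HN.
have [N _ HN] := u0 e e0; exists N => k Nk.
by have /= := HN k Nk; rewrite sub0r normrN.
Qed.

(* An L1 limit of 0/1-valued kernels is rounded to a 0/1-valued one. *)
Lemma round01 (L : sqfun R) : is_graphonI L -> exists W : sqfun R,
  [/\ is_graphonI W, forall p, W p = 0 \/ W p = 1 &
      forall V : sqfun R, bkernel V -> (forall p, unitQ p -> V p = 0 \/ V p = 1) ->
        norm1 (V \- W) <= 2 * norm1 (V \- L)].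
Proof.
move=> LI; have kL : bkernel L by apply: graphon_bkernel; have [] := LI.
have mQ := @measurable_unitQ R; have sQ : @unitQ R `<=` unitQ by [].
pose A : set (plane_L R) := unitQ `&` L @^-1` `]2^-1, +oo[%classic.
have mA : measurable A.
  by have [_ mL] := kL; apply: mL => //; exact: measurable_itv.
pose W : sqfun R := \1_A.
have W01 p : W p = 0 \/ W p = 1.
  by rewrite /W indicE; case: (p \in A); [right|left].
have WE p : unitQ p -> W p = (2^-1 < L p)%R%:R.
  move=> Qp; rewrite /W indicE; congr (nat_of_bool _)%:R.
  by apply/idP/idP => [/set_mem[_ /=]|h]; rewrite ?in_itv/= ?andbT//; apply/mem_set;
    split => //=; rewrite in_itv/= h.
have mW : measurable_fun unitQ (W : plane_L R -> R) by exact: measurable_indic.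
have WI : is_graphonI W.
  split; [split => //|].
  - move=> x y Ix Iy; rewrite !WE//; congr (nat_of_bool (_ < _)%R)%:R.
    by have [[sL _ _] _] := LI; exact: sL.
  - by exists 1 => x y _ _; case: (W01 (x, y)) => ->; rewrite ?normr0 ?normr1.
  - by move=> x y _ _; case: (W01 (x, y)) => ->; rewrite ?lexx ?ler01.
exists W; split => // V kV V01.
have kW : bkernel W by apply: graphon_bkernel; have [] := WI.
rewrite /norm1 -(integral2Z 2 mQ sQ (bkernel_norm (bkernelB kV kL))).
apply: (integral2_le mQ sQ (bkernel_norm (bkernelB kV kW))).
  exact: bkernelZ (bkernel_norm (bkernelB kV kL)).
move=> -[x y] Qp; rewrite /= WE//; apply: round_dist; first exact: V01.
by have [_ h] := LI; have [/= Ix Iy] := Qp; exact: h.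
Qed.

Variables (P : graph_class) (f : forall n, sgraph n -> R).
Arguments P : clear implicits.
Arguments f : clear implicits.

Lemma le_ex_max n (G : sgraph n) : P n G -> f _ G <= ex_max f P n.
Proof.
move=> PG; have [|H _ [<- maxH]] := @ex_maxP R f P n; first by exists G.
exact: maxH.
Qed.

Lemma homo_ltn_ge (n : nat -> nat) : {homo n : i j / (i < j)%N} -> forall i, (i <= n i)%N.
Proof. by move=> hn; elim=> // i IH; exact: leq_ltn_trans IH (hn i i.+1 (ltnSn i)). Qed.

(** * A 0/1-valued limit implies stability *)

Section LimitImpliesStable.
Variable W : sqfun R.
Hypothesis WI : is_graphonI W.
Hypothesis LW : LIM f P = [set graphit W].

(** Otherwise there are graphs of growing order whose defect is at most [halves k] and whose
    distance from [W] is at least [d]. The limit of a convergent subsequence belongs to [LIM f P],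
    so it is at distance 0 from [W], a contradiction. *)
Lemma extremal_close (d : R) : 0 < d -> exists2 e : R, 0 < e & exists n0 : nat,
  forall n (G : sgraph n), (n0 < n)%N -> P n G -> ex_max f P n - e <= f _ G ->
  cut_dist (WG G) W < d.
Proof.
move=> d0; apply: contrapT => nd.
have exG k : exists nG : {n : nat & sgraph n}, [/\ (k < tag nG)%N, P _ (tagged nG),
    ex_max f P (tag nG) - halves R k <= f _ (tagged nG) & d <= cut_dist (WG (tagged nG)) W].
  apply: contrapT => nG; apply: nd; exists (halves R k); first exact: halves_gt0.
  exists k => n G kn PG fG; rewrite ltNge; apply/negP => dG; apply: nG.
  by exists (Tagged _ G).
have [nG HG] := choice exG.
pose n k := tag (nG k); pose G k : sgraph (n k) := tagged (nG k).
have nk k : (k < n k)%N by have [] := HG k.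
have [s [W' [sinc nsinc WI' W's]]] := graphs_precompact R G nk.
have kW : bkernel W by apply: graphon_bkernel; have [] := WI.
have kW' : bkernel W' by apply: graphon_bkernel; have [] := WI'.
have n0 j : (0 < n j)%N by exact: leq_ltn_trans (nk j).
have : LIM f P (graphit W').
  split; first by exists W'.
  exists (n \o s), (fun i => G (s i)); split => //.
  - by move=> i; have [] := HG (s i).
  - apply/tends0P; apply: tends0_le (@tends0_halves R) => i.
    have [_ PG fG _] := HG (s i); have fle := le_ex_max PG.
    rewrite ler0_norm; last by rewrite subr_le0.
    have h : halves R (s i) <= halves R i.
      have si := homo_ltn_ge sinc i.
      rewrite /halves -(subnK si) exprD ler_piMl ?exprn_ge0 ?invr_ge0//.
      by rewrite exprn_ile1 ?invr_ge0// invf_le1 ?ler1n.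
    rewrite opprB; apply: le_trans h; rewrite lerBlDr addrC -lerBlDr; exact: fG.
  - apply/tends0P; apply: (@tends0_le _ _ (fun i => 4 * halves R i)) => [i|].
      rewrite graphit_distE; last 2 first.
      + by have [] := graphon_of_graphI R (G (s i)) (n0 (s i)).
      + by have [] := WI'.
      rewrite ger0_norm; first exact: W's.
      exact: (cut_dist_ge0 (graphon_of_graph_bkernel R (G (s i)) (n0 (s i))) kW').
    move=> e e0; have [N HN] := @tends0_halves R (e / 4) (divr_gt0 e0 (ltr0n _ 4)).
    by exists N => k /HN /quarter_lt; rewrite normrM (@ger0_norm _ 4).
rewrite LW => /= W'W.
have W'W0 : cut_dist W' W = 0 by apply: graphit_eq0 W'W; have [] := WI'.
have [j Hj] := halves_lt (divr_gt0 d0 (ltr0n R 4)).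
have [_ _ _] := HG (s j); apply/negP; rewrite -ltNge.
have kG := graphon_of_graph_bkernel R (G (s j)) (n0 _).
apply: le_lt_trans (cut_dist_triangle kG kW' kW) _.
rewrite W'W0 addr0; apply: le_lt_trans (W's j) _.
exact: quarter_lt (Hj j (leqnn j)).
Qed.

Hypothesis W01 : forall p, unitQ p -> W p = 0 \/ W p = 1.

Lemma stable_of_limit : stable f P.
Proof.
move=> eps eps0.
have e20 : 0 < eps / 2 by rewrite divr_gt0.
have [d d0 Hd] := norm1_of_cut_norm WI W01 e20.
have [e e0 [n0 Hn]] := extremal_close d0.
(* The successor gives the strict bound of [extremal_close] and excludes graphs without vertices. *)
exists e => //; exists n0.+1 => n1 n2 le1 le2 G1 G2 PG1 PG2 fG1 fG2.
have n10 : (0 < n1)%N by exact: leq_ltn_trans le1.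
have n20 : (0 < n2)%N by exact: leq_ltn_trans le2.
have kW : bkernel W by apply: graphon_bkernel; have [] := WI.
have near n (G : sgraph n) : (0 < n)%N -> cut_dist (WG G) W < d ->
    exists2 phi, Phi0 phi & norm1 (pullback (WG G) phi \- W) < eps / 2.
  move=> n_gt0; have kG := graphon_of_graph_bkernel R G n_gt0.
  rewrite (cut_distC kG kW) => /(cut_dist_lt kW kG)[phi p0 lt].
  have kGp := bkernel_pullback0 p0 kG.
  exists phi => //; apply: Hd; last by rewrite (cut_norm_distC kGp kW).
  by apply: graphonI_pullback => //; exact: graphon_of_graphI.
have [phi p0 h1] := near _ _ n10 (Hn _ _ le1 PG1 fG1).
have [psi q0 h2] := near _ _ n20 (Hn _ _ le2 PG2 fG2).
have kG1 := graphon_of_graph_bkernel R G1 n10.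
have kG2 := graphon_of_graph_bkernel R G2 n20.
have k1 := bkernel_pullback0 p0 kG1; have k2 := bkernel_pullback0 q0 kG2.
(* Both kernels are close to [W] after relabelling by [phi] and [psi]; undoing [phi] compares [G1]
   itself with a relabelling of [G2]. *)
have [phi' [p0' K1 K2]] := Phi0_inv p0.
apply: le_lt_trans (delta1_le _ _ n10 n20 (Phi0_comp q0 p0')) _.
have -> : norm1 (WG G1 \- pullback (WG G2) (psi \o phi')) =
    norm1 (pullback (WG G1) phi \- pullback (WG G2) psi).
  rewrite -[RHS](norm1_pullback p0' (bkernelB k1 k2)).
  apply: norm1_eq => p Qp /=; congr (_ - _).
  by rewrite -[LHS](pullbackK _ K2 Qp).
apply: le_lt_trans (norm1_triangle k1 kW k2) _.
rewrite [eps]splitr (norm1C W); exact: ltrD h1 h2.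
Qed.

End LimitImpliesStable.

(** * Stability implies a unique 0/1-valued limit *)

Section StableImpliesLimit.
Hypothesis stab : stable f P.
Hypothesis hinf : forall N : nat, exists2 n : nat, (N <= n)%N & P n !=set0.

(** [hinf] provides arbitrarily large orders, and an exact maximiser is nearly extremal for every
    tolerance; the thresholds of stability then only constrain the orders. *)
Lemma extremal_sequence : exists (n : nat -> nat) (G : forall j, sgraph (n j)),
  [/\ {homo n : i j / (i < j)%N}, forall j, (0 < n j)%N, forall j, P _ (G j),
      forall j, f _ (G j) = ex_max f P (n j) &
      forall j, delta1 R (G j) (G j.+1) < halves R j].
Proof.
have exN j : exists N : nat, forall n1 n2 : nat, (N <= n1)%N -> (N <= n2)%N ->
    forall (G1 : sgraph n1) (G2 : sgraph n2), P _ G1 -> P _ G2 ->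
    f _ G1 = ex_max f P n1 -> f _ G2 = ex_max f P n2 -> delta1 R G1 G2 < halves R j.
  have [e e0 [N HN]] := stab (halves_gt0 R j); exists N => n1 n2 h1 h2 G1 G2 P1 P2 f1 f2.
  by apply: HN => //; rewrite ?f1 ?f2 gerBl ltW.
have [N HN] := choice exN.
have exG k : exists nG : {n : nat & sgraph n}, [/\ (k < tag nG)%N, P _ (tagged nG) &
    f _ (tagged nG) = ex_max f P (tag nG)].
  have [n kn Pn] := hinf k.+1; have [G PG [fG _]] := @ex_maxP R f P n Pn.
  by exists (Tagged _ G).
have [nG HG] := choice exG.
pose n k := tag (nG k).
(* [t j] is at least the threshold [N j], and at least the previous order; since [k < n k], the
   orders [n (t j)] increase strictly. *)
pose t := fix t j := if j is i.+1 then maxn (n (t i)) (N i.+1) else N 0%N.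
have tN j : (N j <= t j)%N by case: j => [|j] //=; exact: leq_maxr.
have nt k : (k < n k)%N by have [] := HG k.
have inc j : (n (t j) < n (t j.+1))%N.
  by apply: leq_ltn_trans (nt _); exact: leq_maxl.
have ge j : (N j <= n (t j))%N by exact: leq_trans (tN j) (ltnW (nt _)).
exists (fun j => n (t j)), (fun j => tagged (nG (t j))); split.
- by apply: (homo_ltn (@ltn_trans)) => j; exact: inc.
- by move=> j; exact: leq_ltn_trans (nt _).
- by move=> j; have [] := HG (t j).
- by move=> j; have [] := HG (t j).
- move=> j; have [_ P1 f1] := HG (t j); have [_ P2 f2] := HG (t j.+1).
  apply: HN => //; exact: leq_trans (ge j) (ltnW (inc j)).
Qed.

Lemma limit_of_stable : exists W : sqfun R,
  [/\ is_graphonI W, forall x y, unitI x -> unitI y -> W (x, y) = 0 \/ W (x, y) = 1 &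
      LIM f P = [set graphit W]].
Proof.
have [n [G [ninc n0 PG fG dG]]] := extremal_sequence.
pose V j := @graphon_of_graph R (n j) (G j).
have VI j : is_graphonI (V j) by exact: graphon_of_graphI.
have kV j : bkernel (V j) by exact: graphon_of_graph_bkernel.
have exphi j : exists phi, Phi0 phi /\ norm1 (V j \- pullback (V j.+1) phi) < halves R j.
  by have [phi p0 lt] := delta1_lt (n0 j) (n0 j.+1) (dG j); exists phi.
have [phi Hphi] := choice exphi.
have ap : forall j, Phi0 (align phi j) by apply: align_Phi0 => j; have [] := Hphi j.
have [j|j|L LI HL] := @norm1_limit R (fun j => pullback (V j) (align phi j)).
- exact: graphonI_pullback.
- have kD : bkernel (V j \- pullback (V j.+1) (phi j)).
    by apply: bkernelB => //; apply: bkernel_pullback0 => //; have [] := Hphi j.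
  by rewrite alignE (norm1_pullback (ap j) kD); have [_ /ltW] := Hphi j.
have [W [WI W01 HW]] := round01 LI.
have kW : bkernel W by apply: graphon_bkernel; have [] := WI.
(* Rounding doubles the L1 error [2 * halves j] of the limit, hence the constant 4. *)
have VW j : cut_dist (V j) W <= 4 * halves R j.
  have kA := bkernel_pullback0 (ap j) (kV j).
  rewrite [leLHS](cut_distC (kV j) kW).
  apply: le_trans (cut_dist_le kW (kV j) (ap j)) _.
  apply: le_trans (cut_norm_le_norm1 (bkernelB kW kA)) _; rewrite norm1C.
  apply: le_trans (HW _ kA _) _; last first.
    by have := HL j; rewrite -(ler_pM2l (ltr0n R 2)) mulrA -natrM.
  by move=> [x y] _; exact: graphon_of_graph01.
have halves4 (e : R) : 0 < e -> exists N, forall j, (N <= j)%N -> 4 * halves R j < e.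
  move=> e0; have [N HN] := halves_lt (divr_gt0 e0 (ltr0n R 4)).
  by exists N => j /HN /quarter_lt.
have gG k (F : sgraph k) : (0 < k)%N -> is_graphon (WG F).
  by move=> k0; have [] := graphon_of_graphI R F k0.
have gW : is_graphon W by have [] := WI.
exists W; split=> [//|x y _ _|]; first exact: W01.
apply/seteqP; split => [x|_ ->]; last first.
  split; first by exists W.
  exists n, G; split => //.
  - by apply/tends0P; apply: (tends0_eq _ (@tends0_cst0 R)) => i; rewrite fG subrr.
  - apply/tends0P => e /halves4[N HN]; exists N => k /HN.
    rewrite graphit_distE//; last exact: gG.
    rewrite (ger0_norm (cut_dist_ge0 (kV k) kW)); exact: (le_lt_trans (VW k)).
(* Uniqueness: [W'] is near some [G' i], which stability puts near [G j], which is near [W]. Each of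
   the three distances takes a third of [e]. *)
move=> [[W' WI' <-] [n' [G' [ninc' PG' /tends0P fG' /tends0P dG']]]].
have gW' : is_graphon W' by have [] := WI'.
have kW' := graphon_bkernel gW'.
apply: graphit_eq => //; apply/le_anti; rewrite cut_dist_ge0// andbT.
apply/ler_addgt0Pr => e e0; rewrite add0r.
have e30 : 0 < e / 3 by rewrite divr_gt0.
have [eps' eps'0 [m0 Hm]] := stab e30.
have [N1 H1] := fG' _ eps'0; have [N2 H2] := dG' _ e30; have [N3 H3] := halves4 _ e30.
(* The successor makes [i], and with it the order [n' i], positive. *)
pose i := (maxn (maxn N1 N2) m0).+1; pose j := maxn N3 m0.
have iN1 : (N1 <= i)%N by rewrite leqW// !leq_max leqnn.
have iN2 : (N2 <= i)%N by rewrite leqW// !leq_max leqnn orbT.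
have im : (m0 <= n' i)%N.
  by apply: leq_trans (homo_ltn_ge ninc' i); rewrite leqW// !leq_max leqnn !orbT.
have n'0 : (0 < n' i)%N by apply: leq_trans (homo_ltn_ge ninc' i).
have jm : (m0 <= n j)%N by apply: leq_trans (homo_ltn_ge ninc j); rewrite leq_maxr.
have kG' := graphon_bkernel (gG _ (G' i) n'0).
have d1 : delta1 R (G' i) (G j) < e / 3.
  apply: Hm => //; last by rewrite fG gerBl ltW.
  have := H1 i iN1; rewrite ltr_norml => /andP[/ltW + _].
  by rewrite lerBrDr addrC.
have [psi q0 c1] := delta1_lt n'0 (n0 j) d1.
have c1' : cut_dist (WG (G' i)) (V j) <= e / 3.
  have kP := bkernelB kG' (bkernel_pullback0 q0 (kV j)).
  apply: le_trans (cut_dist_le kG' (kV j) q0) _.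
  exact: (le_trans (cut_norm_le_norm1 kP) (ltW c1)).
have c2 : cut_dist (WG (G' i)) W' <= e / 3.
  have := H2 i iN2; rewrite (graphit_distE (gG _ (G' i) n'0) gW') => /ltW.
  exact: (le_trans (ler_norm _)).
have c3 : cut_dist (V j) W <= e / 3.
  by apply: le_trans (VW j) (ltW (H3 _ _)); rewrite leq_maxl.
apply: le_trans (cut_dist_triangle kW' kG' kW) _.
rewrite [X in X + _](cut_distC kW' kG').
rewrite -[leRHS](splitr3 e).
apply: (lerD c2); apply: le_trans (cut_dist_triangle kG' (kV j) kW) _.
exact: (lerD c1' c3).
Qed.

End StableImpliesLimit.
End Stability.

Theorem theorem15 (R : realType) (P : graph_class) (f : forall n, sgraph n -> R)
    (hP : graph_property P) (hf : graph_parameter f)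
    (hinf : forall N : nat, exists2 n : nat, (N <= n)%N & P n !=set0) :
  stable f P <->
  exists W : sqfun R,
    [/\ is_graphonI W,
        forall x y, unitI x -> unitI y -> W (x, y) = 0 \/ W (x, y) = 1
      & LIM f P = [set graphit W]].
Proof.
split=> [stab|[W [WI W01 LW]]]; first exact: limit_of_stable.
by apply: stable_of_limit WI LW _ => -[x y] [/= Ix Iy]; exact: W01.
Qed.
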